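(* For every positive integer $n$ there is a polyhedral $3$-sphere (a polyhedral cell complex homeomorphic to the $3$-sphere) with $5n/2+o(n)$ vertices whose facets are $6n+o(n)$ tetrahedra and $n^2/2+o(n)$ cells combinatorially equivalent to a triangular bipyramid (asymptotic notation as $n\to\infty$).
   Context: A triangular bipyramid is the unique simplicial $3$-polytope with $5$ vertices; combinatorially it is the free sum $\Delta^1\oplus\Delta^2$ of a segment and a triangle, i.e. its boundary complex is the join $\partial\Delta^1 * \partial\Delta^2$. *)

(* Defs.v *)
From HB Require Import structures.
From mathcomp Require Import all_boot all_order all_algebra.
From mathcomp Require Import all_classical all_reals all_analysis.

Set Implicit Arguments.
Unset Strict Implicit.
Unset Printing Implicit Defensive.

Import Order.TTheory GRing.Theory Num.Theory.
Import numFieldNormedType.Exports.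

Local Open Scope classical_set_scope.
Local Open Scope ring_scope.

Section Polytopes.
Variable R : realType.

Definition dot (d : nat) (c x : 'rV[R]_d) : R := \sum_(i < d) c 0 i * x 0 i.

Definition conv (d : nat) (A : set 'rV[R]_d) : set 'rV[R]_d :=
  smallest (@convex_set R 'rV[R]_d) A.

Definition polytope (d : nat) (P : set 'rV[R]_d) : Prop :=
  exists2 A : set 'rV[R]_d, finite_set A & P = conv A.

(* The faces cut out by valid inequalities dot c x <= b. The choice c = 0 gives
   both improper faces: P itself (b = 0) and the empty face (b = 1). *)
Definition face (d : nat) (P : set 'rV[R]_d) : set (set 'rV[R]_d) :=
  [set F | exists c : 'rV[R]_d, exists b : R,
     (forall x, P x -> dot c x <= b) /\ F = [set x | P x /\ dot c x = b]].

Definition comb_equiv (d e : nat) (P : set 'rV[R]_d) (Q : set 'rV[R]_e) : Prop :=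
  exists phi : set 'rV[R]_d -> set 'rV[R]_e,
    set_bij (face P) (face Q) phi /\
    forall F G, face P F -> face P G -> (F `<=` G <-> phi F `<=` phi G).

Definition tetrahedron : set 'rV[R]_3 :=
  conv (0 |` range (fun i : 'I_3 => delta_mx 0 i)).

(* The free sum requires 0 to lie in the relative interior of both summands. *)
Definition free_sum (d e : nat) (P : set 'rV[R]_d) (Q : set 'rV[R]_e) :
    set 'rV[R]_(d + e) :=
  conv ([set row_mx x 0 | x in P] `|` [set row_mx 0 y | y in Q]).

Definition segment : set 'rV[R]_1 :=
  conv [set const_mx 1; const_mx (- 1)].

Definition triangle : set 'rV[R]_2 :=
  conv [set delta_mx 0 0; delta_mx 0 1; const_mx (- 1)].

Definition triangular_bipyramid : set 'rV[R]_(1 + 2) :=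
  free_sum segment triangle.

End Polytopes.

Arguments tetrahedron : clear implicits.
Arguments triangular_bipyramid : clear implicits.

(* The data of a finite cell complex: each cell is the image in X, under its
   characteristic map (chart), of a convex polytope in its own ambient space. *)
Record cell_family (R : realType) (X : topologicalType) := CellFamily {
  cell : finType;
  ambient : cell -> nat;
  poly : forall i : cell, set 'rV[R]_(ambient i);
  chart : forall i : cell, 'rV[R]_(ambient i) -> X }.

Arguments poly {R X} K i _ : rename.
Arguments chart {R X} K i _ : rename.

Section PolyhedralComplexes.
Variables (R : realType) (X : topologicalType) (K : cell_family R X).

Definition body (i : cell K) : set X := chart K i @` poly K i.

Definition cell_face (i : cell K) (A : set X) : Prop :=
  exists2 F, face (poly K i) F & A = chart K i @` F.

(* Faces of the polytopes are mapped onto cells, and two cells meet in a common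
   face (take both (i, j) and (j, i) in pc_meet). As usual for polyhedral
   complexes, the empty face is one of the cells. Since X is Hausdorff, a
   continuous injective map on a (compact) polytope is a homeomorphism onto its
   image. *)
Record polyhedral_complex : Prop := PolyhedralComplex {
  pc_hausdorff : hausdorff_space X;
  pc_polytope : forall i : cell K, polytope (poly K i);
  pc_continuous : forall i : cell K,
    {within poly K i, continuous (chart K i)};
  pc_injective : forall i : cell K, set_inj (poly K i) (chart K i);
  pc_body_inj : injective body;
  pc_cover : \bigcup_(i in [set: cell K]) body i = [set: X];
  pc_face : forall (i : cell K) (A : set X),
    cell_face i A -> exists j : cell K, body j = A;
  pc_meet : forall i j : cell K, cell_face i (body i `&` body j) }.

Definition is_vertex (i : cell K) : Prop := exists x, body i = [set x].

Definition is_facet (i : cell K) : Prop :=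
  forall j : cell K, body i `<=` body j -> j = i.

Definition is_tetrahedral_facet (i : cell K) : Prop :=
  is_facet i /\ comb_equiv (poly K i) (tetrahedron R).

Definition is_bipyramidal_facet (i : cell K) : Prop :=
  is_facet i /\ comb_equiv (poly K i) (triangular_bipyramid R).

Definition vertices : nat := #|[pred i : cell K | `[< is_vertex i >]]|.

Definition tetrahedra : nat := #|[pred i : cell K | `[< is_tetrahedral_facet i >]]|.

Definition bipyramids : nat := #|[pred i : cell K | `[< is_bipyramidal_facet i >]]|.

End PolyhedralComplexes.

Definition sphere3 (R : realType) : set 'rV[R]_4 :=
  [set x | \sum_(i < 4) x 0 i ^+ 2 = 1].

Arguments sphere3 : clear implicits.

Definition homeomorphic_sphere3 (R : realType) (X : topologicalType) : Prop :=
  exists f : X -> 'rV[R]_4, exists g : 'rV[R]_4 -> X,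
    [/\ continuous f, {within sphere3 R, continuous g},
        range f = sphere3 R & cancel f g].

(* Main.v *)
(* Take the join of a cycle of length n+2 and a cycle of length n+1: a triangulated 3-sphere whose
   tetrahedra a_i a_(i+1) b_j b_(j+1) are the squares (i, j) of a toroidal grid. Leave one row and one
   column of squares alone and cut the remaining (n+1) x n rectangle into the diagonal slabs
   4k <= i+j < 4k+4. Every slab is a 3-ball; replace it by the cone with a new apex v_k over its
   boundary. This leaves the sphere unchanged up to homeomorphism, since a slab can be swallowed by
   its cone one tetrahedron at a time, each time by a bistellar move. The triangles on the boundary
   staircases of a slab can now be paired within the squares i+j = 0 or 3 (mod 4) next to them: two
   triangles with a common edge a_i b_j form, together with v_k, a bipyramid with axis the opposite
   edge of the square. Thickness 4 is just what makes all those axes distinct and turns all of them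
   into non-edges, so that the bipyramids intersect each other properly. This gives n(n-1)/2 + O(1)
   bipyramids and 7n + O(1) remaining tetrahedra; gluing n of the latter in pairs, in the column left
   alone, corrects both numbers by the missing n/2 and -n. *)
Require Import Defs.
From HB Require Import structures.
From mathcomp Require Import all_boot all_order all_algebra.
From mathcomp Require Import all_classical all_reals all_analysis.
From mathcomp Require Import fintype finset ring lra zify.

Set Implicit Arguments.
Unset Strict Implicit.
Unset Printing Implicit Defensive.

Import Order.TTheory GRing.Theory Num.Theory.
Import numFieldNormedType.Exports.

Local Open Scope classical_set_scope.
Local Open Scope ring_scope.

(** * Faces of convex hulls *)

(** Everything is reduced to finite combinatorics: a space is the set of barycentric coordinates of
    an abstract complex, and a homeomorphism is a piecewise linear exchange of weight between two
    vertex sets. The obstacle is that two adjacent tetrahedra never form a convex set in such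
    coordinates, their five vertices being affinely independent, so a bipyramidal cell is
    parametrised by folding a convex model along its triangle. The number 4 comes from the
    following. An edge a_x b_y lies in squares with index sums x+y-2, x+y-1 and x+y. Away from the
    border of the grid, it is therefore interior to a slab exactly when x+y is 2 or 3 mod 4. The
    bipyramids at a lower staircase have axes in the class 2, those at an upper staircase in the
    class 3. With thickness 3 there would be a single class of interior edges, and both staircases
    would compete for it. *)

Section ConvexCombinations.
Variables (R : realType) (d : nat) (I : finType).
Implicit Types (p : I -> 'rV[R]_d) (T U : {set I}) (x : I -> R).

Definition comb p x : 'rV[R]_d := \sum_i x i *: p i.

(** Subsets [T] of one fixed index type let a single family of points describe all faces of a
    polytope; weights vanish off [T] instead of having [T] as their domain. *)
Definition weight T : set (I -> R) :=
  [set x | [/\ forall i, 0 <= x i, \sum_i x i = 1 &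
               forall i, i \notin T -> x i = 0]].

Definition hull p T : set 'rV[R]_d := [set comb p x | x in weight T].

Lemma weight_ind T i : i \in T -> weight T (fun j => (j == i)%:R).
Proof.
move=> iT; split=> [j||j jT]; first exact: ler0n.
- rewrite (bigD1 i)//= eqxx big1 ?addr0// => j /negPf->//.
- by case: eqP jT => // ->; rewrite iT.
Qed.

Lemma comb_ind p i : comb p (fun j => (j == i)%:R) = p i.
Proof.
rewrite /comb (bigD1 i)//= eqxx scale1r big1 ?addr0// => j /negPf->.
by rewrite scale0r.
Qed.

Lemma hull_pt p T i : i \in T -> hull p T (p i).
Proof. by move=> iT; exists (fun j => (j == i)%:R); [exact: weight_ind|exact: comb_ind]. Qed.

Lemma weightS T U x : T \subset U -> weight T x -> weight U x.
Proof.
move=> /fintype.subsetP TU [x0 x1 xT]; split=> // i iU; apply: xT.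
by apply: contra iU => /TU.
Qed.

Lemma hull_convex p T : convex_set (hull p T).
Proof.
move=> _ _ l /set_mem[x [x0 x1 xT] <-] /set_mem[y [y0 y1 yT] <-].
apply/mem_set; exists (fun i => l%:num * x i + (1 - l%:num) * y i).
  split=> [i||i iT]; last by rewrite xT// yT// !mulr0 addr0.
    by apply: addr_ge0; apply: mulr_ge0 => //; rewrite subr_ge0.
  by rewrite big_split/= -!mulr_sumr x1 y1 !mulr1 addrC subrK.
rewrite /comb [RHS]/conv/= !scaler_sumr -big_split/=.
by apply: eq_bigr => i _; rewrite !scalerA scalerDl.
Qed.

(** Convexity provides only binary combinations: an index of nonzero weight is split off, the other
    weights are divided by [1 - x i], and the induction is on the number of indices. *)
Lemma comb_in_convex (M : set 'rV[R]_d) p n T x :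
  @convex_set R 'rV[R]_d M -> (forall i, i \in T -> M (p i)) ->
  (#|T| <= n)%N -> weight T x -> M (comb p x).
Proof.
move=> cM; elim: n T x => [|n IH] T x pM.
  rewrite leqn0 cards_eq0 => /eqP-> [x0 x1 xT].
  move: x1; rewrite big1 => [/esym/eqP|i _]; first by rewrite oner_eq0.
  by rewrite xT// inE.
move=> Tn [x0 x1 xT].
have [i xi] : exists i, x i != 0.
  apply: contrapT => /forallNP h; move: x1; rewrite big1 => [/esym/eqP|i _].
    by rewrite oner_eq0.
  by apply/eqP; apply: contrapT => /negP; exact: h.
have iT : i \in T by apply: contraT => /xT/eqP; rewrite (negPf xi).
have x1' : x i + \sum_(j | j != i) x j = 1 by rewrite -x1 [in RHS](bigD1 i).
(* If all the weight sits at [i], there is nothing left to rescale. *)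
have [xi1|xi1] := eqVneq (x i) 1.
  have z j : j != i -> x j = 0.
    move: x1'; rewrite xi1 -[RHS]addr0 => /addrI/eqP.
    by rewrite psumr_eq0// => /allP/(_ j) h ji; apply/eqP; apply: (implyP (h _)).
  rewrite /comb (bigD1 i)//= big1 => [|j /z->]; last by rewrite scale0r.
  by rewrite xi1 scale1r addr0; exact: pM.
have s0 : 0 <= \sum_(j | j != i) x j by apply: sumr_ge0.
have xi0 : 0 <= x i <= 1 by rewrite x0/= -x1' lerDl.
pose l : {i01 R} := Itv01 (proj1 (andP xi0)) (proj2 (andP xi0)).
have d0 : 0 < 1 - x i by rewrite subr_gt0 lt_neqAle xi1 (andP xi0).2.
pose y j := if j == i then 0 else x j / (1 - x i).
have wy : weight (T :\ i)%SET y.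
  split=> [j||j]; rewrite /y.
  - by case: ifP => // _; rewrite divr_ge0// ltW.
  - rewrite (bigD1 i)//= eqxx add0r (eq_bigr (fun j => x j / (1 - x i))); last first.
      by move=> j /negPf->.
    rewrite -mulr_suml (_ : \sum_(j | j != i) x j = 1 - x i) ?divff ?gt_eqF//.
    by rewrite -x1' addrAC subrr add0r.
  - by rewrite finset.in_setD1; case: eqVneq => //= _ /xT->; rewrite mul0r.
have -> : comb p x = conv l (p i : convex_lmodType _) (comb p y).
  rewrite [RHS]/conv/= /comb (bigD1 i)//=; congr (_ + _).
  rewrite [in RHS](bigD1 i)//= {1}/y eqxx scale0r add0r scaler_sumr.
  apply: eq_bigr => j /negPf ji; rewrite /y ji scalerA mulrCA divff ?mulr1//.
  exact: lt0r_neq0.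
apply/set_mem/cM; apply/mem_set; first exact: pM.
apply: IH wy; first by move=> j /finset.setD1P[_ /pM].
by move: Tn; rewrite (cardsD1 i) iT ltnS.
Qed.

Lemma conv_hull p T : Defs.conv (p @` [set` T]) = hull p T.
Proof.
apply/seteqP; split.
  apply: smallest_sub; first exact: hull_convex.
  by move=> _ [i iT <-]; exact: hull_pt.
move=> _ [x wx <-] M [cM pM]; apply: comb_in_convex wx => //.
by move=> i iT; apply: pM; exists i.
Qed.

Lemma polytope_hull p T : polytope (hull p T).
Proof.
exists (p @` [set` T]); last by rewrite conv_hull.
exact/finite_image/finite_finset.
Qed.

Lemma hullS p T U : T \subset U -> hull p T `<=` hull p U.
Proof. by move=> TU _ [x wx <-]; exists x => //; exact: weightS wx. Qed.

Lemma dot_comb p x (c : 'rV[R]_d) : dot c (comb p x) = \sum_i x i * dot c (p i).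
Proof.
rewrite /dot /comb; under eq_bigr do rewrite summxE mulr_sumr.
rewrite exchange_big/=; apply: eq_bigr => i _; rewrite mulr_sumr.
by apply: eq_bigr => j _; rewrite mxE mulrCA.
Qed.

(* The vertex sets [U] of the faces of [hull p T]. *)
Definition facial p T U : Prop :=
  U \subset T /\ exists (c : 'rV[R]_d) (b : R),
    forall i, i \in T -> dot c (p i) <= b ?= iff (i \in U).

(** The slacks [b - dot c (p i)] are nonnegative, so a convex combination attains the bound [b] only
    if it charges no index of positive slack. From here on, faces are handled through their index
    sets. *)
Lemma facialP p T (F : set 'rV[R]_d) :
  Defs.face (hull p T) F <-> exists2 U, facial p T U & F = hull p U.
Proof.
have key c b U : U \subset T ->
    (forall i, i \in T -> dot c (p i) <= b ?= iff (i \in U)) ->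
    [set x | hull p T x /\ dot c x = b] = hull p U.
  move=> UT h; apply/seteqP; split.
    move=> _ [[x [x0 x1 xT] <-]]; rewrite dot_comb => e; exists x => //; split=> // i iU.
    have [iT|/xT//] := boolP (i \in T).
    have : \sum_i x i * (b - dot c (p i)) = 0.
      under eq_bigr do rewrite mulrBr.
      by rewrite sumrB -mulr_suml x1 mul1r e subrr.
    move/eqP; rewrite psumr_eq0 => [/allP/(_ i (mem_index_enum _))/= /eqP/eqP|j _]; last first.
      have [/h jT|/xT->] := boolP (j \in T); last by rewrite mul0r.
      by rewrite mulr_ge0// subr_ge0 jT.
    rewrite mulf_eq0 subr_eq0 => /orP[/eqP//|]; rewrite eq_sym h// (negPf iU)//.
  move=> _ [x wx <-]; split; first by exists x => //; exact: weightS wx.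
  have [x0 x1 xU] := wx.
  rewrite dot_comb -[RHS]mul1r -x1 mulr_suml; apply: eq_bigr => i _.
  have [iU|/xU->] := boolP (i \in U); last by rewrite !mul0r.
  by congr (_ * _); apply/eqP; rewrite h// (fintype.subsetP UT).
split=> [[c [b [cb ->]]]|[U [UT [c [b h]]] ->]].
  pose U := [set i in T | dot c (p i) == b]%SET.
  have UT : U \subset T by apply/fintype.subsetP => i; rewrite inE => /andP[].
  have h i : i \in T -> dot c (p i) <= b ?= iff (i \in U).
    by move=> iT; split; [apply: cb; exact: hull_pt|rewrite inE iT].
  by exists U; [split=> //; exists c, b|exact: key].
exists c, b; split; last by rewrite (key c b U).
move=> _ [x [x0 x1 xT] <-]; rewrite dot_comb -[leRHS]mul1r -x1 mulr_suml.
apply: ler_sum => i _; have [iT|/xT->] := boolP (i \in T); last by rewrite !mul0r.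
by rewrite ler_wpM2l// h.
Qed.

(** The functional cutting out [W] is strictly below its bound at every other index of [T], so no
    such point lies in [hull p W]. *)
Lemma sub_hull p T U W : facial p T W -> U \subset T ->
  hull p U `<=` hull p W -> U \subset W.
Proof.
move=> [WT [c [b h]]] UT UW; apply/fintype.subsetP => i iU.
have [x [x0 x1 xW] e] := UW _ (hull_pt p iU).
rewrite -h ?(fintype.subsetP UT)// -e dot_comb -[X in _ == X]mul1r -x1 mulr_suml.
apply/eqP; apply: eq_bigr => j _.
have [jW|/xW->] := boolP (j \in W); last by rewrite !mul0r.
by congr (_ * _); apply/eqP; rewrite h// (fintype.subsetP WT).
Qed.

Lemma hull_inj p T U W : facial p T U -> facial p T W ->
  hull p U = hull p W -> U = W.
Proof.
move=> fU fW e; apply/eqP; rewrite finset.eqEsubset.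
by rewrite (sub_hull fW (proj1 fU))// ?e//; apply: (sub_hull fU (proj1 fW)); rewrite e.
Qed.

End ConvexCombinations.

Section CombinatorialEquivalence.
Variables (R : realType) (d e : nat) (I : finType).
Variables (p : I -> 'rV[R]_d) (q : I -> 'rV[R]_e).

(** The bijection sends [hull p U] to [hull q U]; by [hull_inj] a face determines its facial set, so
    this is well defined. *)
Lemma comb_equiv_hull (T : {set I}) :
  (forall U, facial p T U <-> facial q T U) ->
  comb_equiv (hull p T) (hull q T).
Proof.
move=> pq.
have s F : exists U, Defs.face (hull p T) F -> facial p T U /\ F = hull p U.
  by have [/facialP[U fU ->]|] := pselect (Defs.face (hull p T) F);
     [exists U|exists T].
have {s} [s sP] := choice s.
exists (fun F => hull q (s F)); split.
  split.
  - by move=> F /sP[fs _]; apply/facialP; exists (s F) => //; exact/pq.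
  - move=> F G /set_mem/sP[fF eF] /set_mem/sP[fG eG] /(hull_inj (proj1 (pq _) fF) (proj1 (pq _) fG)) h.
    by rewrite eF eG h.
  - move=> _ /facialP[U fU ->]; exists (hull p U).
      by apply/facialP; exists U => //; exact/pq.
    have [fs h] := sP (hull p U) (proj2 (facialP _ _ _) (ex_intro2 _ _ U (proj2 (pq _) fU) erefl)).
    by congr hull; apply: (hull_inj fs (proj2 (pq _) fU)).
move=> F G /sP[fF eF] /sP[fG eG]; split.
  by rewrite {1}eF {1}eG => /(sub_hull fG (proj1 fF)); exact: hullS.
move=> /(sub_hull (proj1 (pq _) fG) (proj1 fF)) h.
by rewrite eF eG; exact: hullS.
Qed.

End CombinatorialEquivalence.

(** * Recognising tetrahedra and triangular bipyramids *)

Section PolytopeTypes.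
Variable R : realType.

Lemma hull_comp d (I J : finType) (p : I -> 'rV[R]_d) (f : J -> I) (T : {set J}) :
  hull (p \o f) T = hull p (f @: T)%SET.
Proof.
rewrite -!conv_hull; congr Defs.conv; apply/seteqP; split=> [_ [j jT <-]|_ [i /imsetP[j jT ->] <-]].
  by exists (f j) => //=; exact: imset_f.
by exists j.
Qed.

Lemma facial_comp d (I J : finType) (p : I -> 'rV[R]_d) (f : J -> I) (T U : {set J}) :
  injective f -> facial (p \o f) T U <-> facial p (f @: T)%SET (f @: U)%SET.
Proof.
move=> fI; split=> -[UT [c [b h]]].
  split; first exact: imsetS.
  by exists c, b => _ /imsetP[j jT ->]; rewrite mem_imset//; exact: h.
split.
  by apply/fintype.subsetP => j jU; have := fintype.subsetP UT _ (imset_f f jU); rewrite mem_imset.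
by exists c, b => j jT; have := h _ (imset_f f jT); rewrite mem_imset.
Qed.

(** Affine independence in dual form: every slack function on [T] comes from an affine function.
    Supporting hyperplanes can be read off directly from this form. *)
Definition affinely_free d (I : finType) (p : I -> 'rV[R]_d) (T : {set I}) : Prop :=
  forall h : I -> R, exists (c : 'rV[R]_d) (b : R), forall i, i \in T -> dot c (p i) = b - h i.

(** The prescribed slack is the indicator of the complement of [U]. *)
Lemma facial_free d (I : finType) (p : I -> 'rV[R]_d) (T U : {set I}) :
  affinely_free p T -> facial p T U <-> U \subset T.
Proof.
move=> fp; split=> [[]//|UT]; split=> //.
have [c [b h]] := fp (fun i => (i \notin U)%:R).
exists c, b => i /h->; split; first by rewrite gerBl ler0n.
by rewrite -subr_eq0 addrAC subrr sub0r oppr_eq0 pnatr_eq0 eqb0 negbK.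
Qed.

Definition bipyramid_set (I : finType) (i0 i1 x y z : I) : {set I} := [set i0; i1; x; y; z]%SET.

(* Up to affine equivalence, [i0] and [i1] index the apices and [x], [y], [z] the equator:
   the midpoint of the axis is the barycentre of the triangle, and this is the only
   affine relation between the five points. *)
Definition bipyramidal d (I : finType) (p : I -> 'rV[R]_d) (i0 i1 x y z : I) : Prop :=
  (forall c : 'rV[R]_d, dot c (p i0) + dot c (p i1)
       = 2 / 3 * (dot c (p x) + dot c (p y) + dot c (p z))) /\
  (forall h : I -> R, h i0 + h i1 = 2 / 3 * (h x + h y + h z) ->
     exists (c : 'rV[R]_d) (b : R),
       forall i, i \in bipyramid_set i0 i1 x y z -> dot c (p i) = b - h i).

(** The proper faces form the join of the boundary of the axis with the boundary of the equatorial
    triangle. *)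
Definition bipyramid_facial (I : finType) (i0 i1 x y z : I) (U : {set I}) : Prop :=
  U \subset bipyramid_set i0 i1 x y z /\
  (U = bipyramid_set i0 i1 x y z \/
   ~~ ((i0 \in U) && (i1 \in U)) /\ ~~ [&& x \in U, y \in U & z \in U]).

(** The affine relation between the points passes to their slacks with respect to a supporting
    hyperplane. As slacks are nonnegative, a face with both apices or with the whole equator has all
    slacks zero. *)
Lemma facial_bipyramid d (I : finType) (p : I -> 'rV[R]_d) (i0 i1 x y z : I) (U : {set I}) :
  uniq [:: i0; i1; x; y; z] -> bipyramidal p i0 i1 x y z ->
  facial p (bipyramid_set i0 i1 x y z) U <-> bipyramid_facial i0 i1 x y z U.
Proof.
move=> un [pr ph]; set T := bipyramid_set _ _ _ _ _.
have [i0T i1T xT yT zT] : [/\ i0 \in T, i1 \in T, x \in T, y \in T & z \in T].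
  by rewrite !inE !eqxx ?orbT.
split=> [[UT [c [b h]]]|[UT TU]].
  split=> //.
  have H i : i \in T -> exists2 e : R, 0 <= e & dot c (p i) = b - e /\ (i \in U) = (e == 0).
    move=> /h hi; exists (b - dot c (p i)); first by rewrite subr_ge0 hi.
    by rewrite subKr -hi subr_eq0 eq_sym.
  have full : i0 \in U -> i1 \in U -> x \in U -> y \in U -> z \in U -> U = T.
    move=> *; apply/eqP; rewrite finset.eqEsubset UT/=.
    by apply/fintype.subsetP => i; rewrite !inE => /orP[/orP[/orP[/orP[]|]|]|] /eqP->.
  have [e0 e0p [d0 m0]] := H _ i0T; have [e1 e1p [d1 m1]] := H _ i1T.
  have [ex exp [dx mx]] := H _ xT; have [ey eyp [dy my]] := H _ yT.
  have [ez ezp [dz mz]] := H _ zT.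
  have := pr c; rewrite d0 d1 dx dy dz => rel.
  have rel' : e0 + e1 = 2 / 3 * (ex + ey + ez) by lra.
  rewrite m0 m1 mx my mz in full *.
  have [/andP[/eqP z0 /eqP z1]|n01] := boolP (_ && _).
    by left; apply: full; apply/eqP; lra.
  have [/and3P[/eqP zx /eqP zy /eqP zz]|nxyz] := boolP [&& _, _ & _]; last by right.
  by left; apply: full; apply/eqP; lra.
case: TU => [->|[n01 nxyz]].
  split=> //; exists 0, 0 => i iT; rewrite iT /dot big1; first exact: leif_refl.
  by move=> j _; rewrite mxE mul0r.
split=> //.
pose u i : R := (i \notin U)%:R.
have u0 i : 0 <= u i by exact: ler0n.
have uU i : (u i == 0) = (i \in U) by rewrite pnatr_eq0 eqb0 negbK.
pose s := u i0 + u i1; pose t := u x + u y + u z.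
have s0 : 0 < s.
  rewrite lt_neqAle addr_ge0// andbT eq_sym paddr_eq0// !uU//.
have t0 : 0 < t.
  by rewrite lt_neqAle !addr_ge0// andbT eq_sym !paddr_eq0 ?addr_ge0// !uU// -andbA.
(* Indicator slacks, weighted so that both sides of the relation become [2 * s * t]. The factors are
   positive because [U] misses an apex and an equatorial point. *)
pose h i := if (i == i0) || (i == i1) then 2 * t * u i else 3 * s * u i.
have [] := ph h.
  move: un; rewrite /= !inE !negb_or -!andbA => /and5P[_ a1 a2 a3 /and4P[b1 b2 b3 _]].
  rewrite /h !eqxx orbT/= ![_ == i0]eq_sym ![_ == i1]eq_sym.
  rewrite (negPf a1) (negPf a2) (negPf a3) (negPf b1) (negPf b2) (negPf b3) /=.
  by rewrite /s /t; field.
move=> c [b hc]; exists c, b => i /hc->.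
have hu : h i = 0 <-> i \in U.
  rewrite -uU /h; case: ifP => _; split=> [/eqP|/eqP->]; rewrite ?mulr0//.
    by rewrite mulf_eq0 mulf_eq0 pnatr_eq0/= gt_eqF.
  by rewrite mulf_eq0 mulf_eq0 pnatr_eq0/= gt_eqF.
split; first by rewrite gerBl /h; case: ifP => _; rewrite !mulr_ge0// ltW.
by rewrite -subr_eq0 addrAC subrr sub0r oppr_eq0; apply/eqP/idP; move/hu.
Qed.

Definition tetrahedron_vertex (i : 'I_4) : 'rV[R]_3 :=
  if unlift ord0 i is Some j then delta_mx 0 j else 0.

Lemma tetrahedronE : tetrahedron R = hull tetrahedron_vertex [set: 'I_4]%SET.
Proof.
rewrite -conv_hull; congr Defs.conv; apply/seteqP; split=> x.
  move=> [->|[j _ <-]]; first by exists ord0; rewrite /= ?inE// /tetrahedron_vertex unlift_none.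
  by exists (lift ord0 j); rewrite /= ?inE// /tetrahedron_vertex liftK.
move=> [i _ <-]; rewrite /tetrahedron_vertex; case: unliftP => [j _|_]; last by left.
by right; exists j.
Qed.

Lemma dot_delta n (c : 'rV[R]_n) i : dot c (delta_mx 0 i) = c 0 i.
Proof.
rewrite /dot (bigD1 i)//= big1 => [|j /negPf ji]; last by rewrite mxE ji andbF mulr0.
by rewrite mxE !eqxx mulr1 addr0.
Qed.

Lemma tetrahedron_free : affinely_free tetrahedron_vertex [set: 'I_4]%SET.
Proof.
move=> h; exists (\row_j (h ord0 - h (lift ord0 j))), (h ord0) => i _.
rewrite /tetrahedron_vertex; case: unliftP => [j ->|->].
  by rewrite dot_delta mxE.
by rewrite subrr /dot big1// => j _; rewrite [X in _ * X]mxE mulr0.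
Qed.

Definition bipyramid_vertex (i : 'I_5) : 'rV[R]_(1 + 2) :=
  nth 0 [:: row_mx (const_mx 1) 0; row_mx (const_mx (- 1)) 0;
            row_mx 0 (delta_mx 0 0); row_mx 0 (delta_mx 0 1);
            row_mx 0 (const_mx (- 1))] i.

Local Notation o5 k := (Ordinal (isT : (k < 5)%N)).

Lemma bipyramid_setT : bipyramid_set (o5 0) (o5 1) (o5 2) (o5 3) (o5 4) = [set: 'I_5]%SET.
Proof.
by apply/setP => -[[|[|[|[|[|//]]]]] h]; rewrite !inE -!val_eqE.
Qed.

(** The free sum is a hull of two embedded hulls. An affine map carries the hull of [A] into every
    convex set containing the image of [A], which reduces both hulls to their five vertices. *)
Lemma bipyramidE : triangular_bipyramid R = hull bipyramid_vertex [set: 'I_5]%SET.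
Proof.
set H := hull _ _.
have HI (k : 'I_5) : H (bipyramid_vertex k) by apply: hull_pt; rewrite inE.
have cH : convex_set H by exact: hull_convex.
have sub n (f : 'rV[R]_n -> 'rV[R]_(1 + 2)) (A : set 'rV[R]_n) :
    (forall a b (l : {i01 R}), f (l%:num *: a + (1 - l%:num) *: b) = l%:num *: f a + (1 - l%:num) *: f b) ->
    A `<=` f @^-1` H -> Defs.conv A `<=` f @^-1` H.
  move=> fl; apply: smallest_sub => a b l /set_mem fa /set_mem fb.
  apply/mem_set; rewrite /preimage/= fl; apply/set_mem/cH; exact/mem_set.
apply/seteqP; split.
  apply: smallest_sub => // _ [[x xs <-]|[x xs <-]].
    apply: (sub _ (fun x : 'rV[R]_1 => row_mx x 0)) xs => [a b l|_ [->|->]].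
    - by rewrite !scale_row_mx add_row_mx !scaler0 addr0.
    - exact: (HI (o5 0)).
    - exact: (HI (o5 1)).
  apply: (sub _ (fun x : 'rV[R]_2 => row_mx 0 x)) xs => [a b l|_ [[->|->]|->]].
  - by rewrite !scale_row_mx add_row_mx !scaler0 addr0.
  - exact: (HI (o5 2)).
  - exact: (HI (o5 3)).
  - exact: (HI (o5 4)).
rewrite /H -conv_hull; apply: smallest_sub.
  move=> a b l /set_mem ha /set_mem hb; apply/mem_set => M [cM AM].
  by apply/set_mem/cM; apply/mem_set; [exact: ha|exact: hb].
move=> _ [[[|[|[|[|[|//]]]]] h] _ <-]; apply: sub_gen_smallest; rewrite /bipyramid_vertex/=.
- by left; exists (const_mx 1) => //; apply: sub_gen_smallest; left.
- by left; exists (const_mx (-1)) => //; apply: sub_gen_smallest; right.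
- by right; exists (delta_mx 0 0) => //; apply: sub_gen_smallest; left; left.
- by right; exists (delta_mx 0 1) => //; apply: sub_gen_smallest; left; right.
- by right; exists (const_mx (-1)) => //; apply: sub_gen_smallest; right.
Qed.

Lemma dot_row_mx m n (c : 'rV[R]_(m + n)) x y :
  dot c (row_mx x y) = dot (lsubmx c) x + dot (rsubmx c) y.
Proof.
rewrite /dot big_split_ord/=; congr (_ + _); apply: eq_bigr => i _.
  by rewrite row_mxEl mxE.
by rewrite row_mxEr mxE.
Qed.

Lemma bipyramid_bipyramidal :
  bipyramidal bipyramid_vertex (o5 0) (o5 1) (o5 2) (o5 3) (o5 4).
Proof.
have D0 n (c : 'rV[R]_n) : dot c 0 = 0 by rewrite /dot big1// => i _; rewrite mxE mulr0.
have D (c : 'rV[R]_(1 + 2)) : let l := lsubmx c 0 0 in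
    let r0 := rsubmx c 0 0 in let r1 := rsubmx c 0 1 in
    [/\ dot c (bipyramid_vertex (o5 0)) = l, dot c (bipyramid_vertex (o5 1)) = - l,
        dot c (bipyramid_vertex (o5 2)) = r0, dot c (bipyramid_vertex (o5 3)) = r1 &
        dot c (bipyramid_vertex (o5 4)) = - (r0 + r1)].
  rewrite /bipyramid_vertex/= !dot_row_mx !D0 !dot_delta !addr0 !add0r; split=> //.
  - by rewrite /dot big_ord1 [X in _ * X]mxE mulr1.
  - by rewrite /dot big_ord1 [X in _ * X]mxE mulrN1.
  - rewrite /dot 2!big_ord_recl big_ord0 ![const_mx _ _ _]mxE !mulrN1 addr0 -opprD.
    by rewrite (_ : lift ord0 ord0 = 1)//; exact: val_inj.
split=> [c|h hr].
  by have [-> -> -> -> ->] := D c; lra.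
(* The apices are opposite vectors, so [b] has to be the mean of their slacks. *)
pose b := (h (o5 0) + h (o5 1)) / 2.
pose c := row_mx (const_mx (b - h (o5 0)) : 'rV[R]_1)
  (\row_(j < 2) (if j == 0 then b - h (o5 2) else b - h (o5 3))).
exists c, b => i _; have := D c; rewrite row_mxKl row_mxKr !mxE/=.
move=> [d0 d1 d2 d3 d4].
case: i => -[|[|[|[|[|//]]]]] i5.
- by rewrite (_ : Ordinal _ = o5 0) ?d0//; exact: val_inj.
- by rewrite (_ : Ordinal _ = o5 1) ?d1; [rewrite /b; lra|exact: val_inj].
- by rewrite (_ : Ordinal _ = o5 2) ?d2//; exact: val_inj.
- by rewrite (_ : Ordinal _ = o5 3) ?d3//; exact: val_inj.
- by rewrite (_ : Ordinal _ = o5 4) ?d4; [rewrite /b; lra|exact: val_inj].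
Qed.

Lemma facial_bipyramid_vertex (U : {set 'I_5}) :
  facial bipyramid_vertex [set: 'I_5]%SET U
  <-> bipyramid_facial (o5 0) (o5 1) (o5 2) (o5 3) (o5 4) U.
Proof. by rewrite -bipyramid_setT; apply: facial_bipyramid => //; exact: bipyramid_bipyramidal. Qed.

Lemma comb_equiv_tetrahedron d (I : finType) (p : I -> 'rV[R]_d) (T : {set I}) :
  affinely_free p T -> #|T| = 4%N -> comb_equiv (hull p T) (tetrahedron R).
Proof.
move=> pf T4.
pose f (i : 'I_4) : I := enum_val (cast_ord (esym T4) i).
have fI : injective f by move=> i j /enum_val_inj/cast_ord_inj.
have fT : (f @: [set: 'I_4])%SET = T.
  apply/eqP; rewrite eqEcard T4 card_imset// cardsT card_ord leqnn andbT.
  by apply/fintype.subsetP => _ /imsetP[i _ ->]; exact: enum_valP.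
rewrite -fT -hull_comp tetrahedronE; apply: comb_equiv_hull => U.
by rewrite facial_comp// fT !facial_free ?finset.subsetT//; [split=> // _; rewrite -fT imsetS ?finset.subsetT|exact: tetrahedron_free].
Qed.

Lemma comb_equiv_bipyramid d (I : finType) (p : I -> 'rV[R]_d) (i0 i1 x y z : I) :
  uniq [:: i0; i1; x; y; z] -> bipyramidal p i0 i1 x y z ->
  comb_equiv (hull p (bipyramid_set i0 i1 x y z)) (triangular_bipyramid R).
Proof.
move=> un bp.
pose f (i : 'I_5) : I := nth i0 [:: i0; i1; x; y; z] i.
have fI : injective f.
  by move=> i j /eqP; rewrite nth_uniq// => /eqP; exact: val_inj.
have fT : (f @: [set: 'I_5])%SET = bipyramid_set i0 i1 x y z.
  by rewrite -bipyramid_setT /bipyramid_set !imsetU !imset_set1.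
rewrite -fT -hull_comp bipyramidE; apply: comb_equiv_hull => U.
rewrite facial_comp// fT facial_bipyramid// facial_bipyramid_vertex /bipyramid_facial.
rewrite -fT bipyramid_setT finset.subsetT imsetS ?finset.subsetT//.
have m k : (f k \in (f @: U)%SET) = (k \in U) by rewrite mem_imset.
have := (m (o5 0), m (o5 1), m (o5 2), m (o5 3), m (o5 4)).
rewrite /f/= => -[[[[-> ->] ->] ->] ->].
split=> -[_ [e|//]]; split=> //; try by right.
- by left; exact: (imset_inj fI).
- by left; rewrite e.
Qed.

(* Two apices of a bipyramid lie in no common proper face, whereas two vertices
   of a tetrahedron do. *)
Lemma bipyramid_not_tetrahedron d (P : set 'rV[R]_d) :
  comb_equiv P (tetrahedron R) -> comb_equiv P (triangular_bipyramid R) -> False.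
Proof.
rewrite tetrahedronE bipyramidE.
move=> [phi [[phiF phiI phiS] phiP]] [psi [[psiF psiI psiS] psiP]].
set t := tetrahedron_vertex; set q := bipyramid_vertex.
have tf U : Defs.face (hull t [set: 'I_4]%SET) (hull t U).
  by apply/facialP; exists U => //; rewrite facial_free ?finset.subsetT//; exact: tetrahedron_free.
have tsub U W : hull t U `<=` hull t W -> U \subset W.
  apply: sub_hull (finset.subsetT _).
  by rewrite facial_free ?finset.subsetT//; exact: tetrahedron_free.
have bf U : bipyramid_facial (o5 0) (o5 1) (o5 2) (o5 3) (o5 4) U ->
    Defs.face (hull q [set: 'I_5]%SET) (hull q U).
  by move=> /facial_bipyramid_vertex fU; apply/facialP; exists U.
have small k : bipyramid_facial (o5 0) (o5 1) (o5 2) (o5 3) (o5 4) [set k]%SET.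
  split; first by rewrite bipyramid_setT finset.subsetT.
  by right; rewrite !inE; case: k => -[|[|[|[|[|//]]]]] h.
(* An apex corresponds to a face of the tetrahedron with at most one vertex: two distinct vertices
   below it would both have to correspond to the empty face of the bipyramid. *)
have atom k : k = o5 0 \/ k = o5 1 -> exists (F : set 'rV[R]_d) (W : {set 'I_4}),
    [/\ Defs.face P F, psi F = hull q [set k]%SET, phi F = hull t W & (#|W| <= 1)%N].
  move=> k01.
  have [F PF qF] := psiS _ (bf _ (small k)).
  have /facialP[W _ eW] := phiF _ PF.
  exists F, W; split=> //; rewrite leqNgt; apply/negP => /card_gt1P[a [b [aW bW ab]]].
  have [Fa PFa ea] := phiS _ (tf [set a]%SET).
  have [Fb PFb eb] := phiS _ (tf [set b]%SET).
  have sub1 G i : Defs.face P G -> i \in W -> phi G = hull t [set i]%SET -> psi G = hull q finset.set0 \/ psi G = hull q [set k]%SET.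
    move=> PG iW eG.
    have /phiP-/(_ PG PF) GF : phi G `<=` phi F.
      by rewrite eG eW; apply: hullS; rewrite finset.sub1set.
    have /facialP[Y fY eY] := psiF _ PG.
    have : psi G `<=` psi F by apply/psiP.
    rewrite eY qF => /(sub_hull (proj2 (facial_bipyramid_vertex _) (small k))).
    by move=> /(_ (proj1 fY)); rewrite finset.subset1 => /orP[]/eqP->; [right|left].
  have ne (A B : {set 'I_4}) G H : phi G = hull t A -> phi H = hull t B -> G = H -> A = B.
    move=> eA eB GH; apply/eqP; rewrite finset.eqEsubset.
    by apply/andP; split; apply: tsub; rewrite -eA -eB GH.
  have only0 i G : i \in W -> Defs.face P G -> phi G = hull t [set i]%SET -> psi G = hull q finset.set0.
    move=> iW PG eG; have [//|h] := sub1 _ _ PG iW eG.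
    have GF : G = F by apply: psiI; [exact/mem_set|exact/mem_set|]; rewrite h qF.
    have := ne _ _ _ _ eG eW GF => Wi.
    by move: aW bW ab; rewrite -Wi !inE => /eqP-> /eqP->; rewrite eqxx.
  have : Fa = Fb by apply: psiI; [exact/mem_set|exact/mem_set|]; rewrite (only0 a)// (only0 b).
  move=> /(ne _ _ _ _ ea eb)/finset.set1_inj abE.
  by move: ab; rewrite abE eqxx.
have [F0 [W0 [PF0 q0 e0 c0]]] := atom _ (or_introl erefl).
have [F1 [W1 [PF1 q1 e1 c1]]] := atom _ (or_intror erefl).
(* The face [G] spanned by these at most two vertices lies above both apices, hence is the whole
   bipyramid; but the whole tetrahedron has four vertices. *)
have [G PG eG] := phiS _ (tf (W0 :|: W1)%SET).
have FG0 : F0 `<=` G by apply/(phiP _ _ PF0 PG); rewrite e0 eG; apply: hullS; exact: finset.subsetUl.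
have FG1 : F1 `<=` G by apply/(phiP _ _ PF1 PG); rewrite e1 eG; apply: hullS; exact: finset.subsetUr.
have /facialP[Y /facial_bipyramid_vertex fY eY] := psiF _ PG.
have mem k : bipyramid_facial (o5 0) (o5 1) (o5 2) (o5 3) (o5 4) [set k]%SET ->
    hull q [set k]%SET `<=` hull q Y -> k \in Y.
  move=> /facial_bipyramid_vertex fk /(sub_hull (proj2 (facial_bipyramid_vertex _) fY)).
  by move=> /(_ (proj1 fk)); rewrite finset.sub1set.
have Y0 : o5 0 \in Y.
  by apply: mem; [exact: small|rewrite -q0 -eY; exact/psiP].
have Y1 : o5 1 \in Y.
  by apply: mem; [exact: small|rewrite -q1 -eY; exact/psiP].
have YT : Y = [set: 'I_5]%SET.
  by case: fY => _ [->|[]]; [exact: bipyramid_setT|rewrite Y0 Y1].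
have [H PH eH] := phiS _ (tf [set: 'I_4]%SET).
have GH : G `<=` H by apply/(phiP _ _ PG PH); rewrite eG eH; exact/hullS/finset.subsetT.
have /facialP[Z /facial_bipyramid_vertex fZ eZ] := psiF _ PH.
have ZT : Z = [set: 'I_5]%SET.
  apply/eqP; rewrite -finset.subTset -YT.
  apply: (sub_hull (proj2 (facial_bipyramid_vertex _) fZ)); first by rewrite finset.subsetT.
  by rewrite -eY -eZ; exact/psiP.
have HG : H = G by apply: psiI; [exact/mem_set|exact/mem_set|]; rewrite eZ eY ZT YT.
have : [set: 'I_4]%SET \subset (W0 :|: W1)%SET by apply: tsub; rewrite -eG -eH HG.
move=> /subset_leq_card; rewrite cardsT card_ord leqNgt => /negP; apply.
apply: leq_ltn_trans (_ : (2 < 4)%N) => //.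
by apply: leq_trans (leq_card_setU _ _) _; rewrite -[2%N]/(1 + 1)%N leq_add.
Qed.

End PolytopeTypes.

(** * Merging tetrahedra of a simplicial complex into bipyramids *)

(** Common shape of [fold] and [slide]: a displacement in a fixed direction by a continuous
    amount. *)
Lemma continuous_shift (R : realType) (d : nat) (m : 'rV[R]_d -> R^o) (w : 'rV[R]_d) :
  continuous m -> continuous (fun z : 'rV[R]_d => z + m z *: w).
Proof.
move=> cm z; apply: (@continuousD R 'rV[R]_d 'rV[R]_d id (fun z => m z *: w) z).
  exact: cvg_id.
by apply: (@continuousZr_tmp R 'rV[R]_d 'rV[R]_d m w z); exact: cm.
Qed.

(** * Geometric realisation in barycentric coordinates *)

Section Realization.
Variables (R : realType) (V : finType).
Local Notation E := 'rV[R]_#|V|.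
Implicit Types (z : E) (v : V) (S : {set {set V}}).

Definition co z v : R := z 0 (enum_rank v).
Definition pt v : E := delta_mx 0 (enum_rank v).
Definition supp z : {set V} := [set v | co z v != 0]%SET.

Definition realization S : set E :=
  [set z | [/\ forall v, 0 <= co z v, \sum_v co z v = 1 & supp z \in S]].

Lemma coD z z' v : co (z + z') v = co z v + co z' v. Proof. by rewrite /co mxE. Qed.
Lemma coN z v : co (- z) v = - co z v. Proof. by rewrite /co mxE. Qed.
Lemma coZ (a : R) z v : co (a *: z) v = a * co z v. Proof. by rewrite /co mxE. Qed.
Lemma co_sum (J : Type) (r : seq J) (P : pred J) (F : J -> E) v :
  co (\sum_(j <- r | P j) F j) v = \sum_(j <- r | P j) co (F j) v.
Proof. by rewrite /co summxE. Qed.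

Lemma co_pt u v : co (pt u) v = (v == u)%:R.
Proof. by rewrite /co /pt mxE eqxx/= (inj_eq enum_rank_inj). Qed.

Lemma co_inj z z' : co z =1 co z' -> z = z'.
Proof.
by move=> h; apply/rowP => j; have := h (enum_val j); rewrite /co enum_valK.
Qed.

Lemma co_comb_pt (x : V -> R) v : co (comb pt x) v = x v.
Proof.
rewrite co_sum (bigD1 v)//= coZ co_pt eqxx mulr1 big1 ?addr0// => u uv.
by rewrite coZ co_pt eq_sym (negPf uv) mulr0.
Qed.

Lemma comb_pt_co z : comb pt (co z) = z.
Proof. by apply: co_inj => v; rewrite co_comb_pt. Qed.

Lemma dot_pt (c : E) v : dot c (pt v) = co c v.
Proof. by rewrite dot_delta. Qed.

Lemma continuous_co v : continuous (fun z : E => co z v).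
Proof. exact: coord_continuous. Qed.

Lemma hull_ptP (T : {set V}) z :
  hull pt T z <-> [/\ forall v, 0 <= co z v, \sum_v co z v = 1 & supp z \subset T].
Proof.
split=> [[x [x0 x1 xT] <-]|[z0 z1 zT]].
  split=> [v||]; first by rewrite co_comb_pt.
    by under eq_bigr do rewrite co_comb_pt.
  apply/fintype.subsetP => v; rewrite inE co_comb_pt; apply: contraNT.
  by move=> /xT->.
exists (co z); last exact: comb_pt_co.
split=> // v vT; apply/eqP; apply: contraNT vT => zv.
by apply: (fintype.subsetP zT); rewrite inE.
Qed.

Lemma pt_free (T : {set V}) : affinely_free pt T.
Proof.
move=> h; exists (comb pt (fun v => - h v)), 0 => v _.
by rewrite dot_pt co_comb_pt sub0r.
Qed.

Lemma facial_pt (T U : {set V}) : facial pt T U <-> U \subset T.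
Proof. exact/facial_free/pt_free. Qed.

Lemma supp_pt v : supp (pt v) = [set v]%SET.
Proof.
by apply/setP => u; rewrite !inE co_pt pnatr_eq0 eqb0 negbK.
Qed.

Lemma realization_pt S v : realization S (pt v) <-> [set v]%SET \in S.
Proof.
split=> [[_ _]|vS]; first by rewrite supp_pt.
split=> [u||]; [by rewrite co_pt ler0n| |by rewrite supp_pt].
rewrite (bigD1 v)//= co_pt eqxx big1 ?addr0// => u /negPf uv.
by rewrite co_pt uv.
Qed.

Lemma supp_neq0 z : \sum_v co z v = 1 -> exists v, v \in supp z.
Proof.
move=> z1; apply: contrapT => /forallNP h.
move: z1; rewrite big1 => [/esym/eqP|v _]; first by rewrite oner_eq0.
by apply/eqP; apply: contrapT => /negP zv; apply: (h v); rewrite inE.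
Qed.

Lemma supp_pos z v : (forall u, 0 <= co z u) -> (v \in supp z) = (0 < co z v).
Proof. by move=> z0; rewrite inE lt_neqAle z0 andbT eq_sym. Qed.

End Realization.

Arguments realization R {V} S.
Arguments pt R {V} v.

(* Simplicial complex [S] in which the pairs of tetrahedra sharing the triangles
   [Tri b] get merged into bipyramids with apices [p0 b] and [p1 b]. *)
Section MergedComplex.
Variables (R : realType) (V : finType) (S : {set {set V}}) (B : finType).
Variables p0 p1 t0 t1 t2 : B -> V.

Definition Tri b : {set V} := [set t0 b; t1 b; t2 b]%SET.
Definition Axis b : {set V} := [set p0 b; p1 b]%SET.
Definition Bip b : {set V} := bipyramid_set (p0 b) (p1 b) (t0 b) (t1 b) (t2 b).

(** By [mg_side] and [mg_link], the triangle lies in exactly two tetrahedra, one at each apex.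
    [mg_axis] keeps a simplex from containing both apices. [mg_tri] and [mg_axes] keep the triangle
    and the axis of one bipyramid out of all others, so that distinct cells meet in proper faces. *)
Record mergeable : Prop := Mergeable {
  mg_point : exists v, [set v]%SET \in S;
  mg_down : forall s t : {set V}, s \in S -> t \subset s -> t \in S;
  mg_dim : forall s : {set V}, s \in S -> (#|s| <= 4)%N;
  mg_pure : forall s : {set V}, s \in S -> exists2 t : {set V}, t \in S & s \subset t /\ #|t| = 4%N;
  mg_uniq : forall b, uniq [:: p0 b; p1 b; t0 b; t1 b; t2 b];
  mg_side : forall b, (p0 b |: Tri b)%SET \in S /\ (p1 b |: Tri b)%SET \in S;
  mg_link : forall b (s : {set V}), s \in S -> Tri b \subset s ->
    s \subset (p0 b |: Tri b)%SET \/ s \subset (p1 b |: Tri b)%SET;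
  mg_axis : forall b, Axis b \notin S;
  mg_tri : forall b b', Tri b' \subset Bip b -> b' = b;
  mg_axes : forall b b', Axis b' \subset Bip b -> b' = b }.

Hypothesis mg : mergeable.

Local Notation E := 'rV[R]_#|V|.
Local Notation X := (classical_sets.set_type (realization R S)).

(** Only the shared triangles and the tetrahedra containing them disappear; every other simplex
    remains a cell, including the empty one. *)
Definition simplicial_cell : finType :=
  {s : {set V} | (s \in S) && [forall b, ~~ (Tri b \subset s)]}.

Definition vs (i : simplicial_cell + B) : {set V} :=
  match i with inl s => val s | inr b => Bip b end.

(** Convex model of the bipyramid: the apex [p1 b] is moved to the reflection of [p0 b] in the
    barycentre of the triangle. *)
Definition bpt b v : E :=
  if v == p1 b then (2 / 3) *: (pt R (t0 b) + pt R (t1 b) + pt R (t2 b)) - pt R (p0 b)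
  else pt R v.

(** In the half of the model at [p0 b] the coordinate there is nonnegative and nothing moves. In the
    other half, minus that coordinate is the weight of the reflected apex, and this weight is
    carried back to [p1 b]. *)
Definition fold b (z : E) : E :=
  z + Num.max 0 (- co z (p0 b)) *:
    (pt R (p0 b) + pt R (p1 b) - (2 / 3) *: (pt R (t0 b) + pt R (t1 b) + pt R (t2 b))).

Lemma exists_point : exists z : E, realization R S z.
Proof. by have [v vS] := mg_point mg; exists (pt R v); exact/realization_pt. Qed.

Definition base : X := let z := cid exists_point in exist _ (sval z) (mem_set (svalP z)).

Definition merged_complex : cell_family R X :=
  @CellFamily R X (simplicial_cell + B)%type (fun=> #|V|)
    (fun i => match i with inl s => hull (pt R) (val s) | inr b => hull (bpt b) (Bip b) end)
    (fun i z => insubd base (match i with inl _ => z | inr b => fold b z end)).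

Definition carrier (T : {set V}) : set X := [set x | supp (val x) \subset T].

Definition cell_facial (i : simplicial_cell + B) (T : {set V}) : Prop :=
  match i with
  | inl s => T \subset val s
  | inr b => bipyramid_facial (p0 b) (p1 b) (t0 b) (t1 b) (t2 b) T
  end.

Let neqs b : [/\ p0 b != p1 b, p0 b \notin Tri b, p1 b \notin Tri b &
  [/\ t0 b != t1 b, t0 b != t2 b & t1 b != t2 b]].
Proof.
have := mg_uniq mg b.
rewrite /= !inE !negb_or -!andbA => /and5P[a0 a1 a2 a3 /and5P[b1 b2 b3 c1 /and3P[c2 d _]]].
by rewrite a0 a1 a2 a3 b1 b2 b3 c1 c2 d.
Qed.

Lemma Bip_split b : Bip b = (p0 b |: (p1 b |: Tri b))%SET.
Proof. by apply/setP => v; rewrite !inE -!orbA. Qed.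

(** A set missing an apex lies in one of the two tetrahedra of [mg_side]; a set with both apices
    contains the axis. *)
Lemma sub_BipP b (s : {set V}) : s \subset Bip b ->
  (s \in S) = ~~ ((p0 b \in s) && (p1 b \in s)).
Proof.
move=> sB; apply/idP/idP => [sS|].
  apply/negP => /andP[h0 h1]; have /negP := mg_axis mg b; apply.
  by apply: mg_down mg _ _ sS _; rewrite subUset !finset.sub1set h0 h1.
have [S0 S1] := mg_side mg b.
have drop v w A : s \subset (v |: (w |: A))%SET -> v \notin s -> s \subset (w |: A)%SET.
  move=> /fintype.subsetP h vs; apply/fintype.subsetP => u us; have := h _ us.
  by rewrite in_setU1 => /predU1P[uv|//]; move: vs; rewrite -uv us.
rewrite Bip_split in sB; rewrite negb_and => /orP[h|h].
  exact: (mg_down mg S1 (drop _ _ _ sB h)).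
by apply: (mg_down mg S0 (drop _ _ _ _ h)); rewrite setUCA.
Qed.

Lemma val_insub_base (z : E) : realization R S z -> val (insubd base z : X) = z.
Proof. by move=> /mem_set zS; rewrite insubdK. Qed.

(** One apex has weight zero, so the point lies in one half of the model, where [fold] is affine and
    sends each vertex [bpt b v] to [pt R v]. *)
Lemma co_fold_comb b (x : V -> R) : (forall v, 0 <= x v) -> 
  Num.min (x (p0 b)) (x (p1 b)) = 0 -> fold b (comb (bpt b) x) = comb (pt R) x.
Proof.
move=> x0 xm; have [n01 n0 n1 _] := neqs b.
have e : comb (bpt b) x = comb (pt R) x + x (p1 b) *: ((2 / 3) *: (pt R (t0 b) + pt R (t1 b) + pt R (t2 b)) - pt R (p0 b) - pt R (p1 b)).
  rewrite /comb (bigD1 (p1 b))//= [in RHS](bigD1 (p1 b))//= addrAC -scalerDr.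
  rewrite {1}/bpt eqxx [pt R (p1 b) + _]addrC subrK; congr (_ + _).
  by apply: eq_bigr => v /negPf vp; rewrite /bpt vp.
have c0 : co (comb (bpt b) x) (p0 b) = x (p0 b) - x (p1 b).
  rewrite e coD co_comb_pt coZ !(coD, coN, coZ) !co_pt eqxx (negPf n01).
  move: n0; rewrite !inE !negb_or => /andP[/andP[/negPf-> /negPf->] /negPf->]/=.
  by ring.
rewrite /fold c0 e.
have -> : Num.max 0 (- (x (p0 b) - x (p1 b))) = x (p1 b).
  move: xm (x0 (p0 b)) (x0 (p1 b)); rewrite opprB.
  by case: (leP (x (p0 b)) (x (p1 b))) => h e0; rewrite e0 ?subr0 /Num.max; case: ltP => //; lra.
rewrite -addrA -scalerDr; set u := (2 / 3) *: _; set a := pt R (p0 b); set c := pt R (p1 b).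
by rewrite (_ : u - a - c + (a + c - u) = 0) ?scaler0 ?addr0//; apply/rowP => j; rewrite !mxE; ring.
Qed.

Lemma fold_hull b (z : E) : hull (bpt b) (Bip b) z ->
  realization R S (fold b z) /\ supp (fold b z) \subset Bip b.
Proof.
move=> [x [x0 x1 xB] <-]; have [n01 n0 n1 [m01 m02 m12]] := neqs b.
(* The relation between apices and equator allows weight [m] to be taken from each apex and given to
   the triangle without changing the point; afterwards one apex has weight zero. *)
pose m := Num.min (x (p0 b)) (x (p1 b)).
pose x' v := if (v == p0 b) || (v == p1 b) then x v - m else
  if v \in Tri b then x v + 2 / 3 * m else x v.
have m0 : 0 <= m by rewrite /m le_min !x0.
have mp0 : m <= x (p0 b) by rewrite /m ge_min lexx.
have mp1 : m <= x (p1 b) by rewrite /m ge_min lexx orbT.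
have x'0 v : 0 <= x' v.
  rewrite /x'; case: ifP => [/orP[]/eqP->|_]; rewrite ?subr_ge0//.
  by case: ifP => // _; rewrite addr_ge0// mulr_ge0// divr_ge0.
have x'm : Num.min (x' (p0 b)) (x' (p1 b)) = 0.
  rewrite /x' !eqxx orbT/=; move: mp0 mp1; rewrite /m; case: (leP (x (p0 b)) (x (p1 b))) => h _ _.
    by rewrite subrr; apply/min_idPl; rewrite subr_ge0.
  by rewrite subrr; apply/min_idPr; rewrite subr_ge0 ltW.
have e v : x' v = x v + m * (- (v == p0 b)%:R - (v == p1 b)%:R + 2 / 3 * ((v == t0 b)%:R + (v == t1 b)%:R + (v == t2 b)%:R)).
  rewrite /x'; move: n0 n1; rewrite !inE !negb_or.
  move=> /andP[/andP[/negPf a0 /negPf a1] /negPf a2] /andP[/andP[/negPf b0 /negPf b1] /negPf b2].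
  have [->|h0] := eqVneq v (p0 b); first by rewrite (negPf n01) a0 a1 a2/=; ring.
  have [->|h1] := eqVneq v (p1 b); first by rewrite b0 b1 b2/=; ring.
  rewrite /=; have [->|k0] := eqVneq v (t0 b); first by rewrite (negPf m01) (negPf m02)/=; ring.
  have [->|k1] := eqVneq v (t1 b); first by rewrite (negPf m12)/=; ring.
  by case: eqVneq => _ /=; ring.
have ce : comb (bpt b) x = comb (bpt b) x'.
  have bI u (f : V -> R) : \sum_v (f v * (v == u)%:R) *: bpt b v = f u *: bpt b u.
    rewrite (bigD1 u)//= eqxx mulr1 big1 ?addr0// => v /negPf->.
    by rewrite mulr0 scale0r.
  rewrite /comb; under [RHS]eq_bigr do rewrite e scalerDl.
  rewrite big_split/= -[LHS]addr0; congr (_ + _).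
  under eq_bigr do rewrite -scalerA scalerDl scalerDl scaleNr scaleNr -scalerA !scalerDl.
  rewrite -scaler_sumr !big_split/= !sumrN -scaler_sumr !big_split/=.
  have one u : \sum_i (i == u)%:R *: bpt b i = bpt b u.
    by rewrite -[RHS]scale1r -(bI u (fun=> 1)); apply: eq_bigr => i _; rewrite mul1r.
  rewrite !one /bpt eqxx (negPf n01).
  move: n1; rewrite !inE !negb_or => /andP[/andP[b0 b1] b2].
  rewrite ![_ == p1 b]eq_sym (negPf b0) (negPf b1) (negPf b2).
  set u := (2 / 3) *: _; set a := pt R (p0 b).
  by rewrite (_ : - a - (u - a) + u = 0) ?scaler0//; apply/rowP => j; rewrite !mxE; ring.
rewrite ce co_fold_comb//.
have sB : supp (comb (pt R) x') \subset Bip b.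
  apply/fintype.subsetP => v; rewrite inE co_comb_pt; apply: contraNT => vB.
  move: (vB); rewrite e xB// !inE -!orbA !negb_or => /and5P[/negPf-> /negPf-> /negPf-> /negPf-> /negPf->].
  by rewrite /=; apply/eqP; ring.
split=> //; split=> [v||]; first by rewrite co_comb_pt.
  under eq_bigr do rewrite co_comb_pt e.
  have one u : \sum_i (i == u)%:R = 1 :> R.
    by rewrite (bigD1 u)//= eqxx big1 ?addr0// => i /negPf->.
  rewrite big_split/= x1 -mulr_sumr !big_split/= !sumrN -mulr_sumr !big_split/= !one.
  by field.
rewrite (sub_BipP sB) !inE !co_comb_pt.
by move: x'm; case: leP => _ ->; rewrite eqxx ?andbF.
Qed.

Lemma bpt_bipyramidal b : bipyramidal (bpt b) (p0 b) (p1 b) (t0 b) (t1 b) (t2 b).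
Proof.
have [n01 n0 n1 _] := neqs b.
have vb v : v != p1 b -> bpt b v = pt R v by rewrite /bpt => /negPf->.
have w1 : bpt b (p1 b) = (2 / 3) *: (pt R (t0 b) + pt R (t1 b) + pt R (t2 b)) - pt R (p0 b) by rewrite /bpt eqxx.
move: n1; rewrite !inE !negb_or ![p1 b == _]eq_sym => /andP[/andP[b0 b1] b2].
have dD (c u u' : E) : dot c (u + u') = dot c u + dot c u'.
  by rewrite /dot -big_split/=; apply: eq_bigr => i _; rewrite mxE mulrDr.
have dZ (c u : E) a : dot c (a *: u) = a * dot c u.
  by rewrite /dot mulr_sumr; apply: eq_bigr => i _; rewrite mxE mulrCA.
have dw (c : E) : dot c (bpt b (p1 b)) = 2 / 3 * (co c (t0 b) + co c (t1 b) + co c (t2 b)) - co c (p0 b).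
  by rewrite w1 -scaleN1r !(dD, dZ) !dot_pt mulN1r.
split=> [c|h hr].
  by rewrite dw !vb// !dot_pt addrC subrK.
exists (comb (pt R) (fun v => - h v)), 0 => v _.
have [->|vp] := eqVneq v (p1 b); last by rewrite vb// dot_pt co_comb_pt sub0r.
by rewrite dw !co_comb_pt; lra.
Qed.

(** Dictionary for what follows: as subsets of the space, faces of cells are carriers of vertex
    sets, so the axioms of a complex become statements on finite sets. *)
Lemma cell_faceE i (A : set X) :
  cell_face (K := merged_complex) i A <-> exists2 T, cell_facial i T & A = carrier T.
Proof.
case: i => [s|b].
  have /andP[sS _] := valP s.
  have im (T : {set V}) : T \subset val s ->
      (fun z : E => insubd base z : X) @` hull (pt R) T = carrier T.
    move=> Ts; have TS : T \in S by exact: mg_down sS Ts.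
    apply/seteqP; split=> [_ [z /hull_ptP[z0 z1 zT] <-]|x xT].
      by rewrite /carrier/= val_insub_base//; split=> //; exact: mg_down TS zT.
    have [x0 x1 xS] := set_valP x.
    by exists (val x); [exact/hull_ptP|rewrite valKd].
  split=> [[F /facialP[T /facial_pt Ts ->] ->]|[T Ts ->]].
    by exists T; rewrite //= im.
  exists (hull (pt R) T); last by rewrite /= im.
  by apply/facialP; exists T => //; exact/facial_pt.
have fB T : facial (bpt b) (Bip b) T <-> bipyramid_facial (p0 b) (p1 b) (t0 b) (t1 b) (t2 b) T.
  exact: facial_bipyramid (mg_uniq mg b) (bpt_bipyramidal b).
have im (T : {set V}) : bipyramid_facial (p0 b) (p1 b) (t0 b) (t1 b) (t2 b) T ->
    (fun z : E => insubd base (fold b z) : X) @` hull (bpt b) T = carrier T.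
  move=> TF; have TB := proj1 TF; apply/seteqP; split=> [_ [z zT <-]|x xT].
    have [zS zB] := fold_hull (hullS TB zT).
    rewrite /carrier/= val_insub_base//.
    case: (TF) zT => _ [-> //|[n01 _] [x [x0 x1 xT] <-]].
    rewrite co_fold_comb//; last first.
      move: n01; rewrite negb_and => /orP[]/xT->; first exact/min_idPl/x0.
      exact/min_idPr/x0.
    apply/fintype.subsetP => v; rewrite inE co_comb_pt; apply: contraNT.
    by move=> /xT->.
  have [x0 x1 xS] := set_valP x.
  exists (comb (bpt b) (co (val x))).
    exists (co (val x)) => //; split=> // v vT; apply/eqP; apply: contraNT vT => xv.
    by apply: (fintype.subsetP xT); rewrite inE.
  rewrite co_fold_comb ?comb_pt_co ?valKd//.
  move: xS; rewrite (sub_BipP (fintype.subset_trans xT TB)) !inE negb_and !negbK.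
  by move=> /orP[]/eqP->; [exact/min_idPl|exact/min_idPr].
split=> [[F /facialP[T /fB TF ->] ->]|[T TF ->]].
  by exists T; rewrite //= im.
exists (hull (bpt b) T); last by rewrite /= im.
by apply/facialP; exists T => //; exact/fB.
Qed.

Lemma vs_facial i : cell_facial i (vs i).
Proof. by case: i => //= b; split=> //; left. Qed.

Lemma face_self d (I : finType) (p : I -> 'rV[R]_d) (T : {set I}) :
  Defs.face (hull p T) (hull p T).
Proof.
exists 0, 0; have d0 x : dot (0 : 'rV[R]_d) x = 0 by rewrite /dot big1// => i _; rewrite mxE mul0r.
split=> [x _|]; first by rewrite d0.
by apply/seteqP; split=> [x xT|x []//]; split.
Qed.

Lemma carrierS (T U : {set V}) : T \subset U -> carrier T `<=` carrier U.
Proof. by move=> TU x xT; exact: fintype.subset_trans xT TU. Qed.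

Lemma carrierI (T U : {set V}) : carrier T `&` carrier U = carrier (T :&: U)%SET.
Proof.
apply/seteqP; split=> x; rewrite /carrier/= subsetI; first by case=> -> ->.
by case/andP.
Qed.

Lemma facial_mem i (T : {set V}) v : cell_facial i T -> v \in T -> [set v]%SET \in S.
Proof.
case: i => [s|b] /=.
  move=> Ts vT; have /andP[sS _] := valP s.
  by apply: mg_down mg _ _ sS _; rewrite finset.sub1set (fintype.subsetP Ts).
move=> [TB _] vT; rewrite (@sub_BipP b) ?finset.sub1set ?(fintype.subsetP TB)//.
have [n01 _ _ _] := neqs b; rewrite !finset.inE; apply: contra n01 => /andP[/eqP-> /eqP->].
by rewrite eqxx.
Qed.

Definition Xpt v (h : [set v]%SET \in S) : X := exist _ (pt R v) (mem_set (proj2 (realization_pt R S v) h)).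

Lemma carrier_Xpt T v (h : [set v]%SET \in S) : carrier T (Xpt h) <-> v \in T.
Proof. by rewrite /carrier/= supp_pt finset.sub1set. Qed.

(** Each vertex of [T] is itself a point of the space, and it lies in precisely the carriers of the
    sets containing it. *)
Lemma sub_carrier i (T U : {set V}) : cell_facial i T -> carrier T `<=` carrier U -> T \subset U.
Proof.
move=> iT TU; apply/fintype.subsetP => v vT; have vS := facial_mem iT vT.
by apply/(carrier_Xpt U vS)/TU/carrier_Xpt.
Qed.

Lemma carrier_inj i j (T U : {set V}) : cell_facial i T -> cell_facial j U ->
  carrier T = carrier U -> T = U.
Proof.
move=> iT jU e; apply/eqP; rewrite finset.eqEsubset.
by rewrite (sub_carrier iT) ?e// (sub_carrier jU)// e.
Qed.

Lemma bodyE i : body (K := merged_complex) i = carrier (vs i).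
Proof.
have [T iT e] : exists2 T, cell_facial i T & body (K := merged_complex) i = carrier T.
  by apply/cell_faceE; exists (Defs.poly merged_complex i) => //; case: i => j; exact: face_self.
rewrite e; congr carrier; apply/eqP; rewrite finset.eqEsubset; apply/andP; split.
  by case: i iT {e} => [s|b] //= [].
have [F iF eF] : cell_face (K := merged_complex) i (carrier (vs i)).
  by apply/cell_faceE; exists (vs i) => //; exact: vs_facial.
apply: (sub_carrier (vs_facial i)); rewrite -e eF /body => _ [z Fz <-]; exists z => //.
by have [c [b [_ Fe]]] := iF; move: Fz; rewrite Fe => -[].
Qed.

Lemma vs_inj : injective vs.
Proof.
have sTri b : Tri b \subset Bip b.
  by rewrite Bip_split finset.setUA finset.subsetUr.
move=> [s|b] [s'|b'] /=.
- by move=> /val_inj->.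
- by move=> e; have /andP[_ /forallP/(_ b')/negP[]] := valP s; have := sTri b'; rewrite -e.
- by move=> e; have /andP[_ /forallP/(_ b)/negP[]] := valP s'; have := sTri b; rewrite e.
- by move=> e; congr inr; apply: (mg_tri mg); rewrite -e sTri.
Qed.

(** A simplex without a shared triangle is itself a cell; any other is placed by [mg_link] in one of
    the tetrahedra of a bipyramid. *)
Lemma sub_cell (T : {set V}) : T \in S -> exists i, T \subset vs i.
Proof.
move=> TS; have [/forallP nT|/existsP[b]] := boolP [forall b, ~~ (Tri b \subset T)].
  have p : (T \in S) && [forall b, ~~ (Tri b \subset T)] by rewrite TS; exact/forallP.
  by exists (inl (Sub T p)).
rewrite negbK => bT; exists (inr b); rewrite /= Bip_split.
have [TA|TA] := mg_link mg TS bT; apply: fintype.subset_trans TA _.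
  by rewrite finset.setUS// finset.subsetUr.
exact: finset.subsetUr.
Qed.

Lemma polyhedral_merged : polyhedral_complex merged_complex.
Proof.
split.
- move=> x y xy; apply: val_inj; apply: norm_hausdorff => U W nU nW.
  have cv : continuous (set_val : X -> E) by exact: initial_continuous.
  have [z [Uz Wz]] := xy _ _ (cv x U nU) (cv y W nW).
  by exists (set_val z).
- by case=> j; exact: polytope_hull.
- move=> i.
  have [f cf e] : exists2 f : E -> E, continuous f & forall z, Defs.poly merged_complex i z ->
      val (chart merged_complex i z) = f z.
    case: i => [s|b].
      exists id => [z|z zs]; first exact: cvg_id.
      rewrite /= val_insub_base//; have /andP[sS _] := valP s.
      have [z0 z1 zs'] := proj1 (hull_ptP _ _) zs.
      by split=> //; exact: mg_down mg _ _ sS zs'.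
    exists (fold b) => [z|z zs].
      apply: (@continuous_shift _ _ (fun y => Num.max 0 (- co y (p0 b)))) => y.
      apply: (@continuous_max R E (fun=> 0) (fun y => - co y (p0 b)) y).
        exact: cst_continuous.
      by apply: (@continuousN R R^o E (fun y => co y (p0 b)) y); exact: continuous_co.
    by rewrite /= val_insub_base//; have [] := fold_hull zs.
  apply: continuous_comp_initial.
  apply: (@subspace_eq_continuous _ _ _ f).
    by move=> z /set_mem zi; rewrite /= -e.
  exact: continuous_subspaceT.
- move=> [s|b] z z' /set_mem zi /set_mem zi' h.
    have key y : hull (pt R) (val s) y -> realization R S y.
      have /andP[sS _] := valP s.
      by move=> /hull_ptP[y0 y1 ys]; split=> //; exact: mg_down mg _ _ sS ys.
    by move: (congr1 val h); rewrite /= !val_insub_base//; exact: key.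
  move: (congr1 val h); rewrite /= !val_insub_base; try by have [] := fold_hull zi; have [] := fold_hull zi'.
  have [n01 n0 n1 _] := neqs b.
  (* On the convex model the coordinate at [p1 b] vanishes. In the folded image it therefore equals
     the amount of the shift, from which the original point is recovered. *)
  have q0 y : hull (bpt b) (Bip b) y -> co y (p1 b) = 0.
    move=> [x _ <-]; rewrite co_sum big1// => v _; rewrite coZ /bpt.
    move: n1; rewrite !finset.inE !negb_or => /andP[/andP[/negPf a0 /negPf a1] /negPf a2].
    case: eqVneq => [_|/negPf vp]; last by rewrite co_pt eq_sym vp mulr0.
    by rewrite !(coD, coN, coZ) !co_pt a0 a1 a2 [_ == p0 b]eq_sym (negPf n01)/=; ring.
  have q1 y : hull (bpt b) (Bip b) y -> co (fold b y) (p1 b) = Num.max 0 (- co y (p0 b)).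
    move=> /q0 y0; rewrite /fold coD y0 coZ !(coD, coN, coZ) !co_pt eqxx [_ == p0 b]eq_sym (negPf n01).
    move: n1; rewrite !finset.inE !negb_or => /andP[/andP[/negPf a0 /negPf a1] /negPf a2].
    by rewrite a0 a1 a2/=; ring.
  move=> e; move: (congr1 (fun y => co y (p1 b)) e); rewrite !q1// => e1.
  by move: e; rewrite /fold e1 => /addIr.
- move=> i j; rewrite !bodyE => /(carrier_inj (vs_facial i) (vs_facial j)).
  exact: vs_inj.
- apply/seteqP; split=> // x _; have [_ _ xS] := set_valP x.
  by have [i xi] := sub_cell xS; exists i => //; rewrite bodyE.
- move=> i A /cell_faceE[T iT ->].
  have [j <-] : exists j, vs j = T; last by exists j; rewrite bodyE.
  have mk (U : {set V}) : U \in S -> (forall b, ~~ (Tri b \subset U)) -> exists j, vs j = U.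
    move=> US nU; have p : (U \in S) && [forall b, ~~ (Tri b \subset U)] by rewrite US; exact/forallP.
    by exists (inl (Sub U p)).
  case: i iT => [s Ts|b [TB [->|[n01 nt]]]]; last first.
  - apply: mk; first by rewrite (sub_BipP TB).
    move=> b'; apply/negP => b'T; have e := mg_tri mg (fintype.subset_trans b'T TB).
    move: nt; rewrite -e; apply/negP; rewrite negbK.
    by rewrite !(fintype.subsetP b'T) ?finset.inE ?eqxx ?orbT.
  - by exists (inr b).
  have /andP[sS /forallP nt] := valP s; apply: mk; first exact: mg_down mg _ _ sS Ts.
  by move=> b; apply: contra (nt b) => /fintype.subset_trans; apply.
(* Two cells meet in the carrier of their common vertices. For a bipyramid and a different cell,
   this set must miss an apex and a vertex of the triangle. *)
- move=> i j; apply/cell_faceE; rewrite !bodyE carrierI; exists (vs i :&: vs j)%SET => //.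
  case: i => [s|b] /=; first exact: finset.subsetIl.
  split; first exact: finset.subsetIl.
  have [<-|ij] := eqVneq (inr b) j; first by left; rewrite /= finset.setIid.
  right; split.
    apply/negP; rewrite !finset.inE => /andP[/andP[_ a0] /andP[_ a1]].
    have aj : Axis b \subset vs j by rewrite finset.subUset !finset.sub1set a0 a1.
    case: j ij aj {a0 a1} => [s|b'] /= ij aj.
      have /andP[sS _] := valP s.
      by have /negP := mg_axis mg b; apply; exact: mg_down mg _ _ sS aj.
    by move: ij; rewrite (mg_axes mg aj) eqxx.
  apply/negP; rewrite !finset.inE => /and3P[/andP[_ a0] /andP[_ a1] /andP[_ a2]].
  have aj : Tri b \subset vs j by rewrite !finset.subUset !finset.sub1set a0 a1 a2.
  case: j ij aj {a0 a1 a2} => [s|b'] /= ij aj.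
    by have /andP[_ /forallP/(_ b)/negP[]] := valP s.
  by move: ij; rewrite (mg_tri mg aj) eqxx.
Qed.

Let body_sub i j : (body (K := merged_complex) i `<=` body (K := merged_complex) j) <-> vs i \subset vs j.
Proof.
rewrite !bodyE; split; last exact: carrierS.
exact: sub_carrier (vs_facial i).
Qed.

Lemma facet_bipyramid b : is_facet (K := merged_complex) (inr b).
Proof.
move=> j /body_sub/= bj.
have Tb : Tri b \subset vs j.
  by apply: fintype.subset_trans bj; rewrite Bip_split finset.setUA finset.subsetUr.
case: j bj Tb => [s|b'] /= bj Tb; last by rewrite (mg_tri mg Tb).
by have /andP[_ /forallP/(_ b)/negP[]] := valP s.
Qed.

Lemma facet_simplex (s : simplicial_cell) :
  is_facet (K := merged_complex) (inl s) <-> #|val s| = 4%N.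
Proof.
have /andP[sS /forallP nt] := valP s.
split=> [sF|s4 j /body_sub/= sj].
  have [T TS [sT T4]] := mg_pure mg sS; have [j Tj] := sub_cell TS.
  have ej : j = inl s by apply: sF; apply/body_sub; exact: fintype.subset_trans sT Tj.
  apply/eqP; rewrite eqn_leq (mg_dim mg sS)/= -T4 subset_leq_card//.
  by move: Tj; rewrite ej.
case: j sj => [s'|b] /= sj.
  have /andP[s'S _] := valP s'; congr inl; apply/esym/val_inj/eqP.
  by rewrite eqEcard sj s4 (mg_dim mg s'S).
move: (sS); rewrite (sub_BipP sj) negb_and => n01.
have [p pP ps] : exists2 p, p \in Axis b & p \notin val s.
  by case/orP: n01 => h; [exists (p0 b)|exists (p1 b)] => //; rewrite !finset.inE eqxx ?orbT.
have /subsetPn[t tT ts] := nt b; have [n01' n0 n1 _] := neqs b.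
have pt : p != t.
  by apply: contraTneq tT => <-; case/finset.set2P: pP => ->.
(* A simplicial cell inside a bipyramid misses an apex and a vertex of the triangle, so it has at
   most three of the five vertices. *)
have : (val s \subset Bip b :\ p :\ t)%SET by rewrite !finset.subsetD1 sj ps ts.
move=> /subset_leq_card; rewrite s4 leqNgt => /negP[].
have add1 (A : {set V}) v n : (#|A| <= n)%N -> (#|A :|: [set v]%SET| <= n.+1)%N.
  by move=> An; rewrite finset.setUC cardsU1 -add1n leq_add// leq_b1.
have B5 : (#|Bip b| <= 5)%N by rewrite /Bip /bipyramid_set !add1// cards1.
have pB : p \in Bip b by move: pP; rewrite !finset.inE => /orP[]->; rewrite ?orbT.
have tB : t \in (Bip b :\ p)%SET.
  by rewrite finset.in_setD1 eq_sym pt Bip_split finset.setUA finset.in_setU tT orbT.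
by move: B5; rewrite (cardsD1 p) pB (cardsD1 t) tB.
Qed.

Lemma bipyramidal_facetE i :
  is_bipyramidal_facet (K := merged_complex) i <-> exists b, i = inr b.
Proof.
split=> [[iF]|[b ->]]; last first.
  split; first exact: facet_bipyramid.
  by apply: comb_equiv_bipyramid; [exact: mg_uniq mg b|exact: bpt_bipyramidal].
case: i iF => [s /facet_simplex s4 sB|b _ _]; last by exists b.
have := comb_equiv_tetrahedron (@pt_free R V (val s)) s4.
by move=> /bipyramid_not_tetrahedron/(_ sB).
Qed.

Lemma tetrahedral_facetE i :
  is_tetrahedral_facet (K := merged_complex) i <-> exists2 s, i = inl s & #|val s| = 4%N.
Proof.
split=> [[iF]|[s -> s4]]; last first.
  by split; [exact/facet_simplex|apply: comb_equiv_tetrahedron => //; exact: pt_free].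
case: i iF => [s /facet_simplex s4 _|b _ bT]; first by exists s.
case: (bipyramid_not_tetrahedron bT).
by apply: comb_equiv_bipyramid; [exact: mg_uniq mg b|exact: bpt_bipyramidal].
Qed.

Lemma facet_merged i : is_facet (K := merged_complex) i ->
  is_tetrahedral_facet (K := merged_complex) i \/ is_bipyramidal_facet (K := merged_complex) i.
Proof.
case: i => [s /facet_simplex s4|b _]; last by right; apply/bipyramidal_facetE; exists b.
by left; apply/tetrahedral_facetE; exists s.
Qed.

Lemma vertexE i : is_vertex (K := merged_complex) i <-> exists2 v, vs i = [set v]%SET & [set v]%SET \in S.
Proof.
split=> [[x]|[v iv vS]]; rewrite ?bodyE.
  move=> e; have [_ x1 _] := set_valP x; have [v vx] := supp_neq0 x1.
  have xi : carrier (vs i) x by rewrite e.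
  have vi := fintype.subsetP xi v vx.
  have vS := facial_mem (vs_facial i) vi; exists v => //.
  apply/eqP; rewrite finset.eqEsubset finset.sub1set vi andbT.
  apply: (sub_carrier (vs_facial i)); rewrite e => _ ->.
  have <- : Xpt vS = x by have : carrier (vs i) (Xpt vS) by [exact/carrier_Xpt]; rewrite e.
  by apply/carrier_Xpt; rewrite finset.inE.
exists (Xpt vS); rewrite bodyE iv; apply/seteqP; split=> [x xv|_ ->]; last first.
  by apply/carrier_Xpt; rewrite finset.inE.
have [x0 x1 _] := set_valP x; apply: val_inj; apply: co_inj => u /=.
have z w : w != v -> co (val x) w = 0.
  move=> wv; apply/eqP; apply: contraNT wv => xw.
  by have := fintype.subsetP xv w; rewrite !finset.inE => /(_ xw).
move: x1; rewrite (bigD1 v)//= big1 ?addr0 => [xv1|w /z//].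
have [->|uv] := eqVneq u v; first by rewrite xv1 co_pt eqxx.
by rewrite z// co_pt (negPf uv).
Qed.

Let card_vs (P : pred (cell merged_complex)) (Q : {set {set V}}) :
  (forall i, P i -> vs i \in Q) -> (forall s, s \in Q -> exists2 i, P i & vs i = s) ->
  #|P| = #|Q|.
Proof.
move=> PQ QP; rewrite -(card_imset _ vs_inj); apply: eq_card => s.
apply/imsetP/idP => [[i iP ->]|/QP[i iP <-]]; first exact: PQ.
by exists i.
Qed.

Lemma vertices_merged : vertices merged_complex = #|[set v | [set v]%SET \in S]%SET|.
Proof.
rewrite -(card_imset _ (@finset.set1_inj V)).
apply: card_vs => [i|s /imsetP[v]].
  by move=> /asboolP/vertexE[v -> vS]; apply/imsetP; exists v => //; rewrite finset.inE.
rewrite finset.inE => vS ->.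
have [i iv] : exists i, vs i = [set v]%SET.
  have p : ([set v]%SET \in S) && [forall b, ~~ (Tri b \subset [set v]%SET)].
    rewrite vS; apply/forallP => b; have [_ _ _ [m01 _ _]] := neqs b.
    apply: contra m01; rewrite !finset.subUset !finset.sub1set !finset.inE.
    by move=> /andP[/andP[/eqP-> /eqP->] _].
  by exists (inl (Sub [set v]%SET p)).
by exists i => //; apply/asboolP/vertexE; exists v.
Qed.

Lemma tetrahedra_merged : tetrahedra merged_complex =
  #|[set s in S | (#|s| == 4%N) && [forall b, ~~ (Tri b \subset s)]]%SET|.
Proof.
apply: card_vs => [i|s].
  move=> /asboolP/tetrahedral_facetE[s -> /= s4].
  by rewrite finset.inE s4 eqxx/=; exact: valP s.
rewrite finset.inE => /and3P[sS /eqP s4 sn].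
have p : (s \in S) && [forall b, ~~ (Tri b \subset s)] by rewrite sS.
exists (inl (Sub s p)) => //; apply/asboolP/tetrahedral_facetE.
by exists (Sub s p).
Qed.

Lemma bipyramids_merged : bipyramids merged_complex = #|B|.
Proof.
rewrite -(card_image (f := @inr simplicial_cell B)); last by move=> ? ? [].
apply: eq_card => i; rewrite unfold_in /=; apply/asboolP/imageP.
  by move=> /bipyramidal_facetE[b ->]; exists b.
by move=> [b _ ->]; apply/bipyramidal_facetE; exists b.
Qed.

(** Every bipyramid absorbs two tetrahedra, listed by [f], and by [mg_tri] none is absorbed
    twice. *)
Lemma tetrahedra_count :
  (tetrahedra merged_complex + 2 * #|B| = #|[set s in S | #|s| == 4%N]%SET|)%N.
Proof.
rewrite tetrahedra_merged.
set T := [set s in S | #|s| == 4%N]%SET; set T0 := [set s in S | _]%SET.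
pose f (bi : B * bool) : {set V} := ((if bi.2 then p0 bi.1 else p1 bi.1) |: Tri bi.1)%SET.
have fS bi : f bi \in T.
  case: bi => b i; have [S0 S1] := mg_side mg b; have [_ n0 n1 [m01 m02 m12]] := neqs b.
  have T3 : #|Tri b| = 3%N.
    rewrite /Tri -finset.setUA !cardsU1 cards1 !finset.inE.
    by rewrite negb_or m01 m02 m12.
  by rewrite finset.inE /f; case: i => /=; rewrite ?S0 ?S1 cardsU1 ?n0 ?n1 T3.
have fT bi b : Tri b \subset f bi -> b = bi.1.
  move=> bT; apply: (mg_tri mg); apply: fintype.subset_trans bT _.
  rewrite /f Bip_split; case: ifP => _; last exact: finset.subsetUr.
  by rewrite finset.setUS// finset.subsetUr.
have Tf bi : Tri bi.1 \subset f bi by exact: finset.subsetUr.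
have fI : injective f.
  move=> [b i] [b' i'] e; have eb : b = b' by apply: (fT (b', i')); rewrite -e; exact: (Tf (b, i)).
  subst b'; congr pair; have [n01 n0 n1 _] := neqs b.
  have : p0 b \in f (b, i) = (p0 b \in f (b, i')) by rewrite e.
  by rewrite /f !finset.in_setU1 (negPf n0) !orbF; case: (i); case: (i') => //=; rewrite eqxx (negPf n01).
have -> : #|T| = (#|T0| + #|[set f bi | bi in setT]%SET|)%N.
  rewrite -cardsUI [X in (_ + X)%N](_ : _ = 0%N) ?addn0.
    apply: eq_card => s; rewrite finset.in_setU !finset.inE.
    case: (boolP (s \in S)) => sS /=; last first.
      by apply/esym/negbTE/imsetP => -[bi _ sf]; move: (fS bi); rewrite -sf finset.inE (negPf sS).
    case: (boolP (#|s| == 4%N)) => s4 /=; last first.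
      by apply/esym/negbTE/imsetP => -[bi _ sf]; move: (fS bi); rewrite -sf finset.inE sS (negPf s4).
    case: (boolP [forall b, ~~ (Tri b \subset s)]) => //= /forallPn[b].
    rewrite negbK => bs; apply/esym/imsetP.
    have h i : s \subset f (b, i) -> s = f (b, i).
      move=> sf; apply/eqP; rewrite eqEcard sf; move: (fS (b, i)); rewrite finset.inE => /andP[_ /eqP->].
      by rewrite (eqP s4).
    by have [sl|sl] := mg_link mg sS bs; [exists (b, true)|exists (b, false)]; rewrite ?finset.inE//; exact: h.
  apply/eqP; rewrite cards_eq0 -finset.subset0; apply/fintype.subsetP => s.
  rewrite finset.in_setI finset.inE => /andP[/and3P[_ _ /forallP n] /imsetP[bi _ sf]].
  by have /negP[] := n bi.1; rewrite sf.
by rewrite card_imset// cardsT card_prod card_bool mulnC.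
Qed.

End MergedComplex.

(** * Bistellar moves *)

Section PointwiseContinuity.
Variables (R : realType) (T : topologicalType).
Implicit Types (f g : T -> R) (x : T).

Lemma for_continuousD f g x : {for x, continuous f} -> {for x, continuous g} ->
  {for x, continuous (fun z => f z + g z)}.
Proof. exact: (@continuousD R R^o T f g x). Qed.

Lemma for_continuousB f g x : {for x, continuous f} -> {for x, continuous g} ->
  {for x, continuous (fun z => f z - g z)}.
Proof. exact: (@continuousB R R^o T f g x). Qed.

Lemma for_continuousN f x : {for x, continuous f} -> {for x, continuous (fun z => - f z)}.
Proof. exact: (@continuousN R R^o T f x). Qed.

Lemma for_continuousM f g x : {for x, continuous f} -> {for x, continuous g} ->
  {for x, continuous (fun z => f z * g z)}.
Proof. exact: (@continuousM R T f g x). Qed.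

Lemma for_continuousV f x : f x != 0 -> {for x, continuous f} ->
  {for x, continuous (fun z => (f z)^-1)}.
Proof. exact: (@continuousV R T f x). Qed.

Lemma for_continuous_cst (a : R) x : {for x, continuous (fun _ : T => a)}.
Proof. exact: cst_continuous. Qed.

Lemma for_continuous_min f g x : {for x, continuous f} -> {for x, continuous g} ->
  {for x, continuous (fun z => Num.min (f z) (g z))}.
Proof. exact: (@continuous_min R T f g x). Qed.

Lemma eq_for_continuous (U : topologicalType) (f g : T -> U) x : f =1 g ->
  {for x, continuous f} -> {for x, continuous g}.
Proof. by move=> /funext->. Qed.

Lemma for_continuous_bigmin (I : Type) (r : seq I) (P : pred I) (a : R) (F : I -> T -> R) x :
  (forall i, {for x, continuous (F i)}) ->
  {for x, continuous (fun z => \big[Num.min/a]_(i <- r | P i) F i z)}.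
Proof.
move=> cF; elim: r => [|i r IH].
  by apply: (@eq_for_continuous R _ _ _ _ (@for_continuous_cst a x)) => z; rewrite big_nil.
have [Pi|Pi] := boolP (P i).
  by apply: (@eq_for_continuous R _ _ _ _ (for_continuous_min (cF i) IH)) => z; rewrite big_cons Pi.
by apply: (@eq_for_continuous R _ _ _ _ IH) => z; rewrite big_cons (negPf Pi).
Qed.

Lemma for_continuous_sum (I : Type) (r : seq I) (F : I -> T -> R) x :
  (forall i, {for x, continuous (F i)}) ->
  {for x, continuous (fun z => \sum_(i <- r) F i z)}.
Proof.
move=> cF; elim: r => [|i r IH].
  by apply: (@eq_for_continuous R _ _ _ _ (@for_continuous_cst 0 x)) => z; rewrite big_nil.
by apply: (@eq_for_continuous R _ _ _ _ (for_continuousD (cF i) IH)) => z; rewrite big_cons.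
Qed.

Lemma for_continuous_row d (F : T -> 'rV[R]_d) x :
  (forall j, {for x, continuous (fun z => F z 0 j)}) -> {for x, continuous F}.
Proof.
move=> cF U [P nP PU].
have h : \forall z \near x, forall j, P 0 j (F z 0 j).
  by apply: filter_forall => j; exact: cF (P 0 j) (nP 0 j).
by apply: filterS h => z hz; apply: PU => i j; rewrite ord1.
Qed.

End PointwiseContinuity.

(** * Homeomorphic subsets of coordinate spaces *)

Section Homeomorphic.
Variable R : realType.

(** Both maps are defined on the whole ambient space, and continuity at points of the subset refers
    to that space as well; such maps compose without subspace topologies. *)
Definition homeomorphic d e (A : set 'rV[R]_d) (B : set 'rV[R]_e) : Prop :=
  exists (f : 'rV[R]_d -> 'rV[R]_e) (g : 'rV[R]_e -> 'rV[R]_d),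
    [/\ forall x, A x -> {for x, continuous f},
        forall y, B y -> {for y, continuous g},
        forall x, A x -> B (f x) /\ g (f x) = x &
        forall y, B y -> A (g y) /\ f (g y) = y].

Lemma homeomorphic_refl d (A : set 'rV[R]_d) : homeomorphic A A.
Proof. by exists id, id; split=> // x _; exact: cvg_id. Qed.

Lemma homeomorphic_sym d e (A : set 'rV[R]_d) (B : set 'rV[R]_e) :
  homeomorphic A B -> homeomorphic B A.
Proof. by move=> [f [g [cf cg fg gf]]]; exists g, f. Qed.

Lemma homeomorphic_trans d e k (A : set 'rV[R]_d) (B : set 'rV[R]_e) (C : set 'rV[R]_k) :
  homeomorphic A B -> homeomorphic B C -> homeomorphic A C.
Proof.
move=> [f [g [cf cg fg gf]]] [f' [g' [cf' cg' fg' gf']]].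
exists (f' \o f), (g \o g'); split=> [x Ax|y Cy|x Ax|y Cy] /=.
- by apply: continuous_comp; [exact: cf|apply: cf'; have [] := fg _ Ax].
- by apply: continuous_comp; [exact: cg'|apply: cg; have [] := gf' _ Cy].
- by have [Bx ex] := fg _ Ax; have [Cx ->] := fg' _ Bx.
- by have [Bx ex] := gf' _ Cy; have [Cx ->] := gf _ Bx.
Qed.

Lemma homeomorphic_sphere d (A : set 'rV[R]_d) : A !=set0 ->
  homeomorphic A (sphere3 R) -> homeomorphic_sphere3 R (classical_sets.set_type A).
Proof.
move=> [a Aa] [f [g [cf cg fg gf]]].
pose a0 : classical_sets.set_type A := exist _ a (mem_set Aa).
have valg y : sphere3 R y -> set_val (insubd a0 (g y)) = g y.
  by move=> /gf[/mem_set Ag _]; exact: insubdK.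
exists (f \o set_val), (insubd a0 \o g); split.
- move=> x; apply: continuous_comp; first exact: initial_continuous.
  exact/cf/set_valP.
- apply: continuous_comp_initial.
  apply: (@subspace_eq_continuous _ _ _ g).
    by move=> z /set_mem zi; rewrite /= valg.
  apply: continuous_in_subspaceT => y /set_mem; exact: cg.
- apply/seteqP; split=> [_ [x _ <-]|y yS]; first by have [] := fg _ (set_valP x).
  by exists (insubd a0 (g y)) => //; have [_ e] := gf _ yS; rewrite /= valg.
- by move=> x; apply: val_inj; have [Sx e] := fg _ (set_valP x); rewrite [LHS]valg.
Qed.

End Homeomorphic.

(** * The homeomorphism of a flip *)

Section Flip.
Variables (R : realType) (V : finType).
Local Notation E := 'rV[R]_#|V|.
Implicit Types (A B : {set V}) (S : {set {set V}}) (z : E).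

(** The initial value 1 leaves the minimum over a nonempty [A] unchanged at points of a realisation,
    whose coordinates are at most 1. *)
Definition min_co A z : R := \big[Num.min/1]_(v in A) co z v.

(** Each vertex of [A] gives away the smallest weight found on [A], and the vertices of [B] share
    the proceeds equally; the sum of the coordinates is preserved. *)
Definition slide A B z : E :=
  z + min_co A z *: ((#|A|%:R / #|B|%:R) *: (\sum_(v in B) pt R v) - \sum_(v in A) pt R v).

Lemma continuous_slide A B : continuous (slide A B).
Proof.
apply: continuous_shift => z; apply: for_continuous_bigmin => v.
exact: continuous_co.
Qed.

Lemma min_coE A z c : c <= 1 -> (forall v, v \in A -> c <= co z v) ->
  (exists2 v, v \in A & co z v = c) -> min_co A z = c.
Proof.
move=> c1 cA [v vA vc]; apply/eqP; rewrite eq_le; apply/andP; split.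
  by rewrite -vc; exact: bigmin_le_cond.
by apply/bigmin_geP; split.
Qed.

Lemma co_sum_pt A v : co (\sum_(u in A) pt R u) v = (v \in A)%:R.
Proof.
rewrite co_sum; have [vA|vA] := boolP (v \in A).
  rewrite (bigD1 v)//= co_pt eqxx big1 ?addr0// => u /andP[_ uv].
  by rewrite co_pt eq_sym (negPf uv).
rewrite big1// => u uA; rewrite co_pt; case: eqP => // uv.
by move: vA; rewrite uv uA.
Qed.

(* Bistellar move (or stellar subdivision, when [B] is a new vertex): the simplices
   containing [A] are traded for simplices containing [B]. *)
Definition flips S S' A B : Prop := forall s : {set V}, s \in S ->
  ~~ (B \subset s) /\
  if A \subset s then
    forall Z : {set V}, Z \subset A -> Z != finset.set0 -> ((s :\: Z) :|: B)%SET \in S'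
  else s \in S'.

Lemma realization_slide S S' A B z : fintype.disjoint (mem A) (mem B) -> A != finset.set0 -> B != finset.set0 ->
  flips S S' A B -> realization R S z ->
  realization R S' (slide A B z) /\ slide B A (slide A B z) = z.
Proof.
move=> AB A0 B0 fl [z0 z1 zS]; have [Bz hA] := fl _ zS.
have z1' v : co z v <= 1 by rewrite -z1 (bigD1 v)//= lerDl sumr_ge0.
have [m [m0 mA [v vA vm]]] : exists m, [/\ 0 <= m, forall v, v \in A -> m <= co z v &
    exists2 v, v \in A & co z v = m].
  have /finset.set0Pn[v0 v0A] := A0.
  case: (arg_minP (co z) v0A) => v vA vmin.
  by exists (co z v); split=> //; exists v.
have m1 : m <= 1 by rewrite -vm.
have eA : min_co A z = m by apply: min_coE => //; exists v.
have [A1 B1] : (0 < #|A|)%N /\ (0 < #|B|)%N by rewrite !card_gt0.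
pose r : R := #|A|%:R / #|B|%:R.
have r0 : 0 < r by rewrite divr_gt0// ltr0n.
have coE u : co (slide A B z) u = co z u + m * (r * (u \in B)%:R - (u \in A)%:R).
  by rewrite /slide eA coD coZ !(coD, coZ, coN) !co_sum_pt.
have AnB u : u \in A -> u \notin B by move=> uA; rewrite (disjointFr AB uA).
have BnA u : u \in B -> u \notin A by move=> uB; rewrite (disjointFl AB uB).
have co0 u : 0 <= co (slide A B z) u.
  rewrite coE; have [uA|uA] := boolP (u \in A).
    by rewrite (negPf (AnB _ uA)) mulr0 sub0r mulrN1 subr_ge0 mA.
  by rewrite subr0 addr_ge0// mulr_ge0// mulr_ge0// ltW.
have sum1 : \sum_u co (slide A B z) u = 1.
  under eq_bigr do rewrite coE.
  have c (C : {set V}) : \sum_u (u \in C)%:R = #|C|%:R :> R.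
    by rewrite -sum1_card natr_sum [RHS]big_mkcond/=; apply: eq_bigr => u _; case: ifP.
  rewrite big_split/= z1 -mulr_sumr sumrB -mulr_sumr !c /r divfK ?subrr ?mulr0 ?addr0//.
  by rewrite pnatr_eq0 -lt0n.
(* Some vertex of [B] has weight zero, so after the slide the smallest weight on [B] is exactly the
   amount received, and sliding back returns it. *)
have /subsetPn[w wB wz] := Bz.
have w0 : co z w = 0 by move: wz; rewrite finset.inE negbK => /eqP.
have eB : min_co B (slide A B z) = r * m.
  have wr : co (slide A B z) w = r * m.
    by rewrite coE wB w0 (negPf (BnA _ wB)) subr0 mulr1 add0r mulrC.
  apply: min_coE.
  - by rewrite -wr -sum1 (bigD1 w)//= lerDl sumr_ge0.
  - by move=> u uB; rewrite coE uB (negPf (BnA _ uB)) subr0 mulr1 mulrC lerDr.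
  - by exists w.
split; last first.
  rewrite [LHS]/slide eB {1}/slide eA -/r -addrA -[RHS]addr0; congr (_ + _).
  have -> : #|B|%:R / #|A|%:R = r^-1 by rewrite /r invf_div.
  have rn : r != 0 by rewrite gt_eqF.
  set a := \sum_(v in B) _; set b := \sum_(v in A) _; move: (a) (b) => {}a {}b.
  by apply/rowP => j; rewrite !mxE; field.
split=> //.
have [Az|Az] := boolP (A \subset supp z); last first.
  rewrite (negPf Az) in hA.
  have m00 : m = 0.
    have /subsetPn[u uA uz] := Az.
    apply/eqP; rewrite eq_le m0 andbT (le_trans (mA _ uA))//.
    by move: uz; rewrite finset.inE negbK => /eqP->.
  by rewrite (_ : slide A B z = z)// /slide eA m00 scale0r addr0.
rewrite Az in hA.
have mp : 0 < m by rewrite -vm -supp_pos// (fintype.subsetP Az).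
(* Exactly the vertices of [A] with the smallest weight leave the support. *)
pose Z := [set u in A | co z u == m]%SET.
have -> : supp (slide A B z) = ((supp z :\: Z) :|: B)%SET; last first.
  apply: hA; first by apply/fintype.subsetP => u; rewrite finset.inE => /andP[].
  by apply/finset.set0Pn; exists v; rewrite finset.inE vA vm eqxx.
apply/setP => u; rewrite !finset.inE coE.
have [uB|uB] := boolP (u \in B).
  rewrite (negPf (BnA _ uB)) orbT subr0 mulr1 gt_eqF//.
  by rewrite ltr_wpDl// mulr_gt0.
have [uA|uA] := boolP (u \in A); last by rewrite mulr0 subr0 mulr0 addr0 orbF.
rewrite mulr0 sub0r mulrN1 subr_eq0 orbF /=.
have -> : co z u != 0 by have := fintype.subsetP Az u uA; rewrite finset.inE.
by rewrite andbT.
Qed.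

Lemma homeomorphic_flip S S' A B : fintype.disjoint (mem A) (mem B) -> A != finset.set0 -> B != finset.set0 ->
  flips S S' A B -> flips S' S B A -> homeomorphic (realization R S) (realization R S').
Proof.
move=> AB A0 B0 f f'; exists (slide A B), (slide B A); split.
- by move=> x _; exact: continuous_slide.
- by move=> x _; exact: continuous_slide.
- by move=> x; exact: realization_slide f.
- by move=> x; apply: realization_slide f' => //; rewrite disjoint_sym.
Qed.

End Flip.

(** * The join of two triangle boundaries and the round sphere *)

Section JoinOfTriangles.
Variables (R : realType) (V : finType) (a0 a1 a2 b0 b1 b2 : V).
Local Notation L := [:: a0; a1; a2; b0; b1; b2].
Hypothesis un : uniq L.
Local Notation E := 'rV[R]_#|V|.
Local Notation o4 k := (Ordinal (isT : (k < 4)%N)).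

Definition join_of_triangles : {set {set V}} :=
  [set s : {set V} | [&& [forall v in s, v \in L],
     ~~ [&& a0 \in s, a1 \in s & a2 \in s] & ~~ [&& b0 \in s, b1 \in s & b2 \in s]]]%SET.

(** A linear map: in each of two complementary planes the three vertices go to the unit vectors and
    minus their sum, a triangle around the origin. The join thus goes to the boundary of the free
    sum of two triangles, and radial projection makes it round. *)
Definition unflatten (z : E) : 'rV[R]_4 :=
  \row_(j < 4) nth 0 [:: co z a0 - co z a2; co z a1 - co z a2;
                         co z b0 - co z b2; co z b1 - co z b2] j.

Definition enorm (y : 'rV[R]_4) : R := Num.sqrt (\sum_(i < 4) y 0 i ^+ 2).

Definition low (s t : R) : R := Num.min 0 (Num.min s t).

(** Subtracting [low] is the only way to write a vector of the plane with three nonnegative weights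
    of which one is zero. The weights are positively homogeneous, so dividing them by their total
    undoes the radial projection. *)
Definition weights (y : 'rV[R]_4) : seq R :=
  let l := low (y 0 (o4 0)) (y 0 (o4 1)) in let m := low (y 0 (o4 2)) (y 0 (o4 3)) in
  [:: y 0 (o4 0) - l; y 0 (o4 1) - l; - l; y 0 (o4 2) - m; y 0 (o4 3) - m; - m].

Definition weight_of y v : R := nth 0 (weights y) (index v L).

Definition total y : R := \sum_v weight_of y v.

Definition flatten_sphere y : E := comb (pt R) (fun v => weight_of y v / total y).

Let lowl s t : low s t <= 0. Proof. by rewrite /low ge_min lexx. Qed.
Let lows s t : low s t <= s. Proof. by rewrite /low !ge_min lexx orbT. Qed.
Let lowt s t : low s t <= t. Proof. by rewrite /low !ge_min lexx !orbT. Qed.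
Let lowP s t : [\/ low s t = 0, low s t = s | low s t = t].
Proof.
rewrite /low; case: (leP 0 _) => _; first by constructor 1.
by case: (leP s t) => _; [constructor 2|constructor 3].
Qed.
Let lowM c s t : 0 <= c -> low (c * s) (c * t) = c * low s t.
Proof. by move=> c0; rewrite /low !minr_pMr// mulr0. Qed.

Let wE i y : (i < 6)%N -> weight_of y (nth a0 L i) = nth 0 (weights y) i.
Proof. by move=> i6; rewrite /weight_of index_uniq. Qed.

Let w0 v y : v \notin L -> weight_of y v = 0.
Proof. by move=> vL; rewrite /weight_of memNindex// nth_default. Qed.

Let w_ge0 v y : 0 <= weight_of y v.
Proof.
have [vL|/w0->//] := boolP (v \in L).
rewrite /weight_of; have : (index v L < 6)%N by rewrite index_mem.
by case: index => [|[|[|[|[|[|//]]]]]] _ /=; rewrite ?subr_ge0 ?oppr_ge0.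
Qed.

Let sumL (f : V -> R) : (forall v, v \notin L -> f v = 0) ->
  \sum_v f v = \sum_(v <- L) f v.
Proof.
move=> f0; rewrite (big_uniq _ un)/= [RHS]big_mkcond/=; apply: eq_bigr => v _.
by case: ifPn => // /f0.
Qed.

Let total_gt0 y : y != 0 -> 0 < total y.
Proof.
move=> y0; rewrite lt_neqAle /total sumr_ge0// andbT; apply: contraNneq y0 => /esym/eqP.
rewrite -/(total y) => /eqP t0.
have w00 v : weight_of y v = 0.
  by apply/eqP; move: t0 => /eqP; rewrite psumr_eq0// => /allP; apply; rewrite mem_index_enum.
have := And3 (@wE 0 y isT) (@wE 1 y isT) (@wE 2 y isT); have := And3 (@wE 3 y isT) (@wE 4 y isT) (@wE 5 y isT).
rewrite !w00 /= => -[h3 h4 h5] [h0 h1 h2].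
apply/eqP/rowP => -[[|[|[|[|//]]]] k4]; rewrite mxE.
- by rewrite (_ : Ordinal _ = o4 0); [lra|exact: val_inj].
- by rewrite (_ : Ordinal _ = o4 1); [lra|exact: val_inj].
- by rewrite (_ : Ordinal _ = o4 2); [lra|exact: val_inj].
- by rewrite (_ : Ordinal _ = o4 3); [lra|exact: val_inj].
Qed.

Let flattenE y v : co (flatten_sphere y) v = weight_of y v / total y.
Proof. by rewrite co_comb_pt. Qed.

Let weight_ofZ c y v : 0 <= c -> weight_of (c *: y) v = c * weight_of y v.
Proof.
move=> c0; have [vL|vL] := boolP (v \in L); last by rewrite !w0// mulr0.
rewrite /weight_of; have : (index v L < 6)%N by rewrite index_mem.
by case: index => [|[|[|[|[|[|//]]]]]] _ /=; rewrite !mxE lowM// ?mulrBr// mulrN.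
Qed.

Let flattenZ c y : 0 < c -> flatten_sphere (c *: y) = flatten_sphere y.
Proof.
move=> c0; apply: co_inj => v; rewrite !flattenE /total.
under eq_bigr do rewrite weight_ofZ ?ltW//.
by rewrite weight_ofZ ?ltW// -mulr_sumr invfM mulrACA divff ?mul1r// gt_eqF.
Qed.

Let enormZ c y : 0 <= c -> enorm (c *: y) = c * enorm y.
Proof.
move=> c0; rewrite /enorm; under eq_bigr do rewrite mxE exprMn.
by rewrite -mulr_sumr sqrtrM ?exprn_ge0// sqrtr_sqr ger0_norm.
Qed.

Let enorm_eq0 y : enorm y = 0 -> y = 0.
Proof.
move=> /eqP; rewrite sqrtr_eq0 => h.
have : \sum_(i < 4) y 0 i ^+ 2 == 0 by rewrite eq_le h sumr_ge0// => i _; exact: sqr_ge0.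
rewrite psumr_eq0 => [/allP h'|i _]; last exact: sqr_ge0.
by apply/rowP => i; rewrite mxE; apply/eqP; rewrite -sqrf_eq0; apply: h'; rewrite mem_index_enum.
Qed.

Let unflatten_weights z : realization R join_of_triangles z ->
  forall v, weight_of (unflatten z) v = co z v.
Proof.
move=> [z0 z1]; rewrite finset.inE => /and3P[/forallP zL za zb] v.
have zv0 u : u \notin supp z -> co z u = 0 by rewrite finset.inE negbK => /eqP.
have [vL|vL] := boolP (v \in L); last first.
  by rewrite w0// zv0//; apply: contra vL => vz; exact: (implyP (zL v)).
have lo s t r : 0 <= s -> 0 <= t -> 0 <= r -> [\/ s = 0, t = 0 | r = 0] -> low (s - r) (t - r) = - r.
  move=> s0 t0 r0 str; apply/eqP; rewrite eq_le /low !le_min oppr_le0 r0 !ge_min.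
  by case: str => ->; rewrite ?subr0 ?sub0r ?oppr0 ?lexx ?lerDr ?s0 ?t0 ?orbT//=.
have e a b c : ~~ [&& a \in supp z, b \in supp z & c \in supp z] ->
    [\/ co z a = 0, co z b = 0 | co z c = 0].
  by rewrite !negb_and => /or3P[]/zv0 h; [constructor 1|constructor 2|constructor 3].
have la := lo _ _ _ (z0 a0) (z0 a1) (z0 a2) (e _ _ _ za).
have lb := lo _ _ _ (z0 b0) (z0 b1) (z0 b2) (e _ _ _ zb).
rewrite /weight_of -[v in RHS](nth_index a0 vL).
have : (index v L < 6)%N by rewrite index_mem.
by case: index => [|[|[|[|[|[|//]]]]]] _ /=; rewrite !mxE /= ?la ?lb ?opprK ?subrK.
Qed.

Let unflatten_neq0 z : realization R join_of_triangles z -> unflatten z != 0.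
Proof.
move=> zS; have [_ z1 _] := zS; apply/eqP => e.
move: z1; under eq_bigr do rewrite -(unflatten_weights zS) e -(scale0r 0) weight_ofZ// mul0r.
by rewrite big1// => /esym/eqP; rewrite oner_eq0.
Qed.

Let weight_of_continuous v y : {for y, continuous (fun y => weight_of y v)}.
Proof.
have c i : {for y, continuous (fun y : 'rV[R]_4 => y 0 i)} by exact: coord_continuous.
have lc i j : {for y, continuous (fun y : 'rV[R]_4 => low (y 0 i) (y 0 j))}.
  by apply: for_continuous_min; [exact: for_continuous_cst|exact: for_continuous_min].
have nlc i j : {for y, continuous (fun y : 'rV[R]_4 => - low (y 0 i) (y 0 j))}.
  exact: for_continuousN.
rewrite /weight_of; case: index => [|[|[|[|[|[|k]]]]]] /=.
- exact: for_continuousB.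
- exact: for_continuousB.
- exact: nlc.
- exact: for_continuousB.
- exact: for_continuousB.
- exact: nlc.
- apply: (@eq_for_continuous _ R (fun=> 0) _ _ _ (@for_continuous_cst R _ 0 y)) => z.
  by rewrite nth_default.
Qed.

Let sphere_neq0 y : sphere3 R y -> y != 0.
Proof.
move=> y1; apply/eqP => y0; move: y1; rewrite /sphere3/= y0 big1 => [/esym/eqP|i _].
  by rewrite oner_eq0.
by rewrite mxE expr0n.
Qed.

Lemma sphere_join_of_triangles : homeomorphic (realization R join_of_triangles) (sphere3 R).
Proof.
exists (fun z => (enorm (unflatten z))^-1 *: unflatten z), flatten_sphere; split.
- move=> z zS.
  have c v : {for z, continuous (fun z : E => co z v)} by exact: continuous_co.
  have u j : {for z, continuous (fun z => unflatten z 0 j)}.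
    apply: (@eq_for_continuous _ R (fun z => nth 0 [:: co z a0 - co z a2; co z a1 - co z a2;
        co z b0 - co z b2; co z b1 - co z b2] j)) => [x|]; first by rewrite mxE.
    by case: j => -[|[|[|[|//]]]] k4 /=; exact: for_continuousB.
  apply: for_continuous_row => j.
  apply: (@eq_for_continuous _ R (fun z => (enorm (unflatten z))^-1 * unflatten z 0 j)).
    by move=> x; rewrite [RHS]mxE.
  apply: for_continuousM => //; apply: for_continuousV.
    by apply/eqP => /enorm_eq0 /eqP; rewrite (negPf (unflatten_neq0 zS)).
  apply: (@continuous_comp _ _ _ (fun z => \sum_(i < 4) unflatten z 0 i ^+ 2) Num.sqrt); last exact: sqrt_continuous.
  by apply: for_continuous_sum => i; exact: for_continuousM.
- move=> y yS; apply: for_continuous_row => j.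
  apply: (@eq_for_continuous _ R (fun y => weight_of y (enum_val j) * (total y)^-1)).
    by move=> x; rewrite -flattenE /co enum_valK.
  apply: for_continuousM; first exact: weight_of_continuous.
  apply: for_continuousV; first by rewrite gt_eqF// total_gt0// sphere_neq0.
  by apply: for_continuous_sum => v; exact: weight_of_continuous.
- move=> z zS; have nz : 0 < enorm (unflatten z).
    by rewrite lt_neqAle sqrtr_ge0 andbT eq_sym; apply/eqP => /enorm_eq0/eqP; rewrite (negPf (unflatten_neq0 zS)).
  split.
    have : enorm ((enorm (unflatten z))^-1 *: unflatten z) = 1.
      by rewrite enormZ ?invr_ge0 ?ltW// mulVf// gt_eqF.
    move=> /(congr1 (fun x => x ^+ 2)); rewrite expr1n sqr_sqrtr// sumr_ge0// => i _.
    exact: sqr_ge0.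
  rewrite flattenZ ?invr_gt0//; apply: co_inj => v.
  rewrite flattenE /total; under eq_bigr do rewrite unflatten_weights//.
  by have [_ -> _] := zS; rewrite divr1 unflatten_weights.
- move=> y yS; have t0 := total_gt0 (sphere_neq0 yS); split.
    split=> [v||]; first by rewrite flattenE divr_ge0// ltW.
      under eq_bigr do rewrite flattenE.
      by rewrite -mulr_suml divff// gt_eqF.
    have sE v : (v \in supp (flatten_sphere y)) = (weight_of y v != 0).
      by rewrite finset.inE flattenE mulf_eq0 invr_eq0 (gt_eqF t0) orbF.
    rewrite finset.inE; apply/and3P; split.
    - by apply/forallP => v; apply/implyP; rewrite sE; apply: contraNT => /w0->.
    - have := And3 (@wE 0 y isT) (@wE 1 y isT) (@wE 2 y isT); rewrite !sE /= => -[-> -> ->].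
      by case: (lowP (y 0 (o4 0)) (y 0 (o4 1))) => ->; rewrite ?subrr ?oppr0 eqxx ?andbF.
    - have := And3 (@wE 3 y isT) (@wE 4 y isT) (@wE 5 y isT); rewrite !sE /= => -[-> -> ->].
      by case: (lowP (y 0 (o4 2)) (y 0 (o4 3))) => ->; rewrite ?subrr ?oppr0 eqxx ?andbF.
  have u : unflatten (flatten_sphere y) = (total y)^-1 *: y.
    have := And3 (@wE 0 y isT) (@wE 1 y isT) (@wE 2 y isT); have := And3 (@wE 3 y isT) (@wE 4 y isT) (@wE 5 y isT).
    rewrite /= => -[h3 h4 h5] [h0 h1 h2].
    apply/rowP => -[[|[|[|[|//]]]] k4]; rewrite !mxE/= !flattenE -mulrBl mulrC.
    - by rewrite h0 h2 opprK subrK; congr (_ * y _ _); exact: val_inj.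
    - by rewrite h1 h2 opprK subrK; congr (_ * y _ _); exact: val_inj.
    - by rewrite h3 h5 opprK subrK; congr (_ * y _ _); exact: val_inj.
    - by rewrite h4 h5 opprK subrK; congr (_ * y _ _); exact: val_inj.
  have y1 : enorm y = 1 by rewrite /enorm yS sqrtr1.
  by rewrite u enormZ ?invr_ge0 ?ltW// y1 mulr1 invrK scalerA divff ?scale1r// gt_eqF.
Qed.

End JoinOfTriangles.

(** * Coning off balls in a triangulated sphere *)

Section Coning.
Variables (R : realType) (W Q K : finType) (tau : Q -> {set W}).
Local Notation V := (W + K)%type.
Implicit Types (s t : {set V}) (o : Q -> option K) (q : Q) (k : K) (w : W).

Definition base_part s : {set W} := [set w | inl w \in s]%SET.
Definition apex_part s : {set K} := [set k | inr k \in s]%SET.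

(* The pure complex with facets [tau q], in which for each [k] the union of the facets
   owned by [k] is replaced by the cone from the apex [k] over its boundary. A simplex is
   interior to that union when all facets containing it are owned by [k]. *)
Definition coned o : {set {set V}} :=
  [set s | [&& [exists q, base_part s \subset tau q],
     [forall k, exists q, (base_part s \subset tau q) && (o q != Some k)],
     [forall k in apex_part s, exists q, (base_part s \subset tau q) && (o q == Some k)] &
     [forall k in apex_part s, forall k' in apex_part s, k == k']]]%SET.

Lemma conedP o s : reflect
  [/\ exists q, base_part s \subset tau q,
      forall k, exists2 q, base_part s \subset tau q & o q != Some k,
      forall k, inr k \in s -> exists2 q, base_part s \subset tau q & o q = Some k &
      forall k k', inr k \in s -> inr k' \in s -> k = k'] (s \in coned o).
Proof.
rewrite finset.inE; apply: (iffP and4P) => -[h1 h2 h3 h4].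
  split.
  - exact/existsP.
  - by move=> k; have /existsP[q /andP[]] := forallP h2 k; exists q.
  - move=> k ks; have /existsP[q /andP[qs /eqP]] := implyP (forallP h3 k) ltac:(by rewrite finset.inE).
    by exists q.
  - move=> k k' ks k's; apply/eqP.
    have := implyP (forallP h4 k) ltac:(by rewrite finset.inE).
    by move=> /forallP/(_ k')/implyP; apply; rewrite finset.inE.
split.
- exact/existsP.
- by apply/forallP => k; have [q ? ?] := h2 k; apply/existsP; exists q; apply/andP.
- apply/forallP => k; apply/implyP; rewrite finset.inE => /h3[q qs qk].
  by apply/existsP; exists q; rewrite qs qk eqxx.
- apply/forallP => k; apply/implyP; rewrite finset.inE => ks.
  by apply/forallP => k'; apply/implyP; rewrite finset.inE => k's; rewrite (h4 _ _ ks k's).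
Qed.

Lemma coned_down o s t : s \in coned o -> t \subset s -> t \in coned o.
Proof.
move=> /conedP[[q qs] h2 h3 h4] ts.
have bts : base_part t \subset base_part s.
  by apply/fintype.subsetP => w; rewrite !finset.inE => /(fintype.subsetP ts).
apply/conedP; split.
- by exists q; exact: fintype.subset_trans bts qs.
- by move=> k; have [q' qs' qk] := h2 k; exists q' => //; exact: fintype.subset_trans bts qs'.
- move=> k /(fintype.subsetP ts)/h3[q' qs' qk]; exists q' => //.
  exact: fintype.subset_trans bts qs'.
- by move=> k k' kt k't; apply: h4; exact: (fintype.subsetP ts).
Qed.

(** * Adding one facet to an owned region *)

Section Swallow.
Variables (o : Q -> option K) (q0 : Q) (k0 : K) (A0 : {set W}).
Local Notation B0 := (tau q0 :\: A0)%SET.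
Hypothesis o0 : o q0 = None.
Hypothesis A0q : A0 \subset tau q0.
Hypothesis A00 : A0 != finset.set0.
(** Shelling conditions: the ridges of [tau q0] opposite to [B0] lead into the region of [k0], those
    opposite to [A0] lead out of it. By [starB] the face [B0] is new to the region, and by [starA]
    the face [A0] becomes interior. In the coned complexes this trades [A0] for [B0] together with
    the apex; for empty [B0] the apex appears for the first time, by a stellar subdivision. *)
Hypothesis nbA : forall w, w \in A0 -> exists q,
  [/\ q != q0, tau q0 :\ w \subset tau q & o q != Some k0]%SET.
Hypothesis nbB : forall w, w \in B0 -> exists2 q,
  (tau q0 :\ w \subset tau q)%SET & o q = Some k0.
Hypothesis starA : forall q, q != q0 -> A0 \subset tau q -> o q = Some k0.
Hypothesis starB : forall q, q != q0 -> B0 \subset tau q -> o q != Some k0.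

Definition swallow q := if q == q0 then Some k0 else o q.

Let A : {set V} := [set inl w | w in A0]%SET.
Let B : {set V} := (inr k0 |: [set inl w | w in B0])%SET.

Let inlA w : (inl w \in A) = (w \in A0). Proof. by rewrite mem_imset//; move=> ? ? []. Qed.
Let inrA k : (inr k \in A) = false. Proof. by apply/negbTE/imsetP => -[]. Qed.
Let inlB w : (inl w \in B) = (w \in B0).
Proof. by rewrite finset.in_setU1/= mem_imset//; move=> ? ? []. Qed.
Let inrB k : (inr k \in B) = (k == k0).
Proof.
rewrite finset.in_setU1 (inj_eq (@inr_inj _ _)) [X in _ || X](_ : _ = false) ?orbF//.
by apply/negbTE/imsetP => -[].
Qed.
Let subA s : (A \subset s) = (A0 \subset base_part s).
Proof.
apply/fintype.subsetP/fintype.subsetP => h.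
  by move=> w wA; rewrite finset.inE h// inlA.
by move=> [w|k]; rewrite ?inrA// inlA => /h; rewrite finset.inE.
Qed.
Let subB s : (B \subset s) = (inr k0 \in s) && (B0 \subset base_part s).
Proof.
apply/fintype.subsetP/andP => [h|[k0s /fintype.subsetP h]].
  split; first by rewrite h// inrB.
  by apply/fintype.subsetP => w wB; rewrite finset.inE h// inlB.
move=> [w|k]; first by rewrite inlB => /h; rewrite finset.inE.
by rewrite inrB => /eqP->.
Qed.
Let sub_tau w (r : {set W}) q : (tau q0 :\ w \subset tau q)%SET -> r \subset tau q0 -> w \notin r ->
  r \subset tau q.
Proof. by move=> h rq wr; apply: fintype.subset_trans h; rewrite finset.subsetD1 rq. Qed.

Let swallow_out q : q != q0 -> swallow q = o q.
Proof. by rewrite /swallow => /negPf->. Qed.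
Let swallow_in : swallow q0 = Some k0.
Proof. by rewrite /swallow eqxx. Qed.

Let flips_in : flips (coned o) (coned swallow) A B.
Proof.
move=> s /conedP[h1 h2 h3 h4]; rewrite subA subB; split.
  apply/negP => /andP[/h3[q sq qk] Bs].
  have qq0 : q != q0 by apply: contra_eqN qk => /eqP->; rewrite o0.
  by have := starB qq0 (fintype.subset_trans Bs sq); rewrite qk eqxx.
have [As|/subsetPn[x xA xs]] := boolP (A0 \subset base_part s).
  have only q : base_part s \subset tau q -> q != q0 -> o q = Some k0.
    by move=> sq qq0; apply: starA => //; exact: fintype.subset_trans As sq.
  (* The base of [s] is not interior to the region of [k0], while every facet around it other than
     [tau q0] belongs to that region. *)
  have sq0 : base_part s \subset tau q0.
    have [q sq qk] := h2 k0; have [<-//|/(only _ sq) e] := eqVneq q q0.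
    by rewrite e eqxx in qk.
  have apex k : inr k \in s -> k = k0.
    move=> /h3[q sq qk]; have [e|/(only _ sq)] := eqVneq q q0.
      by move: qk; rewrite e o0.
    by rewrite qk => -[].
  move=> Z ZA Z0.
  have [x xA xZ] : exists2 x, x \in A0 & inl x \in Z.
    have /finset.set0Pn[[x|k] xZ] := Z0; have := fintype.subsetP ZA _ xZ; last by rewrite inrA.
    by rewrite inlA => xA; exists x.
  set t := (_ :|: _)%SET.
  have tq0 : base_part t \subset tau q0.
    apply/fintype.subsetP => w; rewrite !finset.inE => /orP[/andP[_ ws]|].
      by apply: (fintype.subsetP sq0); rewrite finset.inE.
    by rewrite -finset.in_setU1 inlB finset.inE => /andP[].
  have xt : x \notin base_part t.
    by rewrite finset.inE finset.in_setU inlB !finset.in_setD xZ xA.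
  have kt k : inr k \in t -> k = k0.
    by rewrite finset.in_setU inrB finset.in_setD => /orP[/andP[_ /apex]|/eqP].
  apply/conedP; split.
  - by exists q0.
  - move=> k; have [->|kk0] := eqVneq k k0; last first.
      by exists q0 => //; rewrite swallow_in; apply: contra kk0 => /eqP[->].
    have [q [qq0 xq qk]] := nbA xA; exists q; last by rewrite swallow_out.
    exact: sub_tau xq tq0 xt.
  - by move=> k /kt->; exists q0.
  - by move=> k k' /kt-> /kt->.
apply/conedP; split=> //.
- move=> k; have [q sq qk] := h2 k; have [e|qq0] := eqVneq q q0; last by exists q; rewrite ?swallow_out.
  rewrite e in sq; have [->|kk0] := eqVneq k k0; last first.
    by exists q0 => //; rewrite swallow_in; apply: contra kk0 => /eqP[->].
  have [q' [qq0 xq qk']] := nbA xA; exists q'; last by rewrite swallow_out.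
  exact: sub_tau xq sq xs.
- move=> k /h3[q sq qk]; exists q => //; rewrite swallow_out//.
  by apply: contra_eqN qk => /eqP->; rewrite o0.
Qed.

Let flips_out : flips (coned swallow) (coned o) B A.
Proof.
move=> s /conedP[h1 h2 h3 h4]; rewrite subA subB; split.
  apply/negP => As; have [q sq] := h2 k0.
  have [->|qq0] := eqVneq q q0; first by rewrite swallow_in eqxx.
  by rewrite swallow_out// starA ?eqxx//; exact: fintype.subset_trans As sq.
have [/andP[k0s Bs]|nBs] := boolP (_ && _).
  (* An apex needs a facet of its region around the base; by [starB] the only such facet that
     contains [B0] is the one just swallowed. *)
  have sq0 : base_part s \subset tau q0.
    have [q sq] := h3 _ k0s; have [<-//|qq0] := eqVneq q q0.
    rewrite swallow_out// => qk.
    by have := starB qq0 (fintype.subset_trans Bs sq); rewrite qk eqxx.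
  move=> Z ZB Z0; set t := (_ :|: _)%SET.
  have tq0 : base_part t \subset tau q0.
    apply/fintype.subsetP => w; rewrite !finset.inE => /orP[/andP[_ ws]|].
      by apply: (fintype.subsetP sq0); rewrite finset.inE.
    by rewrite inlA; exact: fintype.subsetP.
  have kt k : inr k \in t -> k = k0 /\ inr k0 \notin Z.
    rewrite finset.in_setU inrA orbF finset.in_setD => /andP[kZ ks].
    by rewrite (h4 _ _ ks k0s) in kZ *.
  apply/conedP; split.
  - by exists q0.
  - by move=> k; exists q0; rewrite ?o0.
  - move=> k /kt[-> k0Z].
    have [x xB xZ] : exists2 x, x \in B0 & inl x \in Z.
      have /finset.set0Pn[[x|k'] xZ] := Z0; have := fintype.subsetP ZB _ xZ.
        by rewrite inlB => xB; exists x.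
      by rewrite inrB => /eqP e; move: k0Z; rewrite -e xZ.
    have [q xq qk] := nbB xB; exists q => //; apply: sub_tau xq tq0 _.
    rewrite finset.inE finset.in_setU inlA finset.in_setD xZ/=.
    by move: xB; rewrite finset.in_setD => /andP[].
  - by move=> k k' /kt[-> _] /kt[-> _].
apply/conedP; split=> //.
- move=> k; have [q sq qk] := h2 k; have [e|qq0] := eqVneq q q0; last first.
    by exists q; rewrite // -swallow_out.
  by exists q0; rewrite -?e// e o0.
- move=> k ks; have [q sq qk] := h3 _ ks; have [e|qq0] := eqVneq q q0; last first.
    by exists q; rewrite // -swallow_out.
  move: qk; rewrite e swallow_in => -[ek]; rewrite -ek in ks *.
  move: nBs; rewrite ks/= => /subsetPn[x xB xs].
  have [q' xq qk'] := nbB xB; exists q' => //; apply: sub_tau xq _ xs.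
  by rewrite -e.
Qed.

Lemma homeomorphic_swallow :
  homeomorphic (realization R (coned o)) (realization R (coned swallow)).
Proof.
apply: homeomorphic_flip flips_in flips_out.
- rewrite disjoint_subset; apply/fintype.subsetP => -[w|k]; rewrite ?inrA// inlA => wA.
  by have : inl w \notin B by rewrite inlB finset.in_setD wA.
- have /finset.set0Pn[w wA] := A00; apply/finset.set0Pn; exists (inl w).
  by rewrite inlA.
- by apply/finset.set0Pn; exists (inr k0); rewrite inrB.
Qed.

End Swallow.
End Coning.

(** * The grid of squares *)

Definition nxt (n i : nat) : nat := if (i.+1 < n)%N then i.+1 else 0%N.
Definition edge (n i x : nat) : bool := (x == i) || (x == nxt n i).

(** Unfolding the cyclic successor makes incidence a matter of linear arithmetic for [lia]. *)
Lemma edgeP n i x : reflect (x = i \/ ((i.+1 < n)%N /\ x = i.+1) \/ ((n <= i.+1)%N /\ x = 0%N))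
  (edge n i x).
Proof.
rewrite /edge /nxt; apply: (iffP orP); case: ltnP => h.
- by case=> /eqP->; [left|right; left].
- by case=> /eqP->; [left|right; right].
- by case=> [->|[[_ ->]|[]]]; [left|right|lia].
- by case=> [->|[[]|[_ ->]]]; [left|lia|right].
Qed.

(* The cycle lives on the first [k] of [n] vertices. *)
Definition cycle_face (n k : nat) (r : {set 'I_n}) : bool :=
  [exists i : 'I_n, (i < k)%N && [forall x in r, edge k i x]].

Lemma cycle_faceP (n k : nat) (r : {set 'I_n}) : reflect
  (exists2 i, (i < k <= n)%N & forall x : 'I_n, x \in r -> edge k i x)
  ((k <= n)%N && cycle_face k r).
Proof.
apply: (iffP andP) => [[kn /existsP[i /andP[ik /forallP h]]]|[i /andP[ik kn] h]].
  by exists i; [rewrite ik|move=> x xr; exact: (implyP (h x))].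
split=> //; apply/existsP; exists (Ordinal (leq_trans ik kn)); rewrite /= ik.
by apply/forallP => x; apply/implyP; exact: h.
Qed.

(** * Subdividing a cycle inside a join *)

Section Subdivision.
Variables (R : realType) (V : finType) (n : nat) (u : 'I_n -> V) (rest : {set V} -> bool).
Hypothesis u_inj : injective u.
Hypothesis rest_ext : forall s t : {set V},
  (forall v, v \notin codom u -> (v \in s) = (v \in t)) -> rest s = rest t.

(** The join of a [k]-cycle with whatever [rest] prescribes on the vertices outside the image of
    [u]. *)
Definition cycle_complex (k : nat) : {set {set V}} :=
  [set s : {set V} | cycle_face k (u @^-1: s)%SET && rest s]%SET.

Let in_cycle k (s : {set V}) : (k <= n)%N -> s \in cycle_complex k <->
  (exists2 i, (i < k)%N & forall x : 'I_n, u x \in s -> edge k i x) /\ rest s.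
Proof.
move=> kn; rewrite finset.inE; split=> [/andP[c ->]|[[i ik h] ->]].
  have /cycle_faceP[i /andP[ik _] h] : (k <= n)%N && cycle_face k (u @^-1: s)%SET by rewrite kn.
  by split=> //; exists i => // x xs; apply: h; rewrite finset.inE.
rewrite andbT; have /andP[] // : (k <= n)%N && cycle_face k (u @^-1: s)%SET.
by apply/cycle_faceP; exists i; [rewrite ik|move=> x; rewrite finset.inE; exact: h].
Qed.

(** Stellar subdivision of the edge from [k.-1] to 0 by the vertex [k], that is, a flip with a
    singleton [B]. *)
Lemma homeomorphic_subdivision k : (2 < k < n)%N ->
  homeomorphic (realization R (cycle_complex k)) (realization R (cycle_complex k.+1)).
Proof.
move=> /andP[k2 kn].
have n0 : (0 < n)%N by lia. have n1 : (k.-1 < n)%N by lia.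
pose x0 : 'I_n := Ordinal n0; pose x1 : 'I_n := Ordinal n1; pose x2 : 'I_n := Ordinal kn.
pose A : {set V} := [set u x1; u x0]%SET; pose B : {set V} := [set u x2]%SET.
have uA x : (u x \in A) = (x == k.-1 :> nat) || (x == 0%N :> nat).
  by rewrite !finset.inE !(inj_eq u_inj) -!val_eqE.
have uB x : (u x \in B) = (x == k :> nat).
  by rewrite !finset.inE (inj_eq u_inj) -val_eqE.
have AnB : forall v, v \in A :|: B -> v \in codom u.
  by move=> v; rewrite !finset.inE => /orP[/orP[]|] /eqP->; exact: codom_f.
have rE (s Z T : {set V}) : Z \subset A :|: B -> T \subset A :|: B ->
    rest ((s :\: Z) :|: T)%SET = rest s.
  move=> ZA TA; apply: rest_ext => v vu; rewrite finset.in_setU finset.in_setD.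
  have nA (Y : {set V}) : Y \subset A :|: B -> v \notin Y.
    by move=> YA; apply: contra vu => /(fintype.subsetP YA)/AnB.
  by rewrite (negPf (nA _ TA)) orbF nA.
have subA (s : {set V}) : (A \subset s) = (u x1 \in s) && (u x0 \in s).
  by rewrite finset.subUset !finset.sub1set.
have subB (s : {set V}) : (B \subset s) = (u x2 \in s) by rewrite finset.sub1set.
apply: (@homeomorphic_flip R V _ _ A B).
- rewrite disjoint_subset; apply/fintype.subsetP => v vA.
  have : v \notin B.
    by rewrite finset.inE; case/finset.set2P: vA => ->; rewrite (inj_eq u_inj) -val_eqE/=; lia.
  by [].
- by apply/finset.set0Pn; exists (u x1); rewrite !finset.inE eqxx.
- by apply/finset.set0Pn; exists (u x2); rewrite !finset.inE eqxx.
- move=> s /in_cycle[|[i ik h] rs]; first exact: ltnW.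
  rewrite subB subA; split; first by apply/negP => /h/edgeP/=; lia.
  case: ifP => [/andP[/h/edgeP/= e1 /h/edgeP/= e0] Z ZA Z0|/negP ns].
    have ik1 : i = k.-1 by lia.
    have [z /fintype.subsetP/(_ z) zA zZ] : exists2 z, Z \subset A & z \in Z.
      by have /finset.set0Pn[z zZ] := Z0; exists z.
    have [x xA xZ] : exists2 x : 'I_n, (x == k.-1 :> nat) || (x == 0%N :> nat) & u x \in Z.
      have := zA zZ; rewrite !finset.inE => /orP[]/eqP e; rewrite e in zZ.
        by exists x1; rewrite /= ?eqxx.
      by exists x0; rewrite /= ?eqxx ?orbT.
    apply/in_cycle => //; split; last first.
      by rewrite rE ?finset.subsetUr//; apply: fintype.subset_trans ZA (finset.subsetUl _ _).
    (* With the endpoint [x] of the old edge removed, what is left lies on the half of the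
       subdivided edge away from [x]. *)
    exists (if x == k.-1 :> nat then k else k.-1); first by case: ifP => _; lia.
    move=> y; rewrite finset.in_setU finset.in_setD uB => /orP[/andP[yZ /h/edgeP ye]|/eqP yk].
      have yx : y <> x :> nat by move=> /val_inj yx; move: yZ; rewrite yx xZ.
      by apply/edgeP; case: ifP => [/eqP|/eqP]; lia.
    by apply/edgeP; case: ifP => [/eqP|/eqP]; lia.
  apply/in_cycle => //; split=> //.
  have [ik1|ik1] := eqVneq i k.-1; last first.
    by exists i; [lia|move=> x /h/edgeP e; apply/edgeP; lia].
  have [s1|s1] := boolP (u x1 \in s).
    have s0 : u x0 \notin s by apply/negP => s0; apply: ns; rewrite s1 s0.
    exists k.-1; first by lia.
    move=> x xs; apply/edgeP; have /edgeP := h _ xs.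
    have : x <> 0%N :> nat.
      by move=> e; move: s0; rewrite (_ : x0 = x) ?xs//; exact: val_inj.
    by lia.
  exists 0%N; first by lia.
  move=> x xs; apply/edgeP; have /edgeP := h _ xs.
  have : x <> k.-1 :> nat.
    by move=> e; move: s1; rewrite (_ : x1 = x) ?xs//; exact: val_inj.
  by lia.
- move=> s /in_cycle[//|[i ik h] rs]; rewrite subB subA; split.
    by apply/negP => /andP[/h/edgeP/= e1 /h/edgeP/=]; lia.
  case: ifP => [/h/edgeP/= e2 Z ZB Z0|/negP ns].
    have zZ : u x2 \in Z.
      by have /finset.set0Pn[z zZ] := Z0; have := fintype.subsetP ZB _ zZ; rewrite finset.inE => /eqP<-.
    apply/in_cycle; first exact: ltnW.
    split; last first.
      by rewrite rE ?finset.subsetUl//; apply: fintype.subset_trans ZB (finset.subsetUr _ _).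
    exists k.-1; first by lia.
    move=> x; rewrite finset.in_setU finset.in_setD uA => /orP[/andP[xZ /h/edgeP e]|/orP[]/eqP e].
    - have : x <> k :> nat by move=> e'; move: xZ; rewrite (_ : x = x2) ?zZ//; exact: val_inj.
      by move=> ?; apply/edgeP; lia.
    - by apply/edgeP; lia.
    - by apply/edgeP; lia.
  apply/in_cycle; first exact: ltnW.
  split=> //.
  have nk (x : 'I_n) : u x \in s -> x <> k :> nat.
    by move=> xs e; apply: ns; rewrite (_ : x2 = x)//; exact: val_inj.
  exists (if i == k then 0%N else i); first by case: eqP => ?; lia.
  by move=> x xs; have := nk _ xs; have /edgeP := h _ xs; move=> ? ?; apply/edgeP; case: eqP; lia.
Qed.

Lemma homeomorphic_cycle k l : (2 < k <= l)%N -> (l <= n)%N ->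
  homeomorphic (realization R (cycle_complex k)) (realization R (cycle_complex l)).
Proof.
move=> /andP[k2]; elim: l => [|l IH]; first by rewrite leqn0 => /eqP-> _; exact: homeomorphic_refl.
rewrite leq_eqVlt => /orP[/eqP-> _|kl ln]; first exact: homeomorphic_refl.
apply: homeomorphic_trans (IH kl (ltnW ln)) _.
by apply: homeomorphic_subdivision; lia.
Qed.

End Subdivision.

(** * Growing the slabs square by square *)

Section Grid.
Variables (R : realType) (P Q : nat).
Hypotheses (P4 : (3 < P)%N) (Q4 : (3 < Q)%N).

(** The largest index sum of an inner square is [P - 2 + (Q - 2)]. *)
Definition slabs : nat := ((P - 2 + (Q - 2)) %/ 4).+1.
Local Notation point := ('I_P + 'I_Q)%type.
Local Notation vertex := (point + 'I_slabs)%type.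
Local Notation square := ('I_P * 'I_Q)%type.
Implicit Types s t : square.

(* [inl (inl i)] and [inl (inr j)] are the vertices of two cycles of lengths [P] and [Q],
   and the square [(i, j)] stands for the tetrahedron spanned by the i-th edge of the first cycle
   and the j-th edge of the second one. *)
Definition corners s : {set point} :=
  [set w : point | match w with inl x => edge P s.1 x | inr y => edge Q s.2 y end]%SET.

Definition inner s : bool := (s.1.+1 < P)%N && (s.2.+1 < Q)%N.

Definition slab s : 'I_slabs := inord ((s.1 + s.2) %/ 4).

Lemma slab_val s : inner s -> slab s = ((s.1 + s.2) %/ 4)%N :> nat.
Proof.
move=> /andP[h1 h2]; rewrite inordK// /slabs ltnS leq_div2r//.
by have := ltn_ord s.1; have := ltn_ord s.2; lia.
Qed.

Lemma slab_eq s t : inner s -> inner t ->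
  (Some (slab s) == Some (slab t)) = ((s.1 + s.2) %/ 4 == (t.1 + t.2) %/ 4)%N.
Proof. by move=> si ti; rewrite [LHS](inj_eq (@Some_inj _)) -val_eqE /= !slab_val. Qed.

(* Each diagonal slab of thickness 4 swallows its squares column by column, each column from
   top to bottom. *)
Definition owner (c r : nat) s : option 'I_slabs :=
  if inner s && ((s.1 < c) || ((s.1 == c :> nat) && (Q <= s.2 + r)))%N then Some (slab s) else None.

Definition final_owner s : option 'I_slabs := if inner s then Some (slab s) else None.

Lemma corners_inl s (x : 'I_P) : (inl x \in corners s) = edge P s.1 x.
Proof. by rewrite finset.inE. Qed.
Lemma corners_inr s (y : 'I_Q) : (inr y \in corners s) = edge Q s.2 y.
Proof. by rewrite finset.inE. Qed.

Section Step.
Variables (c r : nat) (i : 'I_P) (j : 'I_Q).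
Hypotheses (ic : i = c :> nat) (jr : (j + r.+1)%N = Q) (inn : inner (i, j)).
(** In the chosen order the right and lower neighbours are not yet swallowed. [left] and [top] tell
    whether the other two neighbours belong to the same slab, in which case they already are. *)
Let left : bool := (0 < i)%N && ((i + j) %% 4 != 0)%N.
Let top : bool := (j.+2 < Q)%N && ((i + j) %% 4 != 3)%N.
Let hi : (i.+1 < P)%N. Proof. by case/andP: inn. Qed.
Let hj : (j.+1 < Q)%N. Proof. by case/andP: inn. Qed.

(** The face without vertex [i.+1] of the first cycle is shared with the left neighbour, the face
    without vertex [j] of the second with the upper one. These two vertices leave [A0] when the
    neighbour in question is already swallowed. *)
Let A0 : {set point} := [set w : point in corners (i, j) | match w with
  inl x => ~~ (left && (x == i.+1 :> nat)) | inr y => ~~ (top && (y == j :> nat)) end]%SET.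

Let q0 : square := (i, j).

Let subl (i' : 'I_P) (x : 'I_P) : (forall x', edge P i x' -> x' != x -> edge P i' x') ->
  (corners q0 :\ inl x \subset corners (i', j))%SET.
Proof.
move=> h; apply/fintype.subsetP => -[x'|y'] /finset.setD1P[].
  by rewrite !corners_inl => n e; apply: h => //; apply: contra n => /eqP e'; apply/eqP; congr inl; exact: val_inj.
by rewrite !corners_inr.
Qed.

Let subr (j' : 'I_Q) (y : 'I_Q) : (forall y', edge Q j y' -> y' != y -> edge Q j' y') ->
  (corners q0 :\ inr y \subset corners (i, j'))%SET.
Proof.
move=> h; apply/fintype.subsetP => -[x'|y'] /finset.setD1P[].
  by rewrite !corners_inl.
by rewrite !corners_inr => n e; apply: h => //; apply: contra n => /eqP e'; apply/eqP; congr inr; exact: val_inj.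
Qed.

Let owned s : inner s -> (s.1 < i)%N || ((s.1 == i :> nat) && (j < s.2)%N) ->
  ((s.1 + s.2) %/ 4 = (i + j) %/ 4)%N -> owner c r s = Some (slab q0).
Proof.
move=> si h e; rewrite /owner si/=; case: ifP => [_|/negP[]]; last by move: h jr ic; lia.
by apply/eqP; rewrite slab_eq// e.
Qed.

Let not_owned s : [\/ ~~ inner s, ~~ ((s.1 < i)%N || ((s.1 == i :> nat) && (j < s.2)%N)) |
  ((s.1 + s.2) %/ 4 <> (i + j) %/ 4)%N] -> owner c r s != Some (slab q0).
Proof.
move=> h; rewrite /owner; case: ifP => // /andP[si hs]; rewrite slab_eq//.
case: h => [|/negP h|/eqP//]; first by rewrite si.
by case: h; move: hs jr ic; lia.
Qed.

Let nbA w : w \in A0 -> exists q,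
  [/\ q != q0, corners q0 :\ w \subset corners q & owner c r q != Some (slab q0)]%SET.
Proof.
have ip := ltn_ord i; have jp := ltn_ord j.
case: w => [x|y]; rewrite finset.inE.
  rewrite corners_inl => /andP[/edgeP/= ex].
  have [xi _|xi] := eqVneq (x : nat) i.
    exists (Ordinal hi, j); split.
    - by rewrite xpair_eqE -val_eqE/= (gtn_eqF (ltnSn _)).
    - by apply: subl => x' /edgeP e /eqP n; apply/edgeP => /=; lia.
    - by apply: not_owned; constructor 2 => /=; lia.
  have {xi}ex : x = i.+1 :> nat by lia.
  rewrite ex eqxx andbT /left negb_and -leqNgt leqn0 negbK => h.
  have [i0|i0] := posnP i.
    have PP : (P.-1 < P)%N by lia.
    exists (Ordinal PP, j); split.
    - by rewrite xpair_eqE -val_eqE/= eqxx andbT; apply/eqP; lia.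
    - by apply: subl => x' /edgeP e /eqP n; apply/edgeP => /=; lia.
    - by apply: not_owned; constructor 1; rewrite /inner/=; lia.
  have ii : (i.-1 < P)%N by lia.
  exists (Ordinal ii, j); split.
  - by rewrite xpair_eqE -val_eqE/= eqxx andbT; apply/eqP; lia.
  - by apply: subl => x' /edgeP e /eqP n; apply/edgeP => /=; lia.
  - by apply: not_owned; constructor 3 => /=; lia.
rewrite corners_inr => /andP[/edgeP/= ey].
have [yj|yj _] := eqVneq (y : nat) j.
  rewrite andbT /top negb_and negbK -leqNgt => h.
  exists (i, Ordinal hj); split.
  - by rewrite xpair_eqE -!val_eqE/= eqxx/=; apply/eqP; lia.
  - by apply: subr => y' /edgeP e /eqP n; apply/edgeP => /=; lia.
  - have [jq|jq] := leqP Q j.+2; first by apply: not_owned; constructor 1; rewrite /inner/=; lia.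
    by apply: not_owned; constructor 3 => /=; lia.
have {yj}ey : y = j.+1 :> nat by lia.
have [j0|j0] := posnP j.
  have QQ : (Q.-1 < Q)%N by lia.
  exists (i, Ordinal QQ); split.
  - by rewrite xpair_eqE -!val_eqE/= eqxx/=; apply/eqP; lia.
  - by apply: subr => y' /edgeP e /eqP n; apply/edgeP => /=; lia.
  - by apply: not_owned; constructor 1; rewrite /inner/=; lia.
have jj : (j.-1 < Q)%N by lia.
exists (i, Ordinal jj); split.
- by rewrite xpair_eqE -!val_eqE/= eqxx/=; apply/eqP; lia.
- by apply: subr => y' /edgeP e /eqP n; apply/edgeP => /=; lia.
- by apply: not_owned; constructor 2 => /=; lia.
Qed.

Let nbB w : w \in (corners q0 :\: A0)%SET -> exists2 q,
  (corners q0 :\ w \subset corners q)%SET & owner c r q = Some (slab q0).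
Proof.
have ip := ltn_ord i; have jp := ltn_ord j.
case: w => [x|y]; rewrite finset.in_setD !finset.inE/=.
  case: (edge P i x) => //=; rewrite ?andbF// andbT negbK => /andP[/andP[i0 m] /eqP xi].
  have ii : (i.-1 < P)%N by lia.
  exists (Ordinal ii, j).
    by apply: subl => x' /edgeP e /eqP n; apply/edgeP => /=; lia.
  by apply: owned; rewrite /inner/=; lia.
case: (edge Q j y) => //=; rewrite ?andbF// andbT negbK => /andP[/andP[j0 m] /eqP yj].
exists (i, Ordinal hj).
  by apply: subr => y' /edgeP e /eqP n; apply/edgeP => /=; lia.
by apply: owned; rewrite /inner/=; lia.
Qed.

(** The vertices [i] and [j.+1] always belong to [A0], so the other squares around it can only be
    the left, the upper and the upper left one, as far as [left] and [top] allow. The upper left one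
    has the same index sum as the square itself. *)
Let starA q : q != q0 -> A0 \subset corners q -> owner c r q = Some (slab q0).
Proof.
have ip := ltn_ord i; have jp := ltn_ord j.
case: q => i' j' n /fintype.subsetP A0q; have i'P := ltn_ord i'; have j'Q := ltn_ord j'.
have /edgeP/= a1 : edge P i' i.
  have := A0q (inl i); rewrite !finset.inE/= /edge eqxx/= => -> //.
  by apply/negP => /andP[_ /eqP]; lia.
have /edgeP/= a2 : edge Q j' j.+1.
  have := A0q (inr (Ordinal hj)); rewrite !finset.inE/= [edge Q j j.+1]/edge /nxt hj eqxx orbT/= => -> //.
  by apply/negP => /andP[_ /eqP]; lia.
have a3 : ~~ left -> edge P i' i.+1.
  move=> nl; have := A0q (inl (Ordinal hi)); rewrite !finset.inE/= [edge P i i.+1]/edge /nxt hi eqxx orbT/= => -> //.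
  by rewrite (negPf nl).
have a4 : ~~ top -> edge Q j' j.
  move=> nt; have := A0q (inr j); rewrite !finset.inE/= [edge Q j j]/edge eqxx/= => -> //.
  by rewrite (negPf nt).
have ne : (i' <> i :> nat) \/ (j' <> j :> nat).
  have [e|e] := eqVneq (i' : nat) i; last by left; apply/eqP.
  right=> e'; move: n; rewrite /q0 xpair_eqE -!val_eqE/= e e' !eqxx//.
have l : i' = i :> nat \/ left.
  have [lf|/a3/edgeP/=] := boolP left; first by right.
  by lia.
have t : j' = j :> nat \/ top.
  have [lf|/a4/edgeP/=] := boolP top; first by right.
  by lia.
rewrite /left in l; rewrite /top in t.
by apply: owned; rewrite /inner/=; lia.
Qed.

Let starB q : q != q0 -> (corners q0 :\: A0)%SET \subset corners q -> owner c r q != Some (slab q0).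
Proof.
have ip := ltn_ord i; have jp := ltn_ord j.
case: q => i' j' n /fintype.subsetP A0q; have i'P := ltn_ord i'; have j'Q := ltn_ord j'.
have ne : (i' <> i :> nat) \/ (j' <> j :> nat).
  have [e|e] := eqVneq (i' : nat) i; last by left; apply/eqP.
  right=> e'; move: n; rewrite /q0 xpair_eqE -!val_eqE/= e e' !eqxx//.
have l : left -> edge P i' i.+1.
  move=> lf; have := A0q (inl (Ordinal hi)); rewrite !finset.inE/= [edge P i i.+1]/edge /nxt hi eqxx orbT/= lf.
  by apply.
have t : top -> edge Q j' j.
  move=> tp; have := A0q (inr j); rewrite !finset.inE/= [edge Q j j]/edge eqxx/= tp.
  by apply.
have l' : ~~ left \/ edge P i' i.+1 by have [/l|] := boolP left; [right|left].
have t' : ~~ top \/ edge Q j' j by have [/t|] := boolP top; [right|left].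
apply: not_owned => /=.
have [ii|] := boolP (inner (i', j')); last by constructor 1.
have [/eqP e|/eqP e] := boolP ((i' + j') %/ 4 == (i + j) %/ 4)%N; last by constructor 3.
constructor 2; move: ii; rewrite /inner/= => /andP[i1 j1].
rewrite /left in l'; rewrite /top in t'.
have {}l' : ~~ ((0 < i)%N && ((i + j) %% 4 != 0)%N) \/ (i' = i.+1 :> nat \/ i' = i :> nat).
  by case: l' => [|/edgeP]; [left|right; lia].
have {}t' : ~~ ((j.+2 < Q)%N && ((i + j) %% 4 != 3)%N) \/ (j' = j :> nat \/ j'.+1 = j :> nat).
  by case: t' => [|/edgeP]; [left|right; lia].
by lia.
Qed.

Lemma homeomorphic_step :
  homeomorphic (realization R (coned corners (owner c r)))
               (realization R (coned corners (owner c r.+1))).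
Proof.
have -> : owner c r.+1 = swallow (owner c r) q0 (slab q0).
  apply/funext => -[i' j']; rewrite /swallow /owner /q0 xpair_eqE -!val_eqE/=.
  have [e|e] := eqVneq (i' : nat) i; have [e'|e'] := eqVneq (j' : nat) j => /=.
  - have [-> ->] : i' = i /\ j' = j by split; exact: val_inj.
    by rewrite inn/= ifT//; move: jr ic; lia.
  - by congr (if _ && _ then _ else _); move: jr ic e'; lia.
  - by congr (if _ && _ then _ else _); move: jr ic e; lia.
  - by congr (if _ && _ then _ else _); move: jr ic e; lia.
apply: homeomorphic_swallow nbA nbB starA starB.
- by rewrite /owner inn/=; case: ifP => //; move: jr ic; lia.
- by apply/fintype.subsetP => w; rewrite finset.inE => /andP[].
- apply/finset.set0Pn; exists (inl i); rewrite !finset.inE/= /edge eqxx/=.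
  by apply/negP => /andP[_ /eqP]; lia.
Qed.

End Step.

Lemma homeomorphic_column c r : (c < P)%N -> (r <= Q)%N ->
  homeomorphic (realization R (coned corners (owner c 0)))
               (realization R (coned corners (owner c r))).
Proof.
move=> cP; elim: r => [|r IH] rQ; first exact: homeomorphic_refl.
apply: homeomorphic_trans (IH (ltnW rQ)) _.
have jQ : (Q - r.+1 < Q)%N by lia.
have [inn|out] := boolP (inner (Ordinal cP, Ordinal jQ)).
  by apply: homeomorphic_step inn => //=; lia.
have -> : owner c r.+1 = owner c r; last exact: homeomorphic_refl.
apply/funext => -[i j]; rewrite /owner; case: ifP => [/andP[]|/negP h].
  move=> ii; case/orP => [->|/andP[/eqP/= ic jr]]; first by rewrite ii.
  rewrite ii ic eqxx ltnn /=; case: ifP => // jr'; case/negP: out.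
  by move: ii; rewrite /inner/= ic; lia.
by case: ifP => // /andP[ii ir]; case: h; rewrite ii; lia.
Qed.

Lemma homeomorphic_columns c : (c <= P)%N ->
  homeomorphic (realization R (coned corners (owner 0 0)))
               (realization R (coned corners (owner c 0))).
Proof.
elim: c => [|c IH] cP; first exact: homeomorphic_refl.
apply: homeomorphic_trans (IH (ltnW cP)) _.
have -> : owner c.+1 0 = owner c Q; last exact: homeomorphic_column.
apply/funext => -[i j]; rewrite /owner; congr (if _ && _ then _ else _).
by have := ltn_ord j; rewrite /=; lia.
Qed.

Lemma owner_final : owner P 0 = final_owner.
Proof. by apply/funext => -[i j]; rewrite /owner /final_owner ltn_ord andbT. Qed.

Let ua (x : 'I_P) : vertex := inl (inl x).
Let ub (y : 'I_Q) : vertex := inl (inr y).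

Let no_apex (s : {set vertex}) : bool := [forall k, inr k \notin s].
Let rest_a l (s : {set vertex}) : bool := cycle_face l (ub @^-1: s)%SET && no_apex s.
Let rest_b k (s : {set vertex}) : bool := cycle_face k (ua @^-1: s)%SET && no_apex s.

Let ua_inj : injective ua. Proof. by move=> ? ? []. Qed.
Let ub_inj : injective ub. Proof. by move=> ? ? []. Qed.

Let no_apex_ext (s t : {set vertex}) : (forall k, (inr k \in s) = (inr k \in t)) -> no_apex s = no_apex t.
Proof. by move=> h; apply: eq_forallb => k; rewrite h. Qed.

Let rest_a_ext l (s t : {set vertex}) :
  (forall v, v \notin codom ua -> (v \in s) = (v \in t)) -> rest_a l s = rest_a l t.
Proof.
move=> h; congr (cycle_face _ _ && _).
  apply/setP => y; rewrite !finset.inE; apply: h.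
  by apply/codomP => -[x].
by apply: no_apex_ext => k; apply: h; apply/codomP => -[x].
Qed.

Let rest_b_ext k (s t : {set vertex}) :
  (forall v, v \notin codom ub -> (v \in s) = (v \in t)) -> rest_b k s = rest_b k t.
Proof.
move=> h; congr (cycle_face _ _ && _).
  apply/setP => y; rewrite !finset.inE; apply: h.
  by apply/codomP => -[x].
by apply: no_apex_ext => k'; apply: h; apply/codomP => -[x].
Qed.

Let join_sym k l : cycle_complex ua (rest_a l) k = cycle_complex ub (rest_b k) l.
Proof. by apply/setP => s; rewrite !finset.inE /rest_a /rest_b andbCA. Qed.

Let coned_none : coned corners (owner 0 0) = cycle_complex ua (rest_a Q) P.
Proof.
have none s : owner 0 0 s = None.
  by rewrite /owner; case: ifP => // /andP[_]; have := ltn_ord s.2; lia.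
apply/setP => s; apply/conedP/idP => [[[[i j] /fintype.subsetP ij] _ h3 _]|].
  rewrite finset.inE; apply/and3P; split.
  - apply/existsP; exists i; rewrite ltn_ord/=; apply/forallP => x; apply/implyP.
    by rewrite finset.inE => xs; have := ij (inl x); rewrite !finset.inE; apply.
  - apply/existsP; exists j; rewrite ltn_ord/=; apply/forallP => x; apply/implyP.
    by rewrite finset.inE => xs; have := ij (inr x); rewrite !finset.inE; apply.
  - by apply/forallP => k; apply/negP => /h3[q _]; rewrite none.
rewrite finset.inE => /and3P[/existsP[i /andP[_ /forallP hi]] /existsP[j /andP[_ /forallP hj]] /forallP na].
have sub : base_part s \subset corners (i, j).
  apply/fintype.subsetP => -[x|y]; rewrite !finset.inE => h /=.
    by have /implyP := hi x; apply; rewrite finset.inE.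
  by have /implyP := hj y; apply; rewrite finset.inE.
split.
- by exists (i, j).
- by move=> k; exists (i, j); rewrite ?none.
- by move=> k ks; have := na k; rewrite ks.
- by move=> k k' ks; have := na k; rewrite ks.
Qed.

(** Going backwards, the cones are traded for the original tetrahedra, and then both cycles are
    shrunk to triangles. *)
Lemma homeomorphic_coned_sphere :
  homeomorphic (realization R (coned corners final_owner)) (sphere3 R).
Proof.
rewrite -owner_final.
apply: homeomorphic_trans (homeomorphic_sym (homeomorphic_columns (leqnn P))) _.
rewrite coned_none.
have P3 : (2 < 3 <= P)%N by lia. have Q3 : (2 < 3 <= Q)%N by lia.
apply: homeomorphic_trans (homeomorphic_sym (homeomorphic_cycle R ua_inj (@rest_a_ext Q) P3 (leqnn P))) _.
rewrite join_sym.
apply: homeomorphic_trans (homeomorphic_sym (homeomorphic_cycle R ub_inj (@rest_b_ext 3) Q3 (leqnn Q))) _.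
have h0 : (0 < P)%N by lia. have h1 : (1 < P)%N by lia. have h2 : (2 < P)%N by lia.
have g0 : (0 < Q)%N by lia. have g1 : (1 < Q)%N by lia. have g2 : (2 < Q)%N by lia.
have -> : cycle_complex ub (rest_b 3) 3 = join_of_triangles (ua (Ordinal h0)) (ua (Ordinal h1))
    (ua (Ordinal h2)) (ub (Ordinal g0)) (ub (Ordinal g1)) (ub (Ordinal g2)).
  have cf n (n0 : (0 < n)%N) (n1 : (1 < n)%N) (n2 : (2 < n)%N) (r : {set 'I_n}) :
      cycle_face 3 r = [forall x in r, (x < 3)%N] &&
        ~~ [&& Ordinal n0 \in r, Ordinal n1 \in r & Ordinal n2 \in r].
    apply/idP/idP => [c|/andP[/forallP lt nr]].
      have /cycle_faceP[i /andP[i3 _] h] : (3 <= n)%N && cycle_face 3 r by rewrite n2.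
      apply/andP; split.
        by apply/forallP => x; apply/implyP => /h/edgeP; lia.
      by apply/negP => /and3P[/h/edgeP/= e0 /h/edgeP/= e1 /h/edgeP/= e2]; lia.
    have n3 : (3 <= n)%N by [].
    have /andP[]// : (3 <= n)%N && cycle_face 3 r.
    move: nr; rewrite !negb_and => /or3P[] hr; apply/cycle_faceP.
    - exists 1%N => // x xr; have := implyP (lt x) xr; have : x <> 0%N :> nat.
        by move=> e; move: hr; rewrite (_ : Ordinal n0 = x) ?xr//; exact: val_inj.
      by move=> ? ?; apply/edgeP; lia.
    - exists 2%N => // x xr; have := implyP (lt x) xr; have : x <> 1%N :> nat.
        by move=> e; move: hr; rewrite (_ : Ordinal n1 = x) ?xr//; exact: val_inj.
      by move=> ? ?; apply/edgeP; lia.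
    - exists 0%N => // x xr; have := implyP (lt x) xr; have : x <> 2%N :> nat.
        by move=> e; move: hr; rewrite (_ : Ordinal n2 = x) ?xr//; exact: val_inj.
      by move=> ? ?; apply/edgeP; lia.
  apply/setP => s; rewrite !finset.inE /rest_b (cf _ g0 g1 g2) (cf _ h0 h1 h2) !finset.inE.
  apply/andP/and3P => [[/andP[/forallP lb nb] /andP[/andP[/forallP la na] /forallP np]]|[/forallP lt na nb]].
    split=> //; apply/forallP => -[[x|y]|k]; apply/implyP => vs; rewrite !inE.
    - have := implyP (la x); rewrite finset.inE => /(_ vs) x3.
      rewrite /ua /ub !(inj_eq (@inl_inj _ _)) -!val_eqE/=.
      by move: x3; case: (x : nat) => [|[|[|]]].
    - have := implyP (lb y); rewrite finset.inE => /(_ vs) y3.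
      rewrite /ua /ub !(inj_eq (@inl_inj _ _), inj_eq (@inr_inj _ _)) -!val_eqE/=.
      by move: y3; case: (y : nat) => [|[|[|]]].
    - by have := np k; rewrite vs.
  have m v : v \in s -> v \in [:: ua (Ordinal h0); ua (Ordinal h1); ua (Ordinal h2);
      ub (Ordinal g0); ub (Ordinal g1); ub (Ordinal g2)] by move=> vs; exact: (implyP (lt v)).
  split.
    rewrite nb andbT; apply/forallP => y; apply/implyP; rewrite finset.inE => /m.
    by rewrite !inE => /or4P[|||/or3P[]]// /eqP[->].
  rewrite na andbT/=; apply/andP; split.
    apply/forallP => y; apply/implyP; rewrite finset.inE => /m.
    by rewrite !inE => /or4P[|||/or3P[]]// /eqP[->].
  by apply/forallP => k; apply/negP => /m.
exact: sphere_join_of_triangles.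
Qed.

End Grid.

(** * Cyclic successors and edges of a cycle *)

Lemma edge_inj n i i' : (2 < n)%N -> (i < n)%N -> (i' < n)%N ->
  edge n i' i -> edge n i' (nxt n i) -> i' = i.
Proof. by move=> n2 ii ii' /edgeP h1 /edgeP; rewrite /nxt; case: ifP; lia. Qed.

Lemma edge_ordS n (i x : 'I_n) : edge n i x = (x == i) || (x == ordS i).
Proof.
rewrite /edge -!val_eqE/=; congr (_ || (_ == _)); rewrite /nxt; case: ltnP => h.
  by rewrite modn_small.
have -> : i.+1 = n by apply/eqP; rewrite eqn_leq h ltn_ord.
by rewrite modnn.
Qed.

Lemma ordS_neq n (i : 'I_n) : (1 < n)%N -> ordS i != i.
Proof.
move=> n1; apply/eqP => /(congr1 val)/=; have := ltn_ord i.
rewrite leq_eqVlt => /predU1P[e|h]; last by rewrite modn_small//; lia.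
by rewrite {1}e modnn; lia.
Qed.

Lemma nxt_ordS n (x : 'I_n) : nxt n x = ordS x.
Proof.
rewrite /nxt /=; case: ltnP => g; first by rewrite modn_small.
by rewrite (_ : x.+1 = n) ?modnn//; apply/eqP; rewrite eqn_leq g ltn_ord.
Qed.

Lemma edge_both n (i i' : 'I_n) : (2 < n)%N -> edge n i' i -> edge n i' (ordS i) -> i' = i.
Proof. by move=> n2 e1 e2; apply/ord_inj/(edge_inj n2 _ _ e1); rewrite ?ltn_ord// nxt_ordS. Qed.

Lemma ordSE n (x : 'I_n) : (x.+1 < n)%N -> ordS x = x.+1 :> nat.
Proof. by move=> h /=; rewrite modn_small. Qed.

Lemma ord_predE n (x : 'I_n) : (0 < x)%N -> (ord_pred x).+1 = x :> nat.
Proof.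
move=> x0 /=; rewrite (_ : (x + n).-1 = x.-1 + n)%N; last by lia.
by rewrite modnDr modn_small ?prednK//; have := ltn_ord x; lia.
Qed.

Lemma ord_pred_val n (x : 'I_n) : ord_pred x = (if (x == 0 :> nat) then n.-1 else x.-1)%N :> nat.
Proof.
case: ifP => [/eqP x0|/eqP x0]; last by have := @ord_predE n x; lia.
by rewrite /= x0 add0n modn_small//; have := ltn_ord x; lia.
Qed.

(** A discrete intermediate value argument. For empty [r] the whole cycle can be traversed;
    otherwise two distinct edges containing [r] are consecutive, and [r] is their common vertex. *)
Lemma cycle_change n (r : {set 'I_n}) (D : pred 'I_n) (i i' : 'I_n) : (2 < n)%N ->
  (forall x : 'I_n, x \in r -> edge n i x) -> (forall x : 'I_n, x \in r -> edge n i' x) -> D i -> ~~ D i' ->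
  exists2 x : 'I_n, D x != D (ordS x) & forall y, y \in r -> y = ordS x.
Proof.
move=> n2 ri ri' Di Di'.
have [r0|[x xr]] := set_0Vmem r.
  have [/existsP[x Dx]|h] := boolP [exists x, D x != D (ordS x)].
    by exists x => // y; rewrite r0 finset.inE.
  have n0 : (0 < n)%N by lia.
  have c m (mn : (m < n)%N) : D (Ordinal mn) = D (Ordinal n0).
    elim: m mn => [|m IH] mn; first by congr D; exact: val_inj.
    have mn' : (m < n)%N by exact: ltnW.
    rewrite -(IH mn'); have /existsPn/(_ (Ordinal mn')) := h.
    rewrite negbK => /eqP->; congr D; apply: val_inj => /=.
    by rewrite modn_small.
  move: Di Di'; rewrite (_ : i = Ordinal (ltn_ord i)); last exact: val_inj.
  by rewrite (_ : i' = Ordinal (ltn_ord i')) ?c; [move=> ->|exact: val_inj].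
have ii' : i != i' by apply: contraNneq Di' => <-.
have nx (z : 'I_n) : ordS z = nxt n z :> nat by rewrite nxt_ordS.
have key (z z' : 'I_n) : z != z' -> x = z -> x = ordS z' -> (forall x : 'I_n, x \in r -> edge n z x) ->
    (forall x : 'I_n, x \in r -> edge n z' x) -> forall y, y \in r -> y = ordS z'.
  move=> zz' xz xz' h h' y yr; apply: ord_inj; rewrite nx.
  have /edgeP e := h _ yr; have /edgeP e' := h' _ yr.
  have : z <> z' :> nat by move=> e2; move: zz'; rewrite (val_inj e2) eqxx.
  have : z = nxt n z' :> nat by rewrite -nx -xz' xz.
  by move: (ltn_ord z) (ltn_ord z') (ltn_ord y) e'; rewrite /nxt; case: ifP; lia.
have := ri _ xr; have := ri' _ xr; rewrite !edge_ordS => /orP[/eqP xi'|/eqP xi'] /orP[/eqP xi|/eqP xi].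
- by move: ii'; rewrite -xi -xi' eqxx.
- exists i; last by apply: (key i' i) => //; rewrite eq_sym.
  by rewrite -xi xi' Di (negPf Di').
- exists i'; last exact: (key i i').
  by rewrite -xi' xi Di (negPf Di').
- have e : nxt n i = nxt n i' by rewrite -!nx -xi -xi'.
  by move: ii' e; rewrite -val_eqE/= /nxt; move: (ltn_ord i) (ltn_ord i'); do 2!case: ifP; lia.
Qed.

(** * The coned grid satisfies the conditions for merging *)

Section GridComplex.
Variables (P Q : nat).
Hypotheses (P4 : (3 < P)%N) (Q4 : (3 < Q)%N).
Local Notation slabs := (slabs P Q).
Local Notation point := ('I_P + 'I_Q)%type.
Local Notation vertex := (point + 'I_slabs)%type.
Local Notation square := ('I_P * 'I_Q)%type.
Local Notation grid_complex := (coned (@corners P Q) (@final_owner P Q)).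
Implicit Types q : square.

Lemma cornersE (s : square) : corners s =
  [set inl s.1; inl (ordS s.1); inr s.2; inr (ordS s.2)]%SET :> {set point}.
Proof.
apply/setP => -[x|y]; rewrite !finset.inE edge_ordS.
  by rewrite !(inj_eq (@inl_inj _ _)) !orbF.
by rewrite !(inj_eq (@inr_inj _ _)).
Qed.

Lemma card_corners (s : square) : #|corners s| = 4%N.
Proof.
have [P1 Q1] : (1 < P)%N /\ (1 < Q)%N by lia.
rewrite cornersE -!finset.setUA !cardsU1 cards1 !finset.inE.
rewrite !(inj_eq (@inl_inj _ _)) !(inj_eq (@inr_inj _ _)).
by rewrite ![_ == ordS _]eq_sym !(negPf (ordS_neq _ _)).
Qed.

Lemma corners_sub_inj (s t : square) : corners s \subset corners t -> t = s.
Proof.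
have [P2 Q2] : (2 < P)%N /\ (2 < Q)%N by lia.
case: s t => [i j] [i' j'] /fintype.subsetP h.
have ed n (x : 'I_n) : edge n x (ordS x) by rewrite edge_ordS eqxx orbT.
congr pair; apply: edge_both => //.
- by have := h (inl i); rewrite !corners_inl; apply; rewrite /edge eqxx.
- by have := h (inl (ordS i)); rewrite !corners_inl; apply; exact: ed.
- by have := h (inr j); rewrite !corners_inr; apply; rewrite /edge eqxx.
- by have := h (inr (ordS j)); rewrite !corners_inr; apply; exact: ed.
Qed.

Lemma mem_outer (s : {set vertex}) q : ~~ inner q -> (forall k, inr k \notin s) ->
  base_part s \subset corners q -> s \in grid_complex.
Proof.
move=> nq na sq; have oq : final_owner q = None by rewrite /final_owner (negPf nq).
apply/conedP; split.
- by exists q.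
- by move=> k; exists q; rewrite ?oq.
- by move=> k ks; have := na k; rewrite ks.
- by move=> k k' ks; have := na k; rewrite ks.
Qed.

(** Criterion for simplices over the boundary of a slab, with or without its apex: [q] witnesses
    that the base belongs to the slab, [q'] that it is not interior. *)
Lemma mem_exposed (s : {set vertex}) q q' k : final_owner q = Some k -> final_owner q' != Some k ->
  (forall k', inr k' \in s -> k' = k) ->
  base_part s \subset corners q -> base_part s \subset corners q' -> s \in grid_complex.
Proof.
move=> oq oq' ks sq sq'; apply/conedP; split.
- by exists q.
- move=> k'; have [->|kk'] := eqVneq k' k; first by exists q'.
  by exists q; rewrite // oq; apply: contra kk' => /eqP[->].
- by move=> k' /ks->; exists q.
- by move=> k1 k2 /ks-> /ks->.
Qed.

Let card_split (s : {set vertex}) : #|s| = (#|base_part s| + #|apex_part s|)%N.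
Proof.
rewrite -!sum1_card big_sumType /=; congr (_ + _)%N.
  by apply: eq_bigl => w; rewrite finset.inE.
by apply: eq_bigl => w; rewrite finset.inE.
Qed.

(** Below an apex the base cannot be a full tetrahedron: that lies in a single square, so it would
    be interior to the slab. *)
Lemma grid_dim (s : {set vertex}) : s \in grid_complex -> (#|s| <= 4)%N.
Proof.
move=> /conedP[[q sq] h2 h3 h4]; rewrite card_split.
have a1 : (#|apex_part s| <= 1)%N.
  by apply/card_le1P => k; rewrite finset.inE => ks k'; rewrite finset.inE; apply/idP/eqP => [/h4|->//]; exact.
have [a0|] := posnP #|apex_part s|.
  by rewrite a0 addn0 -(card_corners q) subset_leq_card.
rewrite card_gt0 => /finset.set0Pn[k]; rewrite finset.inE => ks.
have [q1 sq1 ok1] := h3 _ ks; have [q2 sq2 ok2] := h2 k.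
suff : (#|base_part s| < 4)%N by lia.
rewrite ltn_neqAle -{2}(card_corners q1) subset_leq_card// andbT.
apply: contra ok2 => /eqP b4; have e : base_part s = corners q1.
  by apply/eqP; rewrite eqEcard sq1 card_corners b4.
by rewrite -ok1 -(@corners_sub_inj q1 q2)// -e.
Qed.

(** The square [(i', j)] contains [r] as well. Ownership changes between [(i, j)] and this square or
    between it and [(i', j')], and [cycle_change] then finds two adjacent squares around [r] with
    different ownership. *)
Let exposed_ridge (r : {set point}) q q' k : r \subset corners q -> r \subset corners q' ->
  final_owner q = Some k -> final_owner q' != Some k ->
  exists q1 q2 (t : {set point}), [/\ final_owner q1 = Some k, final_owner q2 != Some k, r \subset t,
    #|t| = 3%N & t \subset corners q1 /\ t \subset corners q2].
Proof.
have [P2 Q2] : (2 < P)%N /\ (2 < Q)%N by lia.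
case: q q' => [i j] [i' j'] /fintype.subsetP rq /fintype.subsetP rq' oq oq'.
pose D (s : square) := final_owner s == Some k.
have fin (q1 q2 : square) (t : {set point}) : D q1 != D q2 -> r \subset t -> #|t| = 3%N ->
    t \subset corners q1 -> t \subset corners q2 -> exists q1 q2 (t : {set point}),
    [/\ final_owner q1 = Some k, final_owner q2 != Some k, r \subset t,
    #|t| = 3%N & t \subset corners q1 /\ t \subset corners q2].
  rewrite /D; have [/eqP o1|o1] := boolP (final_owner q1 == Some k).
    by move=> o2 *; exists q1, q2, t; split=> //; move: o2; case: (final_owner q2 == Some k).
  move=> o2 *; exists q2, q1, t; split=> //.
  by apply/eqP; move: o2; case: (final_owner q2 == Some k).
have ra (x : 'I_P) : x \in [set x | inl x \in r]%SET -> edge P i x.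
  by rewrite finset.inE => /rq; rewrite corners_inl.
have ra' (x : 'I_P) : x \in [set x | inl x \in r]%SET -> edge P i' x.
  by rewrite finset.inE => /rq'; rewrite corners_inl.
have rb (y : 'I_Q) : y \in [set y | inr y \in r]%SET -> edge Q j y.
  by rewrite finset.inE => /rq; rewrite corners_inr.
have rb' (y : 'I_Q) : y \in [set y | inr y \in r]%SET -> edge Q j' y.
  by rewrite finset.inE => /rq'; rewrite corners_inr.
have [Dm|Dm] := boolP (D (i', j)); last first.
  have [x Dx hx] := cycle_change (D := fun x => D (x, j)) P2 ra ra' (introT eqP oq) Dm.
  pose t : {set point} := [set inl (ordS x); inr j; inr (ordS j)]%SET.
  apply: (fin (x, j) (ordS x, j) t) => //.
  - apply/fintype.subsetP => -[z|y] zr; rewrite !finset.inE.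
      by rewrite (hx z) ?eqxx// finset.inE.
    by have := rb y; rewrite finset.inE edge_ordS !(inj_eq (@inr_inj _ _)) => ->.
  - rewrite /t -finset.setUA !cardsU1 cards1 !finset.inE/= (inj_eq (@inr_inj _ _)).
    by rewrite eq_sym (negPf (ordS_neq _ _))//; lia.
  - by apply/fintype.subsetP => v; rewrite cornersE !finset.inE => /orP[/orP[]|] ->; rewrite ?orbT.
  - by apply/fintype.subsetP => v; rewrite cornersE !finset.inE => /orP[/orP[]|] ->; rewrite ?orbT.
have [y Dy hy] := cycle_change (D := fun y => D (i', y)) Q2 rb rb' Dm oq'.
pose t : {set point} := [set inl i'; inl (ordS i'); inr (ordS y)]%SET.
apply: (fin (i', y) (i', ordS y) t) => //.
- apply/fintype.subsetP => -[z|z] zr; rewrite !finset.inE.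
    by have := ra' z; rewrite finset.inE edge_ordS !(inj_eq (@inl_inj _ _)) orbF => ->.
  by rewrite (hy z) ?eqxx// finset.inE.
- rewrite /t -finset.setUA !cardsU1 cards1 !finset.inE/= (inj_eq (@inl_inj _ _)) orbF.
  by rewrite eq_sym (negPf (ordS_neq _ _))//; lia.
- by apply/fintype.subsetP => v; rewrite cornersE !finset.inE => /orP[/orP[]|] ->; rewrite ?orbT.
- by apply/fintype.subsetP => v; rewrite cornersE !finset.inE => /orP[/orP[]|] ->; rewrite ?orbT.
Qed.

Let base_inl (t : {set point}) (k : 'I_slabs) : base_part (inr k |: [set inl w | w in t])%SET = t.
Proof.
by apply/setP => w; rewrite finset.inE finset.in_setU1/= mem_imset//; move=> ? ? [].
Qed.

Let base_inl0 (t : {set point}) : base_part ([set inl w | w in t] : {set vertex})%SET = t.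
Proof. by apply/setP => w; rewrite finset.inE mem_imset//; move=> ? ? []. Qed.

(** On a slab, the base extends to a boundary triangle by [exposed_ridge], and the apex completes it
    to a tetrahedron; otherwise the simplex lies in a square outside the slabs. *)
Lemma grid_pure (s : {set vertex}) : s \in grid_complex ->
  exists2 t : {set vertex}, t \in grid_complex & s \subset t /\ #|t| = 4%N.
Proof.
move=> /conedP[h1 h2 h3 h4].
have apexed q k : base_part s \subset corners q -> final_owner q = Some k ->
    (forall k', inr k' \in s -> k' = k) ->
    exists2 t : {set vertex}, t \in grid_complex & s \subset t /\ #|t| = 4%N.
  move=> sq oq sk; have [q' sq' oq'] := h2 k.
  have [q1 [q2 [t [own1 own2 rt t3 [t1 t2]]]]] := exposed_ridge sq sq' oq oq'.
  exists (inr k |: [set inl w | w in t])%SET.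
    apply: (mem_exposed own1 own2); rewrite ?base_inl// => k'.
    by rewrite finset.in_setU1 => /predU1P[[->]|/imsetP[]].
  split.
    apply/fintype.subsetP => -[w|k'] vs; rewrite finset.in_setU1/=.
      by rewrite mem_imset; [apply: (fintype.subsetP rt); rewrite finset.inE|move=> ? ? []].
    by rewrite (sk k')// eqxx.
  rewrite cardsU1 card_imset; last by move=> ? ? [].
  by rewrite t3 (_ : inr k \notin _)//; apply/imsetP => -[].
have [/existsP[k ks]|/existsPn na] := boolP [exists k, inr k \in s].
  have [q sq oq] := h3 _ ks; apply: (apexed q k) => // k' k's.
  exact: h4.
have [q sq] := h1.
have [inq|outq] := boolP (inner q).
  apply: (apexed q (slab q)) => //; first by rewrite /final_owner inq.
  by move=> k ks; have := na k; rewrite ks.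
exists [set inl w | w in corners q]%SET.
  by apply: (mem_outer outq); rewrite ?base_inl0// => k; apply/imsetP => -[].
split; last by rewrite card_imset ?card_corners//; move=> ? ? [].
apply/fintype.subsetP => -[w|k] vs; last by have := na k; rewrite vs.
by rewrite mem_imset; [apply: (fintype.subsetP sq); rewrite finset.inE|move=> ? ? []].
Qed.

Lemma slabP (s t : square) : inner s -> inner t ->
  slab s = slab t <-> ((s.1 + s.2) %/ 4 = (t.1 + t.2) %/ 4)%N.
Proof.
move=> si ti; split=> [e|e]; first by rewrite -!slab_val// e.
by apply: ord_inj; rewrite !slab_val.
Qed.

Lemma final_ownerP (s : square) k : final_owner s = Some k <-> inner s /\ slab s = k.
Proof. by rewrite /final_owner; case: ifP => si; split=> [[]|[]]// ? ->. Qed.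

Lemma final_owner_neq (s : square) k : final_owner s != Some k <-> (inner s -> slab s <> k).
Proof.
split=> [/eqP n si sk|n]; first by apply: n; apply/final_ownerP.
by apply/eqP => /final_ownerP[si]; exact: n.
Qed.

(* The squares of a slab next to its lower or upper boundary staircase whose
   opposite corner is not on the boundary of the grid. *)
Definition lower (s : square) : bool := ((s.1 + s.2) %% 4 == 0)%N.
Definition capped (s : square) : bool :=
  if lower s then (s.1.+2 < P)%N && (s.2.+2 < Q)%N
  else [&& ((s.1 + s.2) %% 4 == 3)%N, inner s, (0 < s.1)%N & (0 < s.2)%N].

Definition bip_index : finType :=
  ({s : square | capped s} + {j : 'I_Q | odd j && (j.+1 < Q)%N})%type.

(** The near corner stands for the edge a_x b_y on the boundary staircase, the far corner for the
    opposite edge, which becomes the axis. *)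
Definition near1 (s : square) : 'I_P := if lower s then s.1 else ordS s.1.
Definition near2 (s : square) : 'I_Q := if lower s then s.2 else ordS s.2.
Definition far1 (s : square) : 'I_P := if lower s then ordS s.1 else s.1.
Definition far2 (s : square) : 'I_Q := if lower s then ordS s.2 else s.2.

Lemma first_lt : (0 < P)%N. Proof. by lia. Qed.
Lemma last_lt : (P.-1 < P)%N. Proof. by lia. Qed.

Local Notation va x := (inl (inl x) : vertex).
Local Notation vb y := (inl (inr y) : vertex).

(* A capped square yields the cone, from the apex of its slab, over its two faces at
   the near corner. The squares [(P.-1, j.-1)] and [(P.-1, j)], [j] odd, outside the slabs
   are merged as well. *)
Definition bip0 (b : bip_index) : vertex :=
  match b with inl s => va (far1 (val s)) | inr j => vb (ord_pred (val j)) end.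
Definition bip1 (b : bip_index) : vertex :=
  match b with inl s => vb (far2 (val s)) | inr j => vb (ordS (val j)) end.
Definition bip2 (b : bip_index) : vertex :=
  match b with inl s => inr (slab (val s)) | inr _ => va (Ordinal last_lt) end.
Definition bip3 (b : bip_index) : vertex :=
  match b with inl s => va (near1 (val s)) | inr _ => va (Ordinal first_lt) end.
Definition bip4 (b : bip_index) : vertex :=
  match b with inl s => vb (near2 (val s)) | inr j => vb (val j) end.

Lemma capped_inner s : capped s -> inner s.
Proof.
rewrite /capped; case: ifP => _; last by case/and4P.
by rewrite /inner; move: (nat_of_ord s.1) (nat_of_ord s.2) => a b; lia.
Qed.

Let bipE (b : bip_index) : (exists s, [/\ capped s, bip0 b = va (far1 s), bip1 b = vb (far2 s),
    bip2 b = inr (slab s) & bip3 b = va (near1 s) /\ bip4 b = vb (near2 s)]) \/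
  (exists j j0 j1 : 'I_Q, [/\ odd j, (j.+1 < Q)%N, j = j0.+1 :> nat, j1 = j.+1 :> nat &
   [/\ bip0 b = vb j0, bip1 b = vb j1, bip2 b = va (Ordinal last_lt),
    bip3 b = va (Ordinal first_lt) & bip4 b = vb j]]).
Proof.
case: b => [s|j]; first by left; exists (val s); split=> //; exact: valP s.
right; have /andP[jo jQ] := valP j.
exists (val j), (ord_pred (val j)), (ordS (val j)); split=> //; last by rewrite ordSE.
by rewrite ord_predE// odd_gt0.
Qed.

Let nearE (s : square) : inner s -> [/\ near1 s = (if lower s then s.1 : nat else s.1.+1) :> nat,
  near2 s = (if lower s then s.2 : nat else s.2.+1) :> nat,
  far1 s = (if lower s then s.1.+1 else s.1 : nat) :> nat &
  far2 s = (if lower s then s.2.+1 else s.2 : nat) :> nat].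
Proof.
move=> /andP[h1 h2]; rewrite /near1 /near2 /far1 /far2.
by case: ifP => _; rewrite ?ordSE.
Qed.

Let cappedP (s : square) : capped s -> [/\ (s.1.+1 < P)%N, (s.2.+1 < Q)%N &
  (lower s /\ ((s.1 + s.2) %% 4 = 0)%N /\ (s.1.+2 < P)%N /\ (s.2.+2 < Q)%N) \/
  (~~ lower s /\ ((s.1 + s.2) %% 4 = 3)%N /\ (0 < s.1)%N /\ (0 < s.2)%N)].
Proof.
move=> /[dup]/capped_inner/andP[h1 h2]; rewrite /capped; case: ifP => [l /andP[]|l /and4P[/eqP m _ a b]].
  by split=> //; left; split=> //; split=> //; exact/eqP.
by split=> //; right; split.
Qed.

Local Notation bTri := (Tri bip2 bip3 bip4).
Local Notation bAxis := (Axis bip0 bip1).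
Local Notation bBip := (Bip bip0 bip1 bip2 bip3 bip4).

Let mem_bip (b : bip_index) (v : vertex) : v \in bBip b -> [\/ v = bip0 b, v = bip1 b, v = bip2 b | v = bip3 b \/ v = bip4 b].
Proof.
rewrite !finset.inE => /orP[/orP[/orP[/orP[]|]|]|] /eqP->.
- by constructor 1.
- by constructor 2.
- by constructor 3.
- by constructor 4; left.
- by constructor 4; right.
Qed.

Let on_bip (b : bip_index) (v : vertex) : v \in bBip b ->
  match b, v with
  | inl s, inl (inl x) => (x = (val s).1 :> nat) \/ (x = (val s).1.+1 :> nat)
  | inl s, inl (inr y) => (y = (val s).2 :> nat) \/ (y = (val s).2.+1 :> nat)
  | inl s, inr k => k = slab (val s)
  | inr j, inl (inl x) => (x = 0%N :> nat) \/ (x = P.-1 :> nat)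
  | inr j, inl (inr y) => (y.+1 = val j :> nat) \/ (y = val j :> nat) \/ (y = (val j).+1 :> nat)
  | inr j, inr k => False
  end.
Proof.
case: b => [s|j] /mem_bip.
  have cs : capped (val s) := valP s.
  have [n1 n2 f1 f2] := nearE (capped_inner cs).
  by case=> [->|->|->|[->|->]] //=; rewrite ?n1 ?n2 ?f1 ?f2; case: ifP; auto.
have /andP[jo jQ] := valP j.
case=> [->|->|->|[->|->]] /=; [left|right; right|by right|by left|by right; left].
  by rewrite -[RHS]ord_predE// odd_gt0.
by rewrite modn_small.
Qed.

Let sub_Tri b b' : bTri b' \subset bBip b -> [/\ bip2 b' \in bBip b, bip3 b' \in bBip b & bip4 b' \in bBip b].
Proof. by rewrite !finset.subUset !finset.sub1set => /andP[/andP[]]. Qed.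

Let sub_Axis b b' : bAxis b' \subset bBip b -> bip0 b' \in bBip b /\ bip1 b' \in bBip b.
Proof. by rewrite !finset.subUset !finset.sub1set => /andP[]. Qed.

(** Near corners have the extreme index sums [4k] and [4k + 5] of slab [k], so each lies in only one
    square of that slab. For the mergers outside the slabs, the parity of [j] separates the
    triangles. *)
Lemma grid_tri (b b' : bip_index) : bTri b' \subset bBip b -> b' = b.
Proof.
move=> /sub_Tri[]; case: b' => [[s' cs']|[j' oj']]; last first.
  have /andP[jo' jQ'] := oj'.
  case: b => [[s cs]|[j oj]] /on_bip/= h1 /on_bip/= h2 /on_bip/= h3.
    by have [? ? _] := cappedP cs; lia.
  have /andP[jo jQ] := oj; congr inr; apply: val_inj; apply: ord_inj => /=.
  have : (j' %% 2 = 1)%N /\ (j %% 2 = 1)%N by rewrite !modn2 jo jo'.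
  by lia.
have [p1 p2 hs'] := cappedP cs'; have [n1 n2 f1 f2] := nearE (capped_inner cs').
case: b => [[s cs]|[j oj]] /on_bip //= e /on_bip /= h2 /on_bip /= h3.
have [q1 q2 hs] := cappedP cs.
move/slabP: e => /(_ (capped_inner cs') (capped_inner cs)) e.
move: h2 h3; rewrite n1 n2 => h2 h3.
congr inl; apply: val_inj => /=; case: s' s hs' hs e h2 h3 {cs cs' p1 p2 n1 n2 f1 f2 q1 q2} => [i' j'] [i j] /=.
rewrite /lower/=; move=> hs' hs e h2 h3.
have [ei ej] : i' = i :> nat /\ j' = j :> nat.
  by move: h2 h3; case: ifP => /eqP; lia.
by congr pair; exact: ord_inj.
Qed.

(** Modulo 4, the corners of a lower square have index sums 0, 1, 2 and those of an upper square 3,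
    0, 1. The axes have sums 2 and 3, each of which occurs in squares of one kind only, at their far
    corners. *)
Lemma grid_axes (b b' : bip_index) : bAxis b' \subset bBip b -> b' = b.
Proof.
move=> /sub_Axis[]; case: b' => [[s' cs']|[j' oj']]; last first.
  have /andP[jo' jQ'] := oj'.
  have jp : (ord_pred j').+1 = j' :> nat by rewrite ord_predE// odd_gt0.
  have js : ordS j' = j'.+1 :> nat by rewrite ordSE.
  case: b => [[s cs]|[j oj]] /on_bip h1 /on_bip h2; move: h1 h2; rewrite /bip0 /bip1 js [val _]/=.
    by rewrite [val _]/=; lia.
  have /andP[jo jQ] := oj => h1 h2; congr inr; apply: val_inj; apply: ord_inj => /=.
  have : (j' %% 2 = 1)%N /\ (j %% 2 = 1)%N by rewrite !modn2 jo jo'.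
  by move: h1 h2; rewrite [val _]/=; lia.
have [p1 p2 hs'] := cappedP cs'; have [n1 n2 f1 f2] := nearE (capped_inner cs').
case: b => [[s cs]|[j oj]] /on_bip /= h2 /on_bip /= h3; last first.
  by exfalso; move: h2; rewrite f1; case: hs' => -[l]; rewrite ?l ?(negPf l); lia.
have [q1 q2 hs] := cappedP cs.
move: h2 h3; rewrite f1 f2 => h2 h3.
congr inl; apply: val_inj => /=; case: s' s hs' hs h2 h3 {cs cs' p1 p2 n1 n2 f1 f2 q1 q2} => [i' j'] [i j] /=.
rewrite /lower/=; move=> hs' hs h2 h3.
have [ei ej] : i' = i :> nat /\ j' = j :> nat.
  by move: h2 h3; case: ifP => /eqP; lia.
by congr pair; exact: ord_inj.
Qed.

Lemma grid_uniq (b : bip_index) : uniq [:: bip0 b; bip1 b; bip2 b; bip3 b; bip4 b].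
Proof.
have [[s [cs -> -> -> [-> ->]]]|[j [j0 [j1 [jo jQ e0 e1 [-> -> -> -> ->]]]]]] := bipE b.
  have [n1 n2 f1 f2] := nearE (capped_inner cs).
  rewrite /= !inE !negb_or /= !(inj_eq (@inl_inj _ _), inj_eq (@inr_inj _ _)) -!val_eqE /=.
  by rewrite n1 n2 f1 f2; case: ifP => _; lia.
by rewrite /= !inE !negb_or /= !(inj_eq (@inl_inj _ _), inj_eq (@inr_inj _ _)) -!val_eqE /=; lia.
Qed.

Let mem_side (b : bip_index) p (v : vertex) : v \in (p |: bTri b)%SET ->
  v = p \/ v = bip2 b \/ v = bip3 b \/ v = bip4 b.
Proof.
by case/finset.setU1P=> [|/finset.setUP[/finset.set2P[]|/finset.set1P]] ->; auto.
Qed.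

Lemma grid_side (b : bip_index) :
  (bip0 b |: bTri b)%SET \in grid_complex /\ (bip1 b |: bTri b)%SET \in grid_complex.
Proof.
have [[s [cs e0 e1 e2 [e3 e4]]]|[j [j0 [j1 [jo jQ ej0 ej1 [e0 e1 e2 e3 e4]]]]]] := bipE b.
  have si := capped_inner cs; have [n1 n2 f1 f2] := nearE si.
  have [p1 p2 hs] := cappedP cs.
  have o : final_owner s = Some (slab s) by apply/final_ownerP.
  split.
    (* The neighbour across the staircase that shares the face without the far vertex of the second
       cycle. *)
    pose s' : square := (s.1, if lower s then ord_pred s.2 else ordS s.2).
    have s2 : (if lower s then ord_pred s.2 else ordS s.2) =
        (if lower s then (if s.2 == 0 :> nat then Q.-1 else s.2.-1)%N else s.2.+1) :> nat.
      by case: ifP => _; rewrite ?ord_pred_val ?ordSE.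
    apply: (@mem_exposed _ s s' (slab s)) => //.
    - apply/final_owner_neq => s'i /(slabP s'i si)/=; rewrite s2.
      by move: s'i hs; rewrite /inner/= s2 /lower; do 2?case: ifP; lia.
    - by move=> k /mem_side; rewrite e0 e2 e3 e4 => -[|[[]|[]]].
    - apply/fintype.subsetP => -[x|y]; rewrite finset.inE => /mem_side; rewrite e0 e2 e3 e4.
        move=> [[->]|[|[[->]|]]]//; rewrite corners_inl; apply/edgeP; rewrite ?n1 ?f1; case: ifP; lia.
      move=> [|[|[|[->]]]]//; rewrite corners_inr; apply/edgeP; rewrite n2; case: ifP; lia.
    - apply/fintype.subsetP => -[x|y]; rewrite finset.inE => /mem_side; rewrite e0 e2 e3 e4.
        move=> [[->]|[|[[->]|]]]//; rewrite corners_inl; apply/edgeP; rewrite ?n1 ?f1 /=; case: ifP; lia.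
      move=> [|[|[|[->]]]]//; rewrite corners_inr -[s'.2]/(if lower s then ord_pred s.2 else ordS s.2) s2; apply/edgeP; rewrite n2.
      by have := ltn_ord s.2; do 2?case: ifP; lia.
  pose s' : square := (if lower s then ord_pred s.1 else ordS s.1, s.2).
  have s1 : (if lower s then ord_pred s.1 else ordS s.1) =
      (if lower s then (if s.1 == 0 :> nat then P.-1 else s.1.-1)%N else s.1.+1) :> nat.
    by case: ifP => _; rewrite ?ord_pred_val ?ordSE.
  apply: (@mem_exposed _ s s' (slab s)) => //.
  - apply/final_owner_neq => s'i /(slabP s'i si)/=; rewrite s1.
    by move: s'i hs; rewrite /inner/= s1 /lower; do 2?case: ifP; lia.
  - by move=> k /mem_side; rewrite e1 e2 e3 e4 => -[|[[]|[]]].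
  - apply/fintype.subsetP => -[x|y]; rewrite finset.inE => /mem_side; rewrite e1 e2 e3 e4.
      move=> [|[|[[->]|]]]//; rewrite corners_inl; apply/edgeP; rewrite ?n1; case: ifP; lia.
    move=> [[->]|[|[|[->]]]]//; rewrite corners_inr; apply/edgeP; rewrite ?n2 ?f2; case: ifP; lia.
  - apply/fintype.subsetP => -[x|y]; rewrite finset.inE => /mem_side; rewrite e1 e2 e3 e4.
      move=> [|[|[[->]|]]]//; rewrite corners_inl -[s'.1]/(if lower s then ord_pred s.1 else ordS s.1) s1; apply/edgeP; rewrite n1.
      by have := ltn_ord s.1; do 2?case: ifP; lia.
    move=> [[->]|[|[|[->]]]]//; rewrite corners_inr; apply/edgeP; rewrite ?n2 ?f2 /=; case: ifP; lia.
have out (y : 'I_Q) : ~~ inner (Ordinal last_lt, y) by rewrite /inner/=; lia.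
split.
  apply: (mem_outer (out j0)); first by move=> k; apply/negP => /mem_side; rewrite e0 e2 e3 e4 => -[|[|[]]].
  apply/fintype.subsetP => -[x|y]; rewrite finset.inE => /mem_side; rewrite e0 e2 e3 e4.
    move=> [|[[->]|[[->]|]]]//; rewrite corners_inl; apply/edgeP => /=; lia.
  by move=> [[->]|[|[|[->]]]]//; rewrite corners_inr; apply/edgeP => /=; lia.
apply: (mem_outer (out j)); first by move=> k; apply/negP => /mem_side; rewrite e1 e2 e3 e4 => -[|[|[]]].
apply/fintype.subsetP => -[x|y]; rewrite finset.inE => /mem_side; rewrite e1 e2 e3 e4.
  move=> [|[[->]|[[->]|]]]//; rewrite corners_inl; apply/edgeP => /=; lia.
by move=> [[->]|[|[|[->]]]]//; rewrite corners_inr; apply/edgeP => /=; lia.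
Qed.

Let star_mem (s : {set vertex}) q w : base_part s \subset corners q -> inl w \in s -> w \in corners q.
Proof. by move=> /fintype.subsetP h ws; apply: h; rewrite finset.inE. Qed.

(** Within its slab, [t] is the only square at its near corner, so the base lies in [t]. It also
    lies in a square that the slab does not own; this one differs from [t] in some coordinate, and
    the far vertex of that coordinate must then be absent. *)
Lemma grid_link (b : bip_index) (s : {set vertex}) : s \in grid_complex -> bTri b \subset s ->
  s \subset (bip0 b |: bTri b)%SET \/ s \subset (bip1 b |: bTri b)%SET.
Proof.
have [P2 Q2] : (2 < P)%N /\ (2 < Q)%N by lia.
move=> /conedP[h1 h2 h3 h4]; rewrite !finset.subUset !finset.sub1set => /andP[/andP[]].
have inT p v : v = p \/ v = bip2 b \/ v = bip3 b \/ v = bip4 b -> v \in (p |: bTri b)%SET.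
  by rewrite !finset.inE => -[|[|[|]]] ->; rewrite eqxx ?orbT.
have [[t [ct e0 e1 e2 [e3 e4]]]|[j [j0 [j1 [jo jQ ej0 ej1 [e0 e1 e2 e3 e4]]]]]] := bipE b.
  rewrite e2 e3 e4 => ks xs ys; have ti := capped_inner ct.
  have [n1 n2 f1 f2] := nearE ti; have [p1 p2 ht] := cappedP ct.
  have [q sq /final_ownerP[qi qt]] := h3 _ ks; move/slabP: qt => /(_ qi ti) qt.
  have qE : q = t.
    have := star_mem sq xs; have := star_mem sq ys.
    rewrite corners_inl corners_inr => /edgeP; rewrite n2 => hy /edgeP; rewrite n1 => hx.
    case: q t qi ti qt hx hy ht {sq ks xs ys ct e0 e1 e2 e3 e4 n1 n2 f1 f2 p1 p2} => [i j] [i' j'].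
    rewrite /inner /lower /= => /andP[a1 a2] /andP[b1 b2] qt hx hy ht.
    have [ei ej] : i = i' :> nat /\ j = j' :> nat by move: hx hy; case: ifP => /eqP; lia.
    by congr pair; exact: ord_inj.
  have [q' sq' oq'] := h2 (slab t).
  have qt' : q' != t.
    apply/eqP => e; move: oq'; rewrite e; apply/negP; rewrite negbK.
    by apply/eqP/final_ownerP.
  have inx (x : 'I_P) : inl (inl x) \in s -> x = near1 t \/ x = far1 t.
    move=> /(star_mem sq); rewrite qE corners_inl edge_ordS /near1 /far1.
    by case: ifP => _ /orP[]/eqP; auto.
  have iny (y : 'I_Q) : inl (inr y) \in s -> y = near2 t \/ y = far2 t.
    move=> /(star_mem sq); rewrite qE corners_inr edge_ordS /near2 /far2.
    by case: ifP => _ /orP[]/eqP; auto.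
  have [q1|q1] := eqVneq q'.1 t.1; last first.
    right; apply/fintype.subsetP => -[[x|y]|k] vs; apply: inT; rewrite e1 e2 e3 e4.
    - right; right; left; have [->//|xf] := inx _ vs.
      have := star_mem sq' vs; have := star_mem sq' xs; rewrite !corners_inl xf => a1 a2.
      case/eqP: q1; move: a1 a2; rewrite /near1 /far1; case: ifP => _ a1 a2.
        exact: (edge_both P2).
      exact: (edge_both P2).
    - by have [->|->] := iny _ vs; [right; right; right|left].
    - by right; left; rewrite (h4 _ _ vs ks).
  have q2 : q'.2 != t.2.
    by apply: contra qt' => /eqP q2; rewrite [q']surjective_pairing [t]surjective_pairing q1 q2.
  left; apply/fintype.subsetP => -[[x|y]|k] vs; apply: inT; rewrite e0 e2 e3 e4.
  - by have [->|->] := inx _ vs; [right; right; left|left].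
  - right; right; right; have [->//|xf] := iny _ vs.
    have := star_mem sq' vs; have := star_mem sq' ys; rewrite !corners_inr xf => a1 a2.
    case/eqP: q2; move: a1 a2; rewrite /near2 /far2; case: ifP => _ a1 a2.
      exact: (edge_both Q2).
    exact: (edge_both Q2).
  - by right; left; rewrite (h4 _ _ vs ks).
rewrite e2 e3 e4 => ls fs js.
have last_only q : base_part s \subset corners q -> q.1 = P.-1 :> nat.
  move=> sq; have := star_mem sq ls; have := star_mem sq fs.
  by rewrite !corners_inl => /edgeP/= a1 /edgeP/= a2; lia.
have na k : inr k \notin s.
  apply/negP => /h3[q sq /final_ownerP[/andP[qi _] _]].
  by have := last_only _ sq; lia.
have [[qa qb] sq] := h1; have /= q1 := last_only _ sq.
have := star_mem sq js; rewrite corners_inr => /edgeP/= qj.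
have inx (x : 'I_P) : inl (inl x) \in s -> x = Ordinal last_lt \/ x = Ordinal first_lt.
  move=> /(star_mem sq); rewrite corners_inl => /edgeP/=; rewrite q1 => a.
  have [a1|a1] : x = P.-1 :> nat \/ x = 0%N :> nat by lia.
    by left; apply: ord_inj.
  by right; apply: ord_inj.
have [q2|q2] : qb = j :> nat \/ qb = j0 :> nat by lia.
  right; apply/fintype.subsetP => -[[x|y]|k] vs; apply: inT; rewrite e1 e2 e3 e4.
  - by have [->|->] := inx _ vs; [right; left|right; right; left].
  - have := star_mem sq vs; rewrite corners_inr => /edgeP/=; rewrite q2 => a.
    have [a1|a1] : y = j :> nat \/ y = j1 :> nat by lia.
      by right; right; right; rewrite (ord_inj a1).
    by left; rewrite (ord_inj a1).
  - by have := na k; rewrite vs.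
left; apply/fintype.subsetP => -[[x|y]|k] vs; apply: inT; rewrite e0 e2 e3 e4.
- by have [->|->] := inx _ vs; [right; left|right; right; left].
- have := star_mem sq vs; rewrite corners_inr => /edgeP/=; rewrite q2 => a.
  have [a1|a1] : y = j :> nat \/ y = j0 :> nat by lia.
    by right; right; right; rewrite (ord_inj a1).
  by left; rewrite (ord_inj a1).
- by have := na k; rewrite vs.
Qed.

(** All squares around a far corner lie in the slab, so this edge is interior and coning removes it;
    the bounds in [capped] keep far corners off the border of the grid. In the column outside the
    slabs, the axis joins vertices two apart on a cycle of length at least 4. *)
Lemma grid_axis (b : bip_index) : bAxis b \notin grid_complex.
Proof.
apply/negP => /conedP[[q0 sq0] h2 _ _].
have m0 : bip0 b \in bAxis b by rewrite !finset.inE eqxx.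
have m1 : bip1 b \in bAxis b by rewrite !finset.inE eqxx orbT.
have [[t [ct e0 e1 _ _]]|[j [j0 [j1 [jo jQ ej0 ej1 [e0 e1 _ _ _]]]]]] := bipE b; rewrite e0 e1 in m0 m1.
  have ti := capped_inner ct; have [n1 n2 f1 f2] := nearE ti; have [p1 p2 ht] := cappedP ct.
  have [q sq /final_owner_neq oq] := h2 (slab t).
  have := star_mem sq m0; have := star_mem sq m1.
  rewrite corners_inl corners_inr => /edgeP; rewrite f2 => hy /edgeP; rewrite f1 => hx.
  case: ht => -[l [m [a1 a2]]]; rewrite ?l ?(negPf l) in hx hy.
    have qi : inner q by rewrite /inner; lia.
    by apply: oq => //; apply/(slabP qi ti); lia.
  have qi : inner q by rewrite /inner; lia.
  by apply: oq => //; apply/(slabP qi ti); lia.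
have := star_mem sq0 m0; have := star_mem sq0 m1.
by rewrite !corners_inr => /edgeP/= a1 /edgeP/= a2; lia.
Qed.

Lemma grid_mergeable : mergeable grid_complex bip0 bip1 bip2 bip3 bip4.
Proof.
split.
- exists (va (Ordinal last_lt)).
  have h0 : (0 < Q)%N by lia.
  apply: (@mem_outer _ (Ordinal last_lt, Ordinal h0)).
  - by rewrite /inner/=; lia.
  - by move=> k; rewrite finset.inE.
  - apply/fintype.subsetP => w; rewrite !finset.inE => /eqP[->].
    by apply/edgeP; left.
- by move=> s t; exact: coned_down.
- exact: grid_dim.
- exact: grid_pure.
- exact: grid_uniq.
- exact: grid_side.
- exact: grid_link.
- exact: grid_axis.
- exact: grid_tri.
- exact: grid_axes.
Qed.

End GridComplex.

(** * Counting *)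

Definition residue (c i j : nat) : bool := ((i + j) %% 4 == c)%N.

Definition row_count (c x M : nat) : nat := (\sum_(j < M) residue c x j)%N.
Definition box_count (c N M : nat) : nat := (\sum_(i < N) row_count c i M)%N.

(** Four consecutive squares of a row contain one of each residue, and at most three squares are
    left over. *)
Lemma row_count_bounds c x M : (c < 4)%N ->
  (4 * row_count c x M <= M + 3)%N /\ (M <= 4 * row_count c x M + 3)%N.
Proof.
move=> c4; have [a [b [-> b4]]] : exists a b, M = (a * 4 + b)%N /\ (b < 4)%N.
  by exists (M %/ 4)%N, (M %% 4)%N; rewrite -divn_eq ltn_mod.
elim: a => [|a IH].
  by rewrite /row_count mul0n add0n; move: b b4 => [|[|[|[|//]]]] _;
    rewrite ?big_ord_recr ?big_ord0 /= /residue; do ?case: eqP => /=; lia.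
have := IH.
have -> : (a.+1 * 4 + b = (a * 4 + b) + 4)%N by lia.
have -> : row_count c x (a * 4 + b + 4) = (row_count c x (a * 4 + b)).+1.
  rewrite /row_count !addnS addn0 !big_ord_recr /= -!addnA -[RHS]addn1; congr (_ + _)%N.
  by rewrite /residue; do ?case: eqP => /=; lia.
by lia.
Qed.

(** Four consecutive rows contribute exactly [M]; each of the at most three further rows costs an
    error of 3, whence the 9. *)
Lemma box_count_bounds c N M : (c < 4)%N ->
  (4 * box_count c N M <= N * M + 9)%N /\ (N * M <= 4 * box_count c N M + 9)%N.
Proof.
move=> c4; have [a [b [-> b4]]] : exists a b, N = (a * 4 + b)%N /\ (b < 4)%N.
  by exists (N %/ 4)%N, (N %% 4)%N; rewrite -divn_eq ltn_mod.
elim: a => [|a IH].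
  have R x := row_count_bounds x M c4.
  rewrite /box_count mul0n add0n; move: b b4 => [|[|[|[|//]]]] _; rewrite ?big_ord_recr ?big_ord0 /=;
    have := R 0%N; have := R 1%N; have := R 2%N; lia.
have := IH.
have -> : (a.+1 * 4 + b = (a * 4 + b) + 4)%N by lia.
have -> : box_count c (a * 4 + b + 4) M = (box_count c (a * 4 + b) M + M)%N.
  rewrite /box_count !addnS addn0 !big_ord_recr /= -!addnA; congr (_ + _)%N.
  rewrite /row_count -!big_split/=; transitivity (\sum_(j < M) 1)%N; last by rewrite sum_nat_const card_ord muln1.
  by apply: eq_bigr => j _; rewrite /residue; do ?case: eqP => /=; lia.
by rewrite mulnDl; lia.
Qed.

Lemma odd_count M : (\sum_(j < M) odd j = M %/ 2)%N.
Proof.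
elim: M => [|M IH]; first by rewrite big_ord0.
by rewrite big_ord_recr/= IH; have := modn2 M; lia.
Qed.

(** * Sums over the inner rectangle *)

Section BoxSums.
Variables N M : nat.

Definition box_sum (g : nat -> nat -> nat) : nat := (\sum_(i < N) \sum_(j < M) g i j)%N.

Lemma box_sumD g h : box_sum (fun i j => g i j + h i j)%N = (box_sum g + box_sum h)%N.
Proof. by rewrite /box_sum -big_split/=; apply: eq_bigr => i _; rewrite big_split. Qed.

Lemma eq_box_sum g h : (forall i j, (i < N)%N -> (j < M)%N -> g i j = h i j) -> box_sum g = box_sum h.
Proof. by move=> gh; rewrite /box_sum; apply: eq_bigr => i _; apply: eq_bigr => j _; apply: gh. Qed.

Lemma box_sum_row x g : (x < N)%N -> box_sum (fun i j => (i == x) * g i j)%N = (\sum_(j < M) g x j)%N.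
Proof.
move=> xN; rewrite /box_sum (bigD1 (Ordinal xN))//= [X in (_ + X)%N]big1 ?addn0 => [|i ix].
  by apply: eq_bigr => j _; rewrite eqxx mul1n.
by rewrite big1// => j _; rewrite (_ : (i == x :> nat) = false)//; apply: contraNF ix => /eqP e; apply/eqP/val_inj.
Qed.

Lemma box_sum_col y g : (y < M)%N -> box_sum (fun i j => (j == y) * g i j)%N = (\sum_(i < N) g i y)%N.
Proof.
move=> yM; rewrite /box_sum; apply: eq_bigr => i _; rewrite (bigD1 (Ordinal yM))//= big1 ?addn0 => [|j jy].
  by rewrite eqxx mul1n.
by rewrite (_ : (j == y :> nat) = false)//; apply: contraNF jy => /eqP e; apply/eqP/val_inj.
Qed.

Lemma box_sum_residue c : box_sum (fun i j => residue c i j) = box_count c N M.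
Proof. by []. Qed.

(** One summand for each of the four directions in which the neighbour may be off the box or in
    another slab: residue 3 ends a slab in the increasing directions, residue 0 in the decreasing
    ones. *)
Definition exposures (i j : nat) : nat :=
  ((i.+1 == N) || residue 3 i j) + ((i == 0%N) || residue 0 i j) +
  (((j.+1 == M) || residue 3 i j) + ((j == 0%N) || residue 0 i j)).

Definition caps (i j : nat) : bool :=
  if residue 0 i j then (i.+1 < N)%N && (j.+1 < M)%N else [&& residue 3 i j, (0 < i)%N & (0 < j)%N].

(** Inclusion-exclusion along the border. In [capE], the squares of residues 0 and 3 lose those on
    two sides of the box, with a correction at the corner common to both; in [expE], each residue
    counts twice and each side once, minus overlaps. A side has a quarter of its squares in a given
    class, up to a bounded error. *)
Lemma box_sum_bounds : (1 < N)%N -> (1 < M)%N ->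
  let b := box_sum (fun i j => caps i j) in
  [/\ (2 * b + N + M <= N * M + 20)%N, (N * M <= 2 * b + N + M + 20)%N,
     (2 * box_sum exposures <= 4 * b + 5 * (N + M) + 40)%N &
     (4 * b + 5 * (N + M) <= 2 * box_sum exposures + 40)%N].
Proof.
move=> N1 M1 b.
have n1 : (N.-1 < N)%N by lia. have m1 : (M.-1 < M)%N by lia.
have n0 : (0 < N)%N by lia. have m0 : (0 < M)%N by lia.
pose row x c := box_sum (fun i j => (i == x) * residue c i j)%N.
pose col y c := box_sum (fun i j => (j == y) * residue c i j)%N.
have rowB x c : (x < N)%N -> (c < 4)%N -> (4 * row x c <= M + 3)%N /\ (M <= 4 * row x c + 3)%N.
  by move=> xN; rewrite /row (box_sum_row (fun i j => residue c i j : nat) xN); exact: row_count_bounds.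
have colB y c : (y < M)%N -> (c < 4)%N -> (4 * col y c <= N + 3)%N /\ (N <= 4 * col y c + 3)%N.
  move=> yM; rewrite /col (box_sum_col (fun i j => residue c i j : nat) yM).
  rewrite (_ : (\sum_(i < N) residue c i y)%N = row_count c y N); first exact: row_count_bounds.
  by apply: eq_bigr => i _; rewrite /residue addnC.
have row1 x : (x < N)%N -> box_sum (fun i j => (i == x) * 1)%N = M.
  by move=> xN; rewrite (box_sum_row (fun _ _ => 1%N) xN) sum_nat_const card_ord muln1.
have col1 y : (y < M)%N -> box_sum (fun i j => (j == y) * 1)%N = N.
  by move=> yM; rewrite (box_sum_col (fun _ _ => 1%N) yM) sum_nat_const card_ord muln1.
pose corner x y c := box_sum (fun i j => (i == x) * ((j == y) * residue c i j))%N.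
have cornerB x y c : (x < N)%N -> (y < M)%N -> (corner x y c <= 1)%N.
  move=> xN yM; rewrite /corner (box_sum_row (fun i j => (j == y) * residue c i j)%N xN).
  rewrite (bigD1 (Ordinal yM))//= big1 ?addn0 => [|j jy]; first by rewrite eqxx mul1n leq_b1.
  by rewrite (_ : (j == y :> nat) = false)//; apply: contraNF jy => /eqP e; apply/eqP/val_inj.
have capE : (b + (row N.-1 0 + col M.-1 0 + (row 0 3 + col 0 3)) =
    box_count 0 N M + box_count 3 N M + (corner N.-1 M.-1 0 + corner 0 0 3))%N.
  rewrite /b /row /col /corner -!box_sum_residue -!box_sumD; apply: eq_box_sum => i j iN jM.
  rewrite /caps; have r03 : ~~ (residue 0 i j && residue 3 i j) by rewrite /residue; case: eqP => // ->.
  have -> : (i == N.-1) = (i.+1 == N) by apply/eqP/eqP; lia.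
  have -> : (j == M.-1) = (j.+1 == M) by apply/eqP/eqP; lia.
  have -> : (i.+1 < N)%N = (i.+1 != N) by rewrite ltn_neqAle iN andbT.
  have -> : (j.+1 < M)%N = (j.+1 != M) by rewrite ltn_neqAle jM andbT.
  rewrite !lt0n; move: r03.
  by do 2!case: residue => //; do 4!case: eqP => _.
have expE : (box_sum exposures + (row N.-1 3 + col M.-1 3 + (row 0 0 + col 0 0)) =
    box_count 0 N M + box_count 0 N M + (box_count 3 N M + box_count 3 N M) + (M + N + (M + N)))%N.
  have -> : (M + N + (M + N) = box_sum (fun i j => (i == N.-1) * 1) + box_sum (fun i j => (j == M.-1) * 1) +
      (box_sum (fun i j => (i == 0%N) * 1) + box_sum (fun i j => (j == 0%N) * 1)))%N.
    by rewrite !row1// !col1.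
  rewrite /row /col -!box_sum_residue -!box_sumD; apply: eq_box_sum => i j iN jM.
  have -> : (i == N.-1) = (i.+1 == N) by apply/eqP/eqP; lia.
  have -> : (j == M.-1) = (j.+1 == M) by apply/eqP/eqP; lia.
  by rewrite /exposures; do 2!case: residue => //; do 4!case: eqP => _.
have := rowB _ 0%N n1 isT; have := colB _ 0%N m1 isT; have := rowB _ 3%N n0 isT; have := colB _ 3%N m0 isT.
have := rowB _ 3%N n1 isT; have := colB _ 3%N m1 isT; have := rowB _ 0%N n0 isT; have := colB _ 0%N m0 isT.
have := cornerB _ _ 0%N n1 m1; have := cornerB _ _ 3%N n0 m0.
have [] := @box_count_bounds 0 N M isT; have [] := @box_count_bounds 3 N M isT.
by split; lia.
Qed.

End BoxSums.

(** * Vertices, tetrahedra and bipyramids of the coned grid *)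

Section GridCounting.
Variables (P Q : nat).
Hypotheses (P4 : (3 < P)%N) (Q4 : (3 < Q)%N).
Local Notation slabs := (slabs P Q).
Local Notation point := ('I_P + 'I_Q)%type.
Local Notation vertex := (point + 'I_slabs)%type.
Local Notation square := ('I_P * 'I_Q)%type.
Local Notation grid_complex := (coned (@corners P Q) (@final_owner P Q)).
Implicit Types q : square.
Local Notation last_lt := (last_lt P4 Q4).

Let sum_inner (F : nat -> nat -> nat) :
  (\sum_(q : square | inner q) F q.1 q.2 = box_sum P.-1 Q.-1 F)%N.
Proof.
rewrite /box_sum (big_ord_widen P (fun i => \sum_(j < Q.-1) F i j)%N (leq_pred P)).
rewrite -(pair_big (fun i : 'I_P => i.+1 < P)%N (fun j : 'I_Q => j.+1 < Q)%N (fun i j => F i j))/=.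
apply: eq_big => [i|i _]; first by apply/idP/idP; lia.
rewrite (big_ord_widen Q (fun j => F i j) (leq_pred Q)).
by apply: eq_bigl => j; apply/idP/idP; lia.
Qed.

Lemma grid_bips : #|bip_index P Q| = (box_sum P.-1 Q.-1 (fun i j => caps P.-1 Q.-1 i j) + Q.-1 %/ 2)%N.
Proof.
rewrite card_sum !card_sig -sum_inner -odd_count; congr (_ + _)%N.
  rewrite -sum1_card big_mkcond [RHS]big_mkcond/=; apply: eq_bigr => -[i j] _.
  rewrite -[_ \in _]/(capped (i, j)) /capped /caps /lower /inner /residue /=.
  have -> : (i.+1 < P.-1)%N = (i.+2 < P)%N by rewrite ltn_predRL.
  have -> : (j.+1 < Q.-1)%N = (j.+2 < Q)%N by rewrite ltn_predRL.
  have wk m n : (m.+2 < n)%N -> (m.+1 < n)%N by exact: ltnW.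
  case: (_ == 0)%N; last by case: (_ == 3)%N; case: (i.+1 < P)%N; case: (j.+1 < Q)%N; do 2!case: (0 < _)%N.
  by have := wk i P; have := wk j Q; do 4!case: (_ < _)%N => //; move=> h1 h2; rewrite ?h1 ?h2.
rewrite (big_ord_widen Q (fun j => odd j : nat) (leq_pred Q)) -sum1_card.
rewrite big_mkcond [RHS]big_mkcond/=; apply: eq_bigr => j _.
rewrite -[_ \in _]/(odd j && (j.+1 < Q)%N) ltn_predRL.
by case: odd; case: ltnP.
Qed.

Lemma grid_vertices : #|[set v : vertex | [set v]%SET \in grid_complex]%SET| = (P + Q + slabs)%N.
Proof.
have h0 : (0 < Q)%N by lia.
have -> : [set v : vertex | [set v]%SET \in grid_complex]%SET = [set: vertex]%SET.
  apply/setP => v; rewrite finset.in_setT [LHS]finset.in_set; case: v => [[x|y]|k].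
  - have lQ : (Q.-1 < Q)%N by lia.
    apply: (@mem_outer P Q _ (x, Ordinal lQ)); first by rewrite /inner/=; lia.
      by move=> k; rewrite finset.inE.
    by apply/fintype.subsetP => w; rewrite !finset.inE => /eqP[->]; apply/edgeP; left.
  - apply: (@mem_outer P Q _ (Ordinal last_lt, y)); first by rewrite /inner/=; lia.
      by move=> k; rewrite finset.inE.
    by apply/fintype.subsetP => w; rewrite !finset.inE => /eqP[->]; apply/edgeP; left.
  - have := ltn_ord k; rewrite ltnS => kK.
    (* An inner square of index sum [4 * k], showing that no slab is empty. *)
    have iP : (minn (4 * k) (P - 2) < P)%N by lia.
    have jQ : (4 * k - minn (4 * k) (P - 2) < Q)%N by lia.
    pose q : square := (Ordinal iP, Ordinal jQ).
    have qi : inner q by rewrite /inner/=; lia.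
    have e0 t : base_part [set inr k : vertex]%SET \subset corners t.
      by apply/fintype.subsetP => w; rewrite !finset.inE.
    apply: (@mem_exposed P Q _ q (Ordinal last_lt, Ordinal h0) k) => //.
    + apply/final_ownerP; split=> //; apply: ord_inj; rewrite slab_val//=; lia.
    + by apply/final_owner_neq; rewrite /inner/=; lia.
    + by move=> k'; rewrite finset.inE => /eqP[].
by rewrite cardsT !card_sum !card_ord.
Qed.

(* The triangle [corners q :\ w] is on the boundary of the slab of [q]. *)
Definition exposed (q : square) (w : point) : bool :=
  inner q && match w with
  | inl x => if x == q.1 then (q.1.+2 == P) || residue 3 q.1 q.2
             else (x == ordS q.1) && ((q.1 == 0%N :> nat) || residue 0 q.1 q.2)
  | inr y => if y == q.2 then (q.2.+2 == Q) || residue 3 q.1 q.2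
             else (y == ordS q.2) && ((q.2 == 0%N :> nat) || residue 0 q.1 q.2)
  end.

Lemma exposed_corner q w : exposed q w -> w \in corners q.
Proof.
case: w => [x|y] /andP[_]; rewrite ?corners_inl ?corners_inr edge_ordS; case: ifP => //= _ /andP[->//].
Qed.

(** Abstract lengths [n] and [m] let the same computation serve both cycles, with the coordinates
    exchanged. *)
Let exposed_next n m a b a' : (a.+1 < n)%N -> (b.+1 < m)%N -> (a' < n)%N -> a' <> a ->
  edge n a' a.+1 -> (a.+2 == n) || residue 3 a b =
  ~~ [&& (a'.+1 < n)%N, (b.+1 < m)%N & (a' + b) %/ 4 == (a + b) %/ 4]%N.
Proof.
move=> an bm an' aa' /edgeP e; have -> : a' = a.+1 by lia.
by rewrite bm /residue; clear -an; apply/idP/idP; lia.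
Qed.

Let exposed_prev n m a b a' : (a.+1 < n)%N -> (b.+1 < m)%N -> (a' < n)%N -> a' <> a ->
  edge n a' a -> (a == 0%N) || residue 0 a b =
  ~~ [&& (a'.+1 < n)%N, (b.+1 < m)%N & (a' + b) %/ 4 == (a + b) %/ 4]%N.
Proof.
move=> an bm an' aa' /edgeP e; rewrite bm /residue.
have [a0|a0] := posnP a.
  have -> : a' = n.-1 by lia.
  by case: (ltnP n.-1.+1 n) => //=; clear -an; lia.
have -> : a' = a.-1 by lia.
by clear -a0 an; apply/idP/idP; lia.
Qed.

Let edge_other n a a' : (2 < n)%N -> (a.+1 < n)%N -> (a' < n)%N ->
  edge n a' a -> edge n a' a.+1 -> a' = a.
Proof. by move=> n2 an an' /edgeP e /edgeP e'; lia. Qed.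

(** The neighbour opposite to [w] is unique: the first endpoint of an edge is opposite to the next
    square in that direction, the second endpoint to the previous one. The formula for [exposed]
    tests whether this neighbour has another owner. *)
Lemma exposed_owner q q' w : inner q -> w \in corners q -> q' != q -> (corners q :\ w \subset corners q')%SET ->
  exposed q w = (final_owner q' != Some (slab q)).
Proof.
case: q q' => [a b] [a' b'] qi wq q'q /fintype.subsetP sub.
have [/= oi oj] : ((a, b).1.+1 < P)%N /\ ((a, b).2.+1 < Q)%N by apply/andP.
have [P1 Q1] : (1 < P)%N /\ (1 < Q)%N by clear -P4 Q4; lia.
have [P2 Q2] : (2 < P)%N /\ (2 < Q)%N by clear -P4 Q4; lia.
have s1 := ordSE oi; have s2 := ordSE oj.
have n1 := ordS_neq a P1; have n2 := ordS_neq b Q1.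
have mem v : v \in corners (a, b) -> v != w -> v \in corners (a', b').
  by move=> vq vw; apply: sub; rewrite finset.in_setD1 vw.
have m1 : inl a != w -> edge P a' a.
  by move=> /(mem (inl a)); rewrite !corners_inl; apply; rewrite /edge eqxx.
have m2 : inl (ordS a) != w -> edge P a' a.+1.
  by move=> /(mem (inl (ordS a))); rewrite !corners_inl s1; apply; apply/edgeP; right; left.
have m3 : inr b != w -> edge Q b' b.
  by move=> /(mem (inr b)); rewrite !corners_inr; apply; rewrite /edge eqxx.
have m4 : inr (ordS b) != w -> edge Q b' b.+1.
  by move=> /(mem (inr (ordS b))); rewrite !corners_inr s2; apply; apply/edgeP; right; left.
have own : (final_owner (a', b') != Some (slab (a, b))) =
    ~~ [&& (a'.+1 < P)%N, (b'.+1 < Q)%N & (a' + b') %/ 4 == (a + b) %/ 4]%N.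
  rewrite andbA -/(inner (a', b')) /final_owner; case: ifP => // q'i.
  by rewrite slab_eq.
rewrite own /exposed qi {own sub mem}/=.
case: w wq m1 m2 m3 m4 => [x|y] wq m1 m2 m3 m4.
  have eb : b' = b :> nat by apply: (edge_other Q2) => //; [exact: m3|exact: m4].
  have na : a' <> a :> nat.
    by move=> /ord_inj ea; move: q'q; rewrite ea (ord_inj eb) eqxx.
  rewrite eb; move: wq; rewrite corners_inl edge_ordS => /orP[]/eqP/= xe; rewrite xe.
    rewrite eqxx; apply: exposed_next => //; apply: m2.
    by rewrite (inj_eq (@inl_inj _ _)) xe.
  rewrite (negPf n1) eqxx; apply: exposed_prev => //; apply: m1.
  by rewrite (inj_eq (@inl_inj _ _)) xe eq_sym.
have ea : a' = a :> nat by apply: (edge_other P2) => //; [exact: m1|exact: m2].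
have nb : b' <> b :> nat.
  by move=> /ord_inj eb; move: q'q; rewrite eb (ord_inj ea) eqxx.
rewrite ea andbCA [(a + b')%N]addnC [X in (_ == X %/ 4)%N]addnC.
have rC c : residue c a b = residue c b a by rewrite /residue addnC.
rewrite !rC; move: wq; rewrite corners_inr edge_ordS => /orP[]/eqP/= xe; rewrite xe.
  rewrite eqxx; apply: exposed_next => //; apply: m4.
  by rewrite (inj_eq (@inr_inj _ _)) xe.
rewrite (negPf n2) eqxx; apply: exposed_prev => //; apply: m3.
by rewrite (inj_eq (@inr_inj _ _)) xe eq_sym.
Qed.

Lemma exists_neighbor q w : w \in corners q -> exists2 q', q' != q & (corners q :\ w \subset corners q')%SET.
Proof.
have [P1 Q1] : (1 < P)%N /\ (1 < Q)%N by lia.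
have pred_neq n (x : 'I_n) : (1 < n)%N -> ord_pred x != x.
  by move=> n1; apply/eqP => /(congr1 (@nat_of_ord n)); rewrite ord_pred_val; case: ifP; have := ltn_ord x; lia.
have step n (x y : 'I_n) : edge n x y -> y != x -> edge n (ordS x) y.
  by rewrite edge_ordS => /orP[->//|/eqP-> _]; rewrite /edge eqxx.
have back n (x y : 'I_n) : edge n x y -> y != ordS x -> edge n (ord_pred x) y.
  rewrite edge_ordS => /orP[/eqP-> _|->//]; rewrite edge_ordS.
  by rewrite (_ : ordS (ord_pred x) = x) ?eqxx ?orbT//; exact: ord_predK.
case: w => [x|y]; rewrite ?corners_inl ?corners_inr edge_ordS => /orP[]/eqP->.
- exists (ordS q.1, q.2).
    by rewrite [q in _ != q]surjective_pairing xpair_eqE negb_and ordS_neq.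
  apply/fintype.subsetP => -[z|z] /finset.setD1P[]; rewrite ?corners_inl ?corners_inr//.
  by rewrite (inj_eq (@inl_inj _ _)) => zx e; exact: step.
- exists (ord_pred q.1, q.2).
    by rewrite [q in _ != q]surjective_pairing xpair_eqE negb_and pred_neq.
  apply/fintype.subsetP => -[z|z] /finset.setD1P[]; rewrite ?corners_inl ?corners_inr//.
  by rewrite (inj_eq (@inl_inj _ _)) => zx e; exact: back.
- exists (q.1, ordS q.2).
    by rewrite [q in _ != q]surjective_pairing xpair_eqE negb_and ordS_neq ?orbT.
  apply/fintype.subsetP => -[z|z] /finset.setD1P[]; rewrite ?corners_inl ?corners_inr//.
  by rewrite (inj_eq (@inr_inj _ _)) => zx e; exact: step.
- exists (q.1, ord_pred q.2).
    by rewrite [q in _ != q]surjective_pairing xpair_eqE negb_and pred_neq ?orbT.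
  apply/fintype.subsetP => -[z|z] /finset.setD1P[]; rewrite ?corners_inl ?corners_inr//.
  by rewrite (inj_eq (@inr_inj _ _)) => zx e; exact: back.
Qed.

Let card_exposed : #|[set p : square * point | exposed p.1 p.2]%SET| =
  box_sum P.-1 Q.-1 (exposures P.-1 Q.-1).
Proof.
rewrite -sum_inner -sum1_card.
under eq_bigl do rewrite finset.inE.
rewrite -(pair_big_dep xpredT exposed (fun _ _ => 1%N))/= [RHS]big_mkcond/=.
apply: eq_bigr => q _; case: ifP => qi; last first.
  by rewrite big1// => w /andP[]; rewrite qi.
have [oi oj] : (q.1.+1 < P)%N /\ (q.2.+1 < Q)%N by apply/andP.
have [P1 Q1] : (1 < P)%N /\ (1 < Q)%N by lia.
have n1 := ordS_neq q.1 P1; have n2 := ordS_neq q.2 Q1.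
rewrite big_sumType/= /exposures; congr (_ + _)%N.
  rewrite big_mkcond (bigD1 q.1)//= (bigD1 (ordS q.1))//= big1 ?addn0 => [|x /andP[x1 x2]].
    rewrite /exposed qi eqxx (negPf n1) eqxx/=.
    have -> : (q.1.+1 == P.-1) = (q.1.+2 == P) by apply/eqP/eqP; lia.
    by do 2!case: (_ || _).
  by rewrite /exposed (negPf x1) (negPf x2) andbF.
rewrite big_mkcond (bigD1 q.2)//= (bigD1 (ordS q.2))//= big1 ?addn0 => [|x /andP[x1 x2]].
  rewrite /exposed qi eqxx (negPf n2) eqxx/=.
  have -> : (q.2.+1 == Q.-1) = (q.2.+2 == Q) by apply/eqP/eqP; lia.
  by do 2!case: (_ || _).
by rewrite /exposed (negPf x1) (negPf x2) andbF.
Qed.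

Let card_outer : #|[set q : square | ~~ inner q]%SET| = (P + Q - 1)%N.
Proof.
have h : #|[set q : square | inner q]%SET| = (P.-1 * Q.-1)%N.
  rewrite -sum1_card; under eq_bigl do rewrite finset.inE.
  rewrite (sum_inner (fun _ _ => 1%N)) /box_sum.
  by under eq_bigr do rewrite sum_nat_const card_ord muln1; rewrite sum_nat_const card_ord.
have := cardsC [set q : square | inner q]%SET; rewrite h card_prod !card_ord.
rewrite (_ : ~: _ = [set q : square | ~~ inner q])%SET; last by apply/setP => q; rewrite !finset.inE.
case: P Q P4 Q4 => [|p] [|r]// _ _; rewrite mulSn mulnS /=; clear; lia.
Qed.

(** The facets are of two kinds: [f q] for a square outside the slabs, and [g (q, w)], the cone over
    a boundary triangle of a slab. The tetrahedron of an inner square is interior to its slab and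
    hence gone. *)
Lemma grid_tets : #|[set s : {set vertex} in grid_complex | #|s| == 4%N]%SET| =
  (P + Q - 1 + box_sum P.-1 Q.-1 (exposures P.-1 Q.-1))%N.
Proof.
pose f q : {set vertex} := [set inl w | w in corners q]%SET.
pose g (p : square * point) : {set vertex} := (inr (slab p.1) |: [set inl w | w in corners p.1 :\ p.2])%SET.
have inlI : injective (@inl point 'I_slabs) by move=> ? ? [].
have base_f q : base_part (f q) = corners q.
  by apply/setP => w; rewrite finset.inE mem_imset.
have apex_f q k : inr k \notin f q by apply/imsetP => -[].
have base_g p : base_part (g p) = (corners p.1 :\ p.2)%SET.
  by apply/setP => w; rewrite finset.inE finset.in_setU1/= mem_imset.
have apex_g p k : inr k \in g p -> k = slab p.1.
  by rewrite finset.in_setU1 => /predU1P[[]//|/imsetP[]].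
have slab_g p : inr (slab p.1) \in g p by rewrite finset.in_setU1 eqxx.
have fI : injective f.
  by move=> q q' e; apply/esym/(corners_sub_inj P4 Q4); rewrite -(base_f q) -(base_f q') e.
have card_g p : p.2 \in corners p.1 -> #|g p| = 4%N.
  move=> pc; rewrite cardsU1 card_imset// (_ : inr _ \notin _); last by apply/imsetP => -[].
  by have := card_corners P4 Q4 p.1; rewrite (cardsD1 p.2) pc.
have gS p : exposed p.1 p.2 -> g p \in grid_complex.
  move=> ex; have pc := exposed_corner ex; have /andP[pi _] := ex.
  have [q' q'p sub] := exists_neighbor pc.
  apply: (@mem_exposed P Q _ p.1 q' (slab p.1)); rewrite ?base_g//.
  - exact/final_ownerP.
  - by rewrite -(exposed_owner pi pc q'p sub).
  - by move=> k; exact: apex_g.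
  - exact: finset.subD1set.
have gI : {in [set p : square * point | exposed p.1 p.2]%SET &, injective g}.
  move=> [q w] [q' w']; rewrite !finset.inE/= => ex ex' e.
  have wq := exposed_corner ex; have wq' := exposed_corner ex'.
  have /andP[qi _] := ex; have /andP[q'i _] := ex'.
  have es : slab q' = slab q.
    by apply: (apex_g (q, w)); rewrite e; exact: (slab_g (q', w')).
  have eb : (corners q :\ w = corners q' :\ w')%SET.
    by rewrite -(base_g (q, w)) -(base_g (q', w')) e.
  have qq' : q' = q.
    apply/eqP; apply: contraT => q'q.
    have sub : (corners q :\ w \subset corners q')%SET by rewrite eb finset.subD1set.
    move: ex; rewrite (exposed_owner qi wq q'q sub) => /negP[].
    by apply/eqP/final_ownerP.
  subst q'; congr pair; apply/eqP; apply: contraT => ww'.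
  have : w \in (corners q :\ w')%SET by rewrite finset.in_setD1 ww'.
  by rewrite -eb finset.in_setD1 eqxx.
rewrite -card_outer -card_exposed -(card_imset _ fI) -(card_in_imset gI).
rewrite -cardsUI [X in (_ + X)%N](_ : _ = 0%N) ?addn0; last first.
  apply/eqP; rewrite cards_eq0; apply/eqP/setP => s; rewrite finset.in_setI finset.in_set0.
  apply/negP => /andP[/imsetP[q _ ->] /imsetP[p _ e]].
  by have := apex_f q (slab p.1); rewrite e slab_g.
apply: eq_card => s; rewrite finset.in_setU [LHS]finset.in_set; apply/idP/idP; last first.
  case/orP => /imsetP[]; last first.
    move=> p; rewrite finset.in_set => ex ->; rewrite gS//= card_g//.
    exact: exposed_corner.
  move=> q; rewrite finset.in_set => qo ->.
  rewrite card_imset// (card_corners P4 Q4) eqxx andbT.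
  by apply: (mem_outer qo); rewrite ?base_f// => k; exact: apex_f.
move=> /andP[/conedP[[q sq] h2 h3 h4] /eqP s4].
have [/existsP[k ks]|/existsPn na] := boolP [exists k, inr k \in s]; last first.
  have es : s = f q.
    apply/eqP; rewrite eqEcard s4 card_imset// (card_corners P4 Q4) andbT.
    apply/fintype.subsetP => -[w|k] ws; last by have := na k; rewrite ws.
    by rewrite mem_imset//; apply: (fintype.subsetP sq); rewrite finset.inE.
  apply/orP; left; apply/imsetP; exists q => //; rewrite finset.in_set.
  apply/negP => qi; have [q' sq' oq'] := h2 (slab q).
  move: oq'; have <- : q' = q by apply: (corners_sub_inj P4 Q4); rewrite -base_f -es.
  by move=> /negP[]; apply/eqP/final_ownerP; split=> //; rewrite (_ : q' = q)//; apply: (corners_sub_inj P4 Q4); rewrite -base_f -es.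
have {sq}[{}q sq /[dup] oq /final_ownerP[qi qk]] := h3 _ ks.
have [q' sq' oq'] := h2 k.
have s3 : #|base_part s| = 3%N.
  have : s = (inr k |: [set inl w | w in base_part s])%SET.
    apply/setP => -[w|k']; rewrite finset.in_setU1/= ?mem_imset// ?finset.inE//.
    rewrite [X in _ || X](_ : _ = false) ?orbF; last by apply/negbTE/imsetP => -[].
    by apply/idP/eqP => [k's|[->]//]; rewrite (h4 _ _ k's ks).
  move=> /(congr1 (fun t : {set vertex} => #|t|)); rewrite s4 cardsU1 card_imset//.
  by rewrite (_ : inr k \notin _); [case|apply/imsetP => -[]].
have [w wq ws] : exists2 w, w \in corners q & w \notin base_part s.
  apply/subsetPn; apply/negP => /subset_leq_card.
  by rewrite s3 (card_corners P4 Q4).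
have eb : base_part s = (corners q :\ w)%SET.
  apply/eqP; rewrite eqEcard finset.subsetD1 sq ws s3/=.
  by have := card_corners P4 Q4 q; rewrite (cardsD1 w) wq add1n => -[->].
have q'q : q' != q by apply: contraNneq oq' => ->; apply/eqP.
apply/orP; right; apply/imsetP; exists (q, w).
  by rewrite finset.in_set/= (exposed_owner qi wq q'q) ?qk// -eb.
apply/setP => -[v|k'].
  by have := base_g (q, w); rewrite -eb => /setP/(_ v); rewrite !finset.inE.
apply/idP/idP => [k's|/apex_g->]; last by rewrite /= qk.
by rewrite (h4 _ _ k's ks) -qk; exact: (slab_g (q, w)).
Qed.

End GridCounting.

(** * From bounded errors to the asymptotic statement *)

Lemma bounded_eqaddo (R : realType) (u : nat -> nat) (a : nat -> R) (C : R) :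
  (forall n, (3 <= n)%N -> `|(u n)%:R - a n| <= C) ->
  (fun n => (u n)%:R : R^o) = (a : nat -> R^o) +o_\oo (fun n => n%:R : R^o).
Proof.
move=> uC; apply/eqaddoP => e e0; near=> n.
have n3 : (3 <= n)%N by near: n; exact: nbhs_infty_ge.
apply: (le_trans (uC n n3)); rewrite normr_nat mulrC -ler_pdivrMr//.
by near: n; exact: nbhs_infty_ger.
Unshelve. all: by end_near. Qed.

(** The factor [p] clears denominators, so that the estimates are left to integer arithmetic. *)
Lemma natr_dist_le (R : realType) (x : nat) (a : R) (p q c : nat) : (0 < p)%N ->
  p%:R * a = q%:R -> (p * x <= q + c)%N -> (q <= p * x + c)%N -> `|x%:R - a| <= c%:R.
Proof.
move=> p0 pa; rewrite -!(ler_nat R) !natrD natrM -pa => h1 h2.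
have p1 : 1 <= p%:R :> R by rewrite ler1n.
have c0 : 0 <= c%:R :> R by [].
rewrite ler_norml; apply/andP; split.
  by rewrite -(ler_pM2l (lt_le_trans ltr01 p1)); nra.
by rewrite -(ler_pM2l (lt_le_trans ltr01 p1)); nra.
Qed.

Theorem theorem4p4 (R : realType) :
  exists (X : nat -> topologicalType)
         (K : forall n : nat, cell_family R (X n)),
    (forall n : nat, (0 < n)%N ->
       [/\ polyhedral_complex (K n), homeomorphic_sphere3 R (X n) &
       forall i : cell (K n), is_facet i ->
          is_tetrahedral_facet i \/ is_bipyramidal_facet i]) /\
    [/\ (fun n : nat => (vertices (K n))%:R : R^o) =
          (fun n : nat => 5 / 2 * n%:R : R^o) +o_\oo (fun n : nat => n%:R : R^o),
        (fun n : nat => (tetrahedra (K n))%:R : R^o) =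
          (fun n : nat => 6 * n%:R : R^o) +o_\oo (fun n : nat => n%:R : R^o) &
        (fun n : nat => (bipyramids (K n))%:R : R^o) =
          (fun n : nat => n%:R ^+ 2 / 2 : R^o) +o_\oo (fun n : nat => n%:R : R^o)].
Proof.
(* Both cycles must have more than 3 vertices; for smaller [n] the sphere of 3 is taken again, which
   the asymptotics do not see. *)
pose m n := maxn n 3.
have P4 n : (3 < (m n).+2)%N by rewrite /m; lia.
have Q4 n : (3 < (m n).+1)%N by rewrite /m; lia.
pose mg n := grid_mergeable (P4 n) (Q4 n).
exists (fun n => classical_sets.set_type (realization R (coned (@corners (m n).+2 (m n).+1) (@final_owner (m n).+2 (m n).+1)))).
exists (fun n => merged_complex R (mg n)); split=> [n _|].
  split.
  - exact: polyhedral_merged.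
  - by apply: homeomorphic_sphere (exists_point R (mg n)) (homeomorphic_coned_sphere R (P4 n) (Q4 n)).
  - exact: facet_merged.
have bip n : bipyramids (merged_complex R (mg n)) = #|bip_index (m n).+2 (m n).+1| by exact: bipyramids_merged.
have tet n := tetrahedra_count R (mg n).
have mE n : (3 <= n)%N -> m n = n by rewrite /m; lia.
have b n : (3 <= n)%N -> exists2 c, (#|bip_index (m n).+2 (m n).+1| = c + n %/ 2)%N &
    [/\ (2 * c + n <= n * n + 21)%N, (n * n <= 2 * c + n + 21)%N,
        (2 * box_sum n.+1 n (exposures n.+1 n) <= 4 * c + 10 * n + 45)%N &
        (4 * c + 10 * n <= 2 * box_sum n.+1 n (exposures n.+1 n) + 40)%N].
  move=> n3; rewrite (grid_bips (P4 n) (Q4 n)) /= mE//.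
  eexists; first reflexivity.
  have [] := @box_sum_bounds n.+1 n _ _; [by lia|by lia|].
  by rewrite mulSn; split; lia.
split.
(* The two cycles have [2n + 3] vertices, and the number of slabs is [n / 2] up to a bounded
   error. *)
- apply: (@bounded_eqaddo _ _ _ 10) => n n3.
  rewrite vertices_merged (grid_vertices (P4 n) (Q4 n)) /slabs mE//.
  apply: (@natr_dist_le _ _ _ 2 (5 * n)) => //; [by rewrite natrM; field|lia|lia].
(* With [c] capped squares, there are [2n + 2] tetrahedra outside the slabs and about [2c + 5n]
   cones over boundary triangles; about [2c + n] of all these are absorbed by bipyramids. *)
- apply: (@bounded_eqaddo _ _ _ 100) => n n3.
  have := tet n; have [c -> [b1 b2 b3 b4]] := b n n3.
  rewrite (grid_tets (P4 n) (Q4 n)) /=; move: (tetrahedra _) => T; rewrite mE// => e.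
  apply: (@natr_dist_le _ _ _ 1 (6 * n)) => //; [by rewrite natrM; field|lia|lia].
- apply: (@bounded_eqaddo _ _ _ 100) => n n3.
  rewrite bip; have [c -> [b1 b2 b3 b4]] := b n n3.
  apply: (@natr_dist_le _ _ _ 2 (n * n)) => //; [by rewrite natrM; field|lia|lia].
Qed.
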